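(* Let $\mathbb{P}_N=\mathbb{P}_N^{\theta,M_N}$ be the measures described in the context and suppose that $\lim_{N\to\infty}p_N=\lim_{N\to\infty}q_N=0$. Then for any $t\in[\theta,\mathsf{M}+\theta]$, $$\lim_{N\to\infty}\frac1{N^2}\log\mathbb{P}_N(\ell_1\le tN)=F_V^{\theta,\mathsf{M}+\theta}-F_V^{\theta,t}.$$ Moreover, if $b_V$ is the rightmost point of the support of $\phi_V^{\theta,\mathsf{M}+\theta}$, then $F_V^{\theta,t}>F_V^{\theta,\mathsf{M}+\theta}$ for $t\in[\theta,b_V)$ and $F_V^{\theta,t}=F_V^{\theta,\mathsf{M}+\theta}$ for $t\in[b_V,\mathsf{M}+\theta]$.
   Context: Measures. For $\theta>0$, $N\in\mathbb{N}$, $M\in\mathbb{Z}_{\ge0}$ let $\mathbb{W}^{\theta,M}_N$ be the set of $(\ell_1,\dots,\ell_N)$ with $\ell_i=\lambda_i+(N-i)\theta$, where $M\ge\lambda_1\ge\cdots\ge\lambda_N\ge0$ are integers. Put $Q_\theta(x)=\frac{\Gamma(x+1)\Gamma(x+\theta)}{\Gamma(x)\Gamma(x+1-\theta)}$ and, for $\vec\ell\in\mathbb{W}^{\theta,M_N}_N$, $$\mathbb{P}_N^{\theta,M_N}(\vec\ell)=\frac1{Z_N}\prod_{1\le i<j\le N}Q_\theta(\ell_i-\ell_j)\prod_{i=1}^N\exp(-NV_N(\ell_i/N)),$$ with $Z_N$ the normalization constant. Assumptions. (1) $\theta>0$, $A_0\ge a_0>0$, $\mathsf{M}\in[a_0,A_0]$;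 $M_N\in\mathbb{Z}_{\ge0}$ and $0\le q_N\le1$ are sequences with $|N^{-1}M_N-\mathsf{M}|\le A_1q_N$ for some $A_1>0$. (2) $V_N$ is continuous on $I_N=[0,M_NN^{-1}+(N-1)N^{-1}\theta]$. $V$ is a continuous function on $I=[0,\mathsf{M}+\theta]$, extended to $[0,\infty)$ by $V(x)=V(\mathsf{M}+\theta)$ for $x\ge\mathsf{M}+\theta$. There are a sequence $p_N\ge0$ and constants $A_2,A_3,A_4>0$ with $|V_N(s)-V(s)|\le A_2p_N$ for $s\in I_N$, and $|V(s)|\le A_3$ for $s\in I$. $V$ is differentiable on $(0,\mathsf{M}+\theta)$ with $|V'(s)|\le A_4\left[1+|\log|s||+|\log|s-\mathsf{M}-\theta||\right]$ there. Equilibrium measures. For $s\in[\theta,\infty)$ let $\mathcal{A}^\theta_s$ be the set of $\phi\in L^1([0,s])$ with $0\le\phi\le\theta^{-1}$ a.e. and $\int_0^s\phi=1$. $\phi_V^{\theta,s}$ is the (known to exist) unique minimizer over $\mathcal{A}^\theta_s$ of $$I_V^\theta(\phi)=-\theta\iint\log|x-y|\phi(x)\phi(y)\,dx\,dy+\int V(x)\phi(x)\,dx,$$ and $F_V^{\theta,s}:=I_V^\theta(\phi_V^{\theta,s})=\inf_{\phi\in\mathcal{A}^\theta_s}I_V^\theta(\phi)\in\mathbb{R}$. *)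

(* Defs.v *)
From mathcomp Require Import all_boot all_order all_algebra.
From mathcomp Require Import all_classical all_reals all_analysis.

Set Implicit Arguments.
Unset Strict Implicit.
Unset Printing Implicit Defensive.

Import Order.TTheory GRing.Theory Num.Theory.
Import numFieldNormedType.Exports.

Local Open Scope classical_set_scope.
Local Open Scope ring_scope.

(* Euler's integral: it is the Gamma function for 0 < x only, which covers
   every argument that occurs in [interaction] at x = l_i - l_j >= theta. *)
Definition Gamma (R : realType) (x : R) : R :=
  \int[@lebesgue_measure R]_(t in `]0%R, +oo[) ((t `^ (x - 1)) * expR (- t)).

Definition interaction (R : realType) (theta x : R) : R :=
  Gamma (x + 1) * Gamma (x + theta) / (Gamma x * Gamma (x + 1 - theta)).

(* The particles l_1 > ... > l_N are encoded by the integers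
   M >= lambda_1 >= ... >= lambda_N >= 0 from which they are built.  Indices
   start at 0: [particle theta lambda i] is l_(i+1), whence N - (i + 1). *)
Definition particle (R : realType) (theta : R) (N M : nat)
    (lambda : {ffun 'I_N -> 'I_M.+1}) (i : 'I_N) : R :=
  (lambda i)%:R + (N - i.+1)%:R * theta.

Definition configurations (N M : nat) : {set {ffun 'I_N -> 'I_M.+1}} :=
  [set lambda : {ffun 'I_N -> 'I_M.+1} |
    [forall i : 'I_N, forall j : 'I_N,
      (i <= j)%N ==> (lambda j <= lambda i)%N]]%SET.

Definition gibbs_weight (R : realType) (theta : R) (N M : nat) (VN : R -> R)
    (lambda : {ffun 'I_N -> 'I_M.+1}) : R :=
  (\prod_(i < N) \prod_(j < N | (i < j)%N)
     interaction theta (particle theta lambda i - particle theta lambda j)) *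
  \prod_(i < N) expR (- N%:R * VN (particle theta lambda i / N%:R)).

Definition partition_function (R : realType) (theta : R) (N M : nat)
    (VN : R -> R) : R :=
  \sum_(lambda in configurations N M) gibbs_weight theta VN lambda.

Definition gibbs_prob (R : realType) (theta : R) (N M : nat) (VN : R -> R)
    (E : pred {ffun 'I_N -> 'I_M.+1}) : R :=
  \sum_(lambda in configurations N M | E lambda)
    gibbs_weight theta VN lambda / partition_function theta N M VN.

(* Elements of L^1([0, s]) are represented by functions on the whole line
   whose values outside [0, s] are irrelevant. *)
Definition admissible (R : realType) (theta s : R) : set (R -> R) :=
  [set phi : R -> R |
    [/\ (@lebesgue_measure R).-integrable `[0, s] (EFin \o phi),
        {ae @lebesgue_measure R, forall x, x \in `[0, s] ->
          0 <= phi x <= theta^-1}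
      & \int[@lebesgue_measure R]_(x in `[0, s]) phi x = 1]].

Definition energy (R : realType) (theta : R) (V : R -> R) (s : R)
    (phi : R -> R) : R :=
  - theta *
    \int[(@lebesgue_measure R \x @lebesgue_measure R)%E]_(z in
        `[0, s] `*` `[0, s]) (ln `|z.1 - z.2| * phi z.1 * phi z.2) +
  \int[@lebesgue_measure R]_(x in `[0, s]) (V x * phi x).

Definition min_energy (R : realType) (theta : R) (V : R -> R) (s : R) : R :=
  inf [set energy theta V s phi | phi in admissible theta s].

Definition is_equilibrium (R : realType) (theta : R) (V : R -> R) (s : R)
    (phi : R -> R) : Prop :=
  admissible theta s phi /\
  forall psi, admissible theta s psi ->
    energy theta V s phi <= energy theta V s psi.

(* The support of the measure phi(x) dx on [0, s]; unlike the closure of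
   [set x | phi x != 0], it does not depend on the representative of phi. *)
Definition density_support (R : realType) (s : R) (phi : R -> R) : set R :=
  [set x | forall e : R, 0 < e ->
    0 < \int[@lebesgue_measure R]_(y in `]x - e, x + e[ `&` `[0, s]) phi y].

Definition is_rightmost (R : realType) (S : set R) (b : R) : Prop :=
  S b /\ ubound S b.

(* Main.v *)
Require Import Defs.
From HB Require Import structures.
From mathcomp Require Import all_boot all_order all_algebra.
From mathcomp Require Import all_classical all_reals all_analysis.
From mathcomp Require Import measurable_realfun zify ring lra.

Set Implicit Arguments.
Unset Strict Implicit.
Unset Printing Implicit Defensive.

Import Order.TTheory GRing.Theory Num.Theory.
Import numFieldNormedType.Exports.

Local Open Scope classical_set_scope.
Local Open Scope ring_scope.

(** Write [y i] for the rescaled particles l_(i+1) / N.  From the convexity of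
    ln Gamma and the functional equation of Gamma, ln (Q_theta x) differs from
    2 theta ln x by O(1/x), uniformly on [theta, +oo).  Hence the weight of a
    configuration is exp (N^2 (theta ln N - H(y) + o(1))), where H(y) is the
    energy of the empirical measure of the [y i] ([ln_gibbs_weight_bounds]).
    There are only (M + 1)^N = exp (o(N^2)) configurations, so the logarithm of
    a sum of weights is governed by the least H(y) that occurs in it.

    The particles are at distance at least theta / N from each other.  Spreading
    the mass 1 / N of each of them over an interval of length theta / N yields a
    density bounded by 1 / theta, with nearly the same energy
    ([discrete_energy_ge]).  Conversely, the quantiles of a density bounded by
    1 / theta are theta / N apart, and rounding them gives a configuration
    ([quantile_configuration]).  So the sum of the weights with l_1 <= t N is
    exp (N^2 (theta ln N - F_t + o(1))), where F_t is the least energy on [0, t]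
    ([ln_restricted_partition]).  The probability is the quotient of two such
    sums, for t and for Mbar + theta; the terms theta ln N cancel.

    The singularity of the logarithm is handled by truncating it at a distance
    [d]: for a density bounded by 1 / theta this costs at most 2 d in the energy
    ([log_pair_tlog]), and for a configuration the repulsion of the particles
    bounds the cost by a multiple of the square root of [d]
    ([ln_gibbs_weight_bounds]).  The truncated kernel is Lipschitz, so that sums
    and integrals can be compared by quadrature.

    For the second part, let f be the minimizer on [0, Mbar + theta].  If t >= b,
    then f vanishes almost everywhere beyond t and competes on [0, t], so the two
    minima agree.  If t < b, then f has mass beyond some s > t, where no
    competitor on [0, t] has any.  The logarithmic energy is strictly convex, for
    - ln |x - y| is, up to terms that disappear on differences of densities, a
    positive superposition of products of indicators of intervals
    ([log_kernel_window]).  So a competitor whose energy is close to that of f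
    would give, at the midpoint with f, an energy below the minimum
    ([minimizer_gap]). *)

(** * Euler's integral *)

Section LeftEndpoint.
Context {R : realType}.
Local Notation mu := (@lebesgue_measure R).

(** The fundamental theorem of calculus applies on closed intervals where
    the integrand is continuous; by monotone convergence a bound on them that is
    uniform in [c] passes to an integrand that is singular at [a]. *)
Lemma ge0_integral_itvoc_le (f : R -> \bar R) (a b : R) (C : \bar R) : a < b ->
  measurable_fun [set: R] f -> (forall x, (0 <= f x)%E) ->
  (forall c, a < c < b -> (\int[mu]_(x in `[c, b]) f x <= C)%E) ->
  (\int[mu]_(x in `]a, b]) f x <= C)%E.
Proof.
move=> ab mf f0 fC.
pose F n := [set` `[a + (b - a) / n.+2%:R, b]].
have ba0 : 0 < b - a by rewrite subr_gt0.
have -> : `]a, b]%classic = \bigcup_n F n.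
  apply/seteqP; split=> [x /=|x [n _]]; rewrite /F/= !in_itv/=.
    move=> /andP[ax xb].
    have xa0 : 0 < x - a by rewrite subr_gt0.
    exists (Num.truncn ((b - a) / (x - a))) => //; rewrite /F/= in_itv/= xb andbT.
    rewrite -lerBrDl ler_pdivrMr// mulrC -ler_pdivrMr//.
    have := truncnS_gt ((b - a) / (x - a)) => h.
    by rewrite (le_trans (ltW h))// ler_nat.
  by move=> /andP[h ->]; rewrite (lt_le_trans _ h)// ltrDl divr_gt0.
have ndF : nondecreasing_seq F.
  move=> m n mn; rewrite subsetEset /F => x /=; rewrite !in_itv/=.
  move=> /andP[h ->]; rewrite andbT (le_trans _ h)// lerD2l ler_pM2l//.
  by rewrite lef_pV2 ?posrE// ler_nat.
have F_cvg : (\int[mu]_(x in F i) f x @[i --> \oo] -->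
    \int[mu]_(x in \bigcup_i F i) f x)%E.
  apply: ge0_nondecreasing_set_cvg_integral => // n.
    exact: measurable_itv.
  exact: measurable_funTS.
rewrite -(cvg_lim _ F_cvg)//; apply: lime_le; first exact: cvgP F_cvg.
apply: nearW => n; apply: fC; rewrite ltrDl divr_gt0//=.
by rewrite -ltrBrDl ltr_pdivrMr// ltr_pMr// ltr1n.
Qed.

End LeftEndpoint.

Section Gamma.
Context {R : realType}.
Local Notation mu := (@lebesgue_measure R).

Definition gamma_integrand (x t : R) : R := t `^ (x - 1) * expR (- t).

Lemma gamma_integrand_ge0 (x t : R) : 0 <= gamma_integrand x t.
Proof. by rewrite mulr_ge0 ?powR_ge0 ?expR_ge0. Qed.

Lemma measurable_gamma_integrand (x : R) : measurable_fun [set: R] (gamma_integrand x).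
Proof.
apply: measurable_funM; first exact: measurable_powR.
by apply: measurableT_comp => //; exact: measurableT_comp.
Qed.

Lemma within_continuous_powR (x : R) (D : set R) : D `<=` `]0, +oo[ ->
  {within D, continuous (@powR R ^~ x)}.
Proof.
move=> D0; apply: continuous_in_subspaceT => t /set_mem/D0/= t0.
apply: differentiable_continuous; apply/derivable1_diffP.
exact: derivable_powR.
Qed.

(** The exponential is at most 1 and t^(x-1) has the primitive t^x / x. *)
Lemma gamma_integrand_near0 (x : R) : 0 < x ->
  (\int[mu]_(t in `]0%R, 1%R]) (gamma_integrand x t)%:E < +oo)%E.
Proof.
move=> x0; apply: (@le_lt_trans _ _ (x^-1)%:E); last exact: ltry.
apply: ge0_integral_itvoc_le => //.
- by apply/measurable_EFinP; exact: measurable_gamma_integrand.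
- by move=> t; rewrite lee_fin gamma_integrand_ge0.
move=> c /andP[c0 c1].
apply: (@le_trans _ _ (\int[mu]_(t in `[c, 1%R]) (t `^ (x - 1))%:E)%E).
  apply: ge0_le_integral => //=.
  - by move=> t _; rewrite lee_fin gamma_integrand_ge0.
  - apply: measurable_funTS.
    by apply/measurable_EFinP; exact: measurable_gamma_integrand.
  - apply: measurable_funTS; apply/measurable_EFinP; exact: measurable_powR.
  - move=> t; rewrite in_itv/= => /andP[ct _].
    rewrite lee_fin ler_piMr ?powR_ge0// -expR0 ler_expR.
    by rewrite lerNl oppr0 (le_trans (ltW c0)).
rewrite (@continuous_FTC2 _ _ (fun t => x^-1 * t `^ x))//.
- by rewrite powR1 mulr1 lee_fin gerBl mulr_ge0 ?powR_ge0// invr_ge0 ltW.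
- apply: within_continuous_powR => t /=; rewrite !in_itv/= andbT.
  by move=> /andP[ct _]; rewrite (lt_le_trans c0 ct).
- have cts (u : R) : 0 < u -> {for u, continuous (fun t => x^-1 * t `^ x)}.
    move=> u0; apply: differentiable_continuous; apply/derivable1_diffP.
    apply: derivableM => //; apply: derivable_powR.
    by rewrite in_itv/= u0.
  split.
  + move=> t; rewrite in_itv/= => /andP[ct _]; apply: derivableM => //.
    by apply: derivable_powR; rewrite in_itv/= (lt_trans c0).
  + by apply: cvg_at_right_filter; exact: cts.
  + by apply: cvg_at_left_filter; exact: cts.
- move=> t; rewrite in_itv/= => /andP[ct _].
  have t0 : 0 < t by exact: lt_trans ct.
  rewrite derive1Ml; last by apply: derivable_powR; rewrite in_itv/= t0.
  by rewrite powR_derive1 ?in_itv/= ?t0// mulKf ?gt_eqF.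
Qed.

(** Half of the exponential absorbs the power of t, because
    ln t <= t / k + ln k for every k > 0. *)
Lemma gamma_integrand_le_expR (x : R) : exists2 K : R, 0 < K &
  forall t, 1 <= t -> gamma_integrand x t <= K * expR (- (2^-1 * t)).
Proof.
(* With this k the coefficient of t below is at most 1 / 2. *)
pose k := 2 * `|x - 1| + 1.
have k0 : 0 < k by rewrite ltr_wpDl// mulr_ge0.
exists (expR (`|x - 1| * ln k)) => [|t t1]; first exact: expR_gt0.
have t0 : 0 < t by exact: lt_le_trans t1.
rewrite /gamma_integrand /powR gt_eqF// -!expRD ler_expR.
have lnt : ln t <= t / k + ln k.
  have -> : ln t = ln (t / k) + ln k by rewrite ln_div ?posrE// subrK.
  rewrite lerD2r; have /le_trans -> // : ln (t / k) <= t / k.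
  by apply/ltW/ln_sublinear; rewrite divr_gt0.
have lnt0 : 0 <= ln t by exact: ln_ge0.
have h1 : (x - 1) * ln t <= `|x - 1| * (t / k + ln k).
  by apply: (le_trans (ler_norm _)); rewrite normrM (ger0_norm lnt0) ler_wpM2l.
have h2 : `|x - 1| * (t / k) <= 2^-1 * t.
  rewrite mulrCA (mulrC 2^-1) ler_wpM2l ?(ltW t0)//.
  rewrite ler_pdivrMr// /k; lra.
have -> : - t = - (2^-1 * t) - 2^-1 * t by field.
lra.
Qed.

Lemma gamma_integrand_nearoo (x : R) :
  (\int[mu]_(t in `[1%R, +oo[) (gamma_integrand x t)%:E < +oo)%E.
Proof.
have [K K0 gK] := gamma_integrand_le_expR x.
apply: (@le_lt_trans _ _ (\int[mu]_(t in `[1%R, +oo[) ((2 * K)%:E * (exponential_pdf 2^-1 t)%:E))%E).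
  apply: ge0_le_integral => //=.
  - by move=> t _; rewrite lee_fin gamma_integrand_ge0.
  - apply: measurable_funTS.
    by apply/measurable_EFinP; exact: measurable_gamma_integrand.
  - apply: measurable_funTS; apply/measurable_EFinP.
    by apply: measurable_funM => //; apply: measurable_exponential_pdf.
  - move=> t; rewrite in_itv/= andbT => t1.
    rewrite -EFinM lee_fin exponential_pdfE ?(le_trans _ t1)// mulNr.
    set e := expR _; have -> : 2 * K * (2^-1 * e) = K * e by field.
    exact: gK.
rewrite ge0_integralZl_EFin//=.
- rewrite lte_mul_pinfty// ?lee_fin ?mulr_ge0 ?ltW//.
  rewrite (@le_lt_trans _ _ (\int[mu]_t (exponential_pdf 2^-1 t)%:E)%E)//.
    apply: ge0_subset_integral => //=.
    - by apply/measurable_EFinP; exact: measurable_exponential_pdf.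
    - by move=> t _; rewrite lee_fin exponential_pdf_ge0.
  by rewrite integral_exponential_pdf// ltry.
- by move=> t _; rewrite lee_fin exponential_pdf_ge0.
- apply: measurable_funTS; apply/measurable_EFinP.
  exact: measurable_exponential_pdf.
- by rewrite mulr_ge0 ?ltW.
Qed.

Lemma integrable_gamma_integrand (x : R) : 0 < x ->
  mu.-integrable `]0%R, +oo[ (EFin \o gamma_integrand x).
Proof.
move=> x0; apply/integrableP; split.
  apply: measurable_funTS.
  by apply/measurable_EFinP; exact: measurable_gamma_integrand.
under eq_integral do rewrite /= ger0_norm ?gamma_integrand_ge0//.
rewrite (@itv_bndbnd_setU _ _ _ (BRight 1%R)) ?bnd_simp//.
rewrite ge0_integral_setU//=.
- rewrite lte_add_pinfty//; first exact: gamma_integrand_near0.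
  rewrite integral_itv_obnd_cbnd; first exact: gamma_integrand_nearoo.
  apply: measurable_funTS.
  by apply/measurable_EFinP; exact: measurable_gamma_integrand.
- apply: measurable_funTS.
  by apply/measurable_EFinP; exact: measurable_gamma_integrand.
- by move=> t _; rewrite lee_fin gamma_integrand_ge0.
- apply/disj_setPS => t [/=]; rewrite !in_itv/= => /andP[_ t1].
  by rewrite ltNge t1.
Qed.

Lemma GammaE x : Gamma x = \int[mu]_(t in `]0%R, +oo[) gamma_integrand x t.
Proof. by []. Qed.

Lemma EFin_Gamma (x : R) : 0 < x ->
  (Gamma x)%:E = (\int[mu]_(t in `]0%R, +oo[) (gamma_integrand x t)%:E)%E.
Proof.
move=> x0; rewrite GammaE /Rintegral fineK//.
by apply: integrable_fin_num => //; exact: integrable_gamma_integrand.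
Qed.

(** On [1, 2] the integrand is at least t^-1 e^-t >= e^-2 / 2 for every x > 0.
    With [Gamma_le_add] this bounds ln Gamma on compact subsets of ]0, +oo[. *)
Lemma Gamma_ge (x : R) : 0 < x -> 2^-1 * expR (- 2) <= Gamma x.
Proof.
move=> x0; rewrite -lee_fin EFin_Gamma//.
apply: (@le_trans _ _ (\int[mu]_(t in `[1%R, 2%R]) (2^-1 * expR (- 2))%:E)%E).
  rewrite integral_cst//= lebesgue_measure_itv/= lte_fin ltr1n.
  have -> : ((2%R : R)%:E - 1%:E = 1)%E by rewrite -EFinB; congr EFin; lra.
  by rewrite mule1.
apply: (@le_trans _ _ (\int[mu]_(t in `[1%R, 2%R]) (gamma_integrand x t)%:E)%E).
  apply: ge0_le_integral => //=.
  - apply: measurable_funTS.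
    by apply/measurable_EFinP; exact: measurable_gamma_integrand.
  - move=> t; rewrite in_itv/= => /andP[t1 t2]; rewrite lee_fin.
    apply: ler_pM; rewrite ?invr_ge0 ?expR_ge0//; last by rewrite ler_expR lerN2.
    have t0 : 0 < t by exact: lt_le_trans t1.
    apply: (@le_trans _ _ (t `^ (- 1))).
      by rewrite powR_inv1 ?(ltW t0)// lef_pV2 ?posrE.
    by apply: ler_powR => //; lra.
apply: ge0_subset_integral => //=.
- apply: measurable_funTS.
  by apply/measurable_EFinP; exact: measurable_gamma_integrand.
- by move=> t _; rewrite lee_fin gamma_integrand_ge0.
- move=> t /=; rewrite !in_itv/= andbT => /andP[t1 _].
  exact: lt_le_trans t1.
Qed.

Lemma Gamma_gt0 (x : R) : 0 < x -> 0 < Gamma x.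
Proof.
by move=> /Gamma_ge; apply: lt_le_trans; rewrite mulr_gt0 ?invr_gt0 ?expR_gt0.
Qed.

(** The power t^(x-1) is at most t^(b-1) for t >= 1 and at most t^(a-1) for
    t <= 1. *)
Lemma Gamma_le_add (a b x : R) : 0 < a -> a <= x <= b ->
  Gamma x <= Gamma a + Gamma b.
Proof.
move=> a0 /andP[ax xb].
have x0 : 0 < x by exact: lt_le_trans ax.
have b0 : 0 < b by exact: lt_le_trans xb.
rewrite !GammaE -RintegralD//; [|exact: integrable_gamma_integrand..].
apply: le_Rintegral => //.
- exact: integrable_gamma_integrand.
- have := @integrableD _ _ _ mu `]0%R, +oo[ (measurable_itv _) _ _
    (integrable_gamma_integrand a0) (integrable_gamma_integrand b0).
  exact.
- move=> t; rewrite /= in_itv/= andbT => t0.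
  rewrite /gamma_integrand -mulrDl ler_wpM2r ?expR_ge0//.
  have [t1|t1] := leP 1 t.
    rewrite (@le_trans _ _ (t `^ (b - 1))) ?lerDr ?powR_ge0//.
    by apply: ler_powR => //; lra.
  rewrite (@le_trans _ _ (t `^ (a - 1))) ?lerDl ?powR_ge0//.
  by apply: ger_powR; [rewrite t0 ltW|lra].
Qed.

(** This is Holder's inequality for the integrands at x and y.  It is obtained by
    integrating a pointwise inequality: after normalization by Gamma x and
    Gamma y, it says that exp lies above its tangent at a convex combination. *)
Lemma ln_Gamma_convex (l x y : R) : 0 <= l <= 1 -> 0 < x -> 0 < y ->
  ln (Gamma (l * x + (1 - l) * y)) <= l * ln (Gamma x) + (1 - l) * ln (Gamma y).
Proof.
move=> /andP[l0 l1] x0 y0.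
set z := l * x + _; set c := l * ln (Gamma x) + _.
have z0 : 0 < z.
  have [l00|l0'] := eqVneq l 0; first by rewrite /z l00; lra.
  have lgt0 : 0 < l by rewrite lt_neqAle eq_sym l0'.
  by rewrite /z ltr_wpDr ?mulr_gt0// mulr_ge0 ?subr_ge0// ltW.
suff : Gamma z * expR (- c) <= 1.
  rewrite -[X in _ <= X]expR0 -{1}(lnK (_ : Gamma z \in Num.pos)) ?posrE ?Gamma_gt0//.
  by rewrite -expRD ler_expR subr_le0.
have -> : 1 = l * ((Gamma x)^-1 * Gamma x) + (1 - l) * ((Gamma y)^-1 * Gamma y).
  by rewrite !mulVf ?gt_eqF ?Gamma_gt0//; lra.
have iG (r u : R) : 0 < u -> mu.-integrable `]0%R, +oo[
    (EFin \o (fun t => r * gamma_integrand u t)).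
  move=> u0; have := @integrableZl _ _ _ mu `]0%R, +oo[ (measurable_itv _) r _
    (integrable_gamma_integrand u0).
  exact.
rewrite !mulrA !GammaE -RintegralZr//; last exact: integrable_gamma_integrand.
rewrite -!GammaE [X in _ <= _ * X + _]GammaE [X in _ <= _ + _ * X]GammaE.
rewrite -!RintegralZl//; [|exact: integrable_gamma_integrand..].
rewrite -RintegralD//; [|exact: iG..].
apply: le_Rintegral => //.
- apply: eq_integrable (iG (expR (- c)) z z0) => //.
  by move=> t _; rewrite /= mulrC.
- have := @integrableD _ _ _ mu `]0%R, +oo[ (measurable_itv _) _ _
    (iG (l * (Gamma x)^-1) x x0) (iG ((1 - l) * (Gamma y)^-1) y y0).
  exact.
move=> t /=; rewrite in_itv/= andbT => t0.
have gE (v : R) : 0 < v -> (Gamma v)^-1 * gamma_integrand v t =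
    expR ((v - 1) * ln t - t - ln (Gamma v)).
  move=> v0; rewrite /gamma_integrand /powR gt_eqF// -expRD [RHS]expRB.
  by rewrite lnK ?posrE ?Gamma_gt0// mulrC.
rewrite -(mulrA l) -(mulrA (1 - l)) !gE//.
have -> : gamma_integrand z t * expR (- c) = expR ((z - 1) * ln t - t - c).
  by rewrite /gamma_integrand /powR gt_eqF// -!expRD.
set w := (z - 1) * _ - _ - _; set u := (x - 1) * _ - _ - _.
set v := (y - 1) * _ - _ - _.
have wE : w = l * u + (1 - l) * v by rewrite /w /u /v /z /c; ring.
have eb (s : R) : expR w * (1 + (s - w)) <= expR s.
  have -> : expR s = expR w * expR (s - w) by rewrite -expRD; congr expR; ring.
  by rewrite ler_wpM2l ?expR_ge0 ?expR_ge1Dx.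
have hu : l * (expR w * (1 + (u - w))) <= l * expR u by rewrite ler_wpM2l.
have hv : (1 - l) * (expR w * (1 + (v - w))) <= (1 - l) * expR v.
  by rewrite ler_wpM2l ?subr_ge0.
apply: le_trans (lerD hu hv).
rewrite le_eqVlt; apply/orP; left; apply/eqP.
transitivity (expR w * (1 + (l * u + (1 - l) * v - w))); first by rewrite -wE; ring.
by ring.
Qed.

End Gamma.

Section GammaRec.
Context {R : realType}.
Local Notation mu := (@lebesgue_measure R).

Lemma gamma_integrand_cvgy (x : R) : gamma_integrand x t @[t --> +oo] --> 0.
Proof.
have [K K0 gK] := gamma_integrand_le_expR x.
have e0 : K * expR (- (2^-1 * t)) @[t --> +oo] --> K * 0.
  apply: cvgM; first exact: cvg_cst.
  apply: (@cvg_comp _ _ _ (fun t => 2^-1 * t) (fun t => expR (- t)) _ +oo).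
    exact: gt0_cvgMry.
  exact: cvgr_expR.
rewrite mulr0 in e0; apply: squeeze_cvgr e0; last exact: cvg_cst.
near=> t; rewrite gamma_integrand_ge0/=; apply: gK.
by near: t; exact: nbhs_pinfty_ge.
Unshelve. all: end_near. Qed.

Lemma is_derive_gamma_integrand (x t : R) : 0 < t ->
  is_derive t 1 (gamma_integrand (x + 1)) ((x - t) * gamma_integrand x t).
Proof.
move=> t0; rewrite /gamma_integrand addrK.
have h1 : is_derive t (1:R) (fun t : R => t `^ x) (x * t `^ (x - 1)).
  exact: is_derive1_powR.
have h2 : is_derive t (1:R) (fun t : R => expR (- t)) (- expR (- t)).
  apply: DeriveDef; first exact: ex_derive.
  rewrite -derive1E (@derive1_comp _ -%R expR)//.
  rewrite !derive1E derive_val.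
  by rewrite (@derive_val _ _ _ _ _ _ _ (is_deriveNid t 1)) mulrN1.
have := is_deriveM h1 h2; rewrite /= => h; apply: is_derive_eq h _.
have -> : t `^ x = t * t `^ (x - 1).
  rewrite /powR gt_eqF// -{2}(lnK (_ : t \in Num.pos)) ?posrE// -expRD.
  by congr expR; ring.
rewrite /GRing.scale/=; ring.
Qed.

Lemma continuous_gamma_integrand (x t : R) : 0 < t ->
  {for t, continuous (gamma_integrand x)}.
Proof.
move=> t0; rewrite -(subrK 1 x); apply: differentiable_continuous.
apply/derivable1_diffP; apply: ex_derive.
exact: is_derive_gamma_integrand.
Qed.

(** Integration by parts: (x - t) t^(x-1) e^-t is the derivative of t^x e^-t,
    which vanishes at both ends, so its integral is 0.  The derivative changes
    sign at t = x, and the fundamental theorem is applied on either side.  As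
    x > 1, it is continuous at 0 too. *)
Lemma Gamma_rec (x : R) : 1 < x -> Gamma (x + 1) = x * Gamma x.
Proof.
move=> x1; have x0 : 0 < x by exact: lt_trans x1.
have ctsF (t : R) : 0 < t -> {for t, continuous (gamma_integrand (x + 1))}.
  exact: continuous_gamma_integrand.
have ctsf (t : R) : 0 < t -> {for t, continuous (fun t => (x - t) * gamma_integrand x t)}.
  move=> t0; apply: cvgM; last exact: continuous_gamma_integrand.
  by apply: cvgB; [exact: cvg_cst|exact: cvg_id].
have cvg0 (y : R) : 1 < y -> gamma_integrand y t @[t --> 0^'+] --> gamma_integrand y 0.
  move=> y1; rewrite /gamma_integrand powR0 ?gt_eqF ?subr_gt0// mul0r.
  rewrite -[X in _ --> X](mul0r (expR (- 0))).
  apply: cvgM; first by apply: powR_cvg0; rewrite subr_gt0.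
  apply: cvg_at_right_filter.
  apply: (@cvg_comp _ _ _ (fun t : R => - t) expR); last exact: continuous_expR.
  by apply: cvgN; exact: cvg_id.
have derF (t : R) : 0 < t ->
    derive1 (gamma_integrand (x + 1)) t = (x - t) * gamma_integrand x t.
  move=> t0; have h := is_derive_gamma_integrand x t0.
  by rewrite derive1E (@derive_val _ _ _ _ _ _ _ h).
(* To the left of x the derivative is nonnegative, to the right nonpositive. *)
have int_low : (\int[mu]_(t in `[0%R, x]) ((x - t) * gamma_integrand x t)%:E =
    (gamma_integrand (x + 1) x)%:E)%E.
  rewrite (@continuous_FTC2 _ _ (gamma_integrand (x + 1)))//.
  - rewrite /gamma_integrand [in X in (_ - X)%E]powR0 ?mul0r ?sube0//.
    by rewrite addrK gt_eqF.
  - apply/continuous_within_itvP => //; split.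
    + by move=> t; rewrite in_itv/= => /andP[t0 _]; exact: ctsf.
    + apply: cvgM; last exact: cvg0.
      by apply: cvg_at_right_filter; apply: cvgB; [exact: cvg_cst|exact: cvg_id].
    + by apply: cvg_at_left_filter; exact: ctsf.
  - split.
    + move=> t; rewrite in_itv/= => /andP[t0 _]; apply: ex_derive.
      exact: is_derive_gamma_integrand.
    + by apply: cvg0; rewrite ltrDr.
    + by apply: cvg_at_left_filter; exact: ctsF.
  - by move=> t; rewrite in_itv/= => /andP[t0 _]; exact: derF.
have int_high : (\int[mu]_(t in `[x, +oo[) ((t - x) * gamma_integrand x t)%:E =
    (gamma_integrand (x + 1) x)%:E)%E.
  rewrite (@ge0_continuous_FTC2y _ _ (fun t => - gamma_integrand (x + 1) t) _ 0)//.
  - by rewrite -EFinB opprK add0r.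
  - by move=> t xt; rewrite mulr_ge0 ?gamma_integrand_ge0 ?subr_ge0.
  - apply: continuous_in_subspaceT => t /set_mem/=; rewrite in_itv/= andbT => xt.
    have t0 : 0 < t by exact: lt_le_trans xt.
    apply: cvgM; last exact: continuous_gamma_integrand.
    by apply: cvgB; [exact: cvg_id|exact: cvg_cst].
  - by rewrite -oppr0; apply: cvgN; exact: gamma_integrand_cvgy.
  - move=> t xt; apply: derivableN; apply: ex_derive.
    by apply: is_derive_gamma_integrand; exact: lt_trans xt.
  - by apply: cvgN; apply: cvg_at_right_filter; exact: ctsF.
  - move=> t; rewrite in_itv/= andbT => xt.
    have t0 : 0 < t by exact: lt_trans xt.
    rewrite derive1E deriveN; last by apply: ex_derive; exact: is_derive_gamma_integrand.
    by rewrite -derive1E derF// -mulNr opprB.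
have iD : mu.-integrable `]0, +oo[ (EFin \o (fun t => (x - t) * gamma_integrand x t)).
  have i1 := @integrableZl _ _ _ mu `]0%R, +oo[ (measurable_itv _) x _
    (integrable_gamma_integrand x0).
  have x10 : 0 < x + 1 by rewrite ltr_wpDl// ltW.
  have i2 := integrable_gamma_integrand x10.
  apply: eq_integrable (integrableB _ i1 i2) => // t /set_mem/=.
  rewrite in_itv/= andbT => t0; rewrite /gamma_integrand addrK -EFinM -EFinB.
  have -> : t `^ x = t * t `^ (x - 1) by rewrite mulr_powRB1// ltW.
  by congr EFin; ring.
suff : \int[mu]_(t in `]0, +oo[) ((x - t) * gamma_integrand x t) = 0.
  have -> : \int[mu]_(t in `]0, +oo[) ((x - t) * gamma_integrand x t) =
     \int[mu]_(t in `]0, +oo[) (x * gamma_integrand x t - gamma_integrand (x + 1) t).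
    apply: eq_Rintegral => t /set_mem/=; rewrite in_itv/= andbT => t0.
    rewrite /gamma_integrand addrK -(@mulr_powRB1 _ t x) ?ltW//; ring.
  rewrite RintegralB//.
  - rewrite RintegralZl//; last exact: integrable_gamma_integrand.
    by move=> /eqP; rewrite subr_eq0 => /eqP.
  - have := @integrableZl _ _ _ mu `]0%R, +oo[ (measurable_itv _) x _
      (integrable_gamma_integrand x0).
    exact.
  - by apply: integrable_gamma_integrand; rewrite ltr_wpDl// ltW.
have U : `]0, +oo[%classic = (`]0, x] `|` `]x, +oo[)%classic :> set R.
  by rewrite -itv_bndbnd_setU ?bnd_simp ?(ltW x0).
rewrite U Rintegral_setU//; last 2 first.
- by rewrite -U.
- apply/disj_setPS => t [/=]; rewrite !in_itv/= andbT => /andP[_ tx].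
  by rewrite ltNge tx.
have i1 : mu.-integrable `]0, x] (EFin \o (fun t => (x - t) * gamma_integrand x t)).
  by apply: integrableS iD => // t /=; rewrite !in_itv/= => /andP[->].
have i2 : mu.-integrable `]x, +oo[ (EFin \o (fun t => (x - t) * gamma_integrand x t)).
  apply: integrableS iD => // t /=; rewrite !in_itv/= !andbT.
  exact: lt_trans.
rewrite (Rintegral_itv_obnd_cbnd i1).
rewrite [X in X + _ = _](_ : _ = gamma_integrand (x + 1) x); last first.
  by rewrite /Rintegral int_low.
apply/eqP; rewrite addr_eq0; apply/eqP/esym.
have -> : - (\int[mu]_(t in `]x, +oo[) ((x - t) * gamma_integrand x t)) =
    \int[mu]_(t in `]x, +oo[) ((t - x) * gamma_integrand x t).
  rewrite -mulN1r -RintegralZl//; apply: eq_Rintegral => t _; ring.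
rewrite /Rintegral integral_itv_obnd_cbnd ?int_high//.
apply/measurable_funTS; apply/measurable_EFinP; apply: measurable_funM.
  exact: measurable_funB.
exact: measurable_gamma_integrand.
Qed.

End GammaRec.

(** * The pair interaction at large distance *)

Section Interaction.
Context {R : realType}.

Lemma ln_sub_le (u v : R) : 0 < u -> 0 < v -> ln u - ln v <= (u - v) / v.
Proof.
move=> u0 v0; rewrite -ln_div ?posrE//.
have {1}-> : u / v = 1 + (u - v) / v by field; rewrite gt_eqF.
apply: le_ln1Dx; rewrite -subr_gt0 opprK.
by have -> : (u - v) / v + 1 = u / v by [field; rewrite gt_eqF]; rewrite divr_gt0.
Qed.

Lemma ln_shift_bound (x s : R) : 0 < x -> `|s| <= x / 2 ->
  `|ln (x + s) - ln x| <= 2 * `|s| / x.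
Proof.
move=> x0 sx; have xs0 : 0 < x + s.
  by move: sx; rewrite ler_norml => /andP[? _]; lra.
have sn := ler_norm s; have sn' : - s <= `|s| by rewrite -normrN ler_norm.
rewrite ler_norml; apply/andP; split.
  rewrite lerNl opprB (le_trans (ln_sub_le x0 xs0))//.
  rewrite ler_pdivrMr// mulrAC ler_pdivlMr//.
  have h : `|s| * x <= 2 * `|s| * (x + s).
    have : 0 <= `|s| * (x + 2 * s).
      by rewrite mulr_ge0//; move: sx; rewrite ler_norml => /andP[? _]; lra.
    lra.
  apply: le_trans h; rewrite ler_pM2r//; lra.
apply: (le_trans (ln_sub_le xs0 x0)); rewrite ler_pM2r ?invr_gt0//.
have := normr_ge0 s; lra.
Qed.

Section ConvexRec.
Variable g : R -> R.
Hypothesis g_convex : forall l x y, 0 <= l <= 1 -> 0 < x -> 0 < y ->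
  g (l * x + (1 - l) * y) <= l * g x + (1 - l) * g y.
Hypothesis g_rec : forall x, 1 < x -> g (x + 1) = ln x + g x.
Hypothesis g_bounded : forall a b, 0 < a -> exists2 B : R, 0 <= B &
  forall x, a <= x <= b -> `|g x| <= B.

(** By convexity the slope of g over [z, z + d] is at most its slope over
    [z + d, z + d + 1], which the recurrence makes ln (z + d). *)
Lemma convex_slope_le (z d : R) : 0 < z -> 0 <= d -> 1 < z + d ->
  g (z + d) - g z <= d * ln (z + d).
Proof.
move=> z0 d0 zd1; have d1 : 0 < d + 1 by lra.
have l01 : 0 <= (d + 1)^-1 <= 1 by rewrite invr_ge0 ltW//= invf_le1//; lra.
have y0 : 0 < z + d + 1 by lra.
have := g_convex l01 z0 y0.
rewrite [X in g X <= _](_ : _ = z + d); last by field; lra.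
rewrite g_rec//.
set G := g (z + d); set h := g z; set l := ln (z + d).
rewrite -(ler_pM2l d1) => H.
have E : (d + 1) * ((d + 1)^-1 * h + (1 - (d + 1)^-1) * (l + G)) = h + d * (l + G).
  by field; lra.
lra.
Qed.

(** By convexity the slope of g over [z, z + d] is at least its slope over
    [z - 1, z], which the recurrence makes ln (z - 1). *)
Lemma convex_slope_ge (z d : R) : 2 < z -> 0 <= d ->
  d * ln (z - 1) <= g (z + d) - g z.
Proof.
move=> z2 d0; have d1 : 0 < d + 1 by lra.
have l01 : 0 <= d / (d + 1) <= 1.
  by rewrite divr_ge0//=; [rewrite ler_pdivrMr//; lra|lra].
have z10 : 0 < z - 1 by lra.
have y0 : 0 < z + d by lra.
have := g_convex l01 z10 y0.
rewrite [X in g X <= _](_ : _ = z); last by field; lra.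
have rz : g z = ln (z - 1) + g (z - 1).
  by rewrite -g_rec ?subrK//; lra.
move: rz; set G := g (z + d); set h := g z.
set l := ln (z - 1); set k := g (z - 1) => rz.
rewrite -(ler_pM2l d1) => H.
have E : (d + 1) * (d / (d + 1) * k + (1 - d / (d + 1)) * G) = d * k + G.
  by field; lra.
have : d * h = d * l + d * k by rewrite rz mulrDr.
lra.
Qed.

(** The difference g (x + 1) - g x equals ln x, and x + theta and x + 1 - theta
    are 2 theta - 1 apart, so the slope bounds make the other difference
    (2 theta - 1) ln x up to O(1/x).  Which of the two points comes first depends
    on the sign of 2 theta - 1.  For x below X0 all terms are bounded. *)
Lemma convex_rec_shift_bound (theta : R) : 0 < theta -> exists2 C : R, 0 <= C &
  forall x, theta <= x -> `|g (x + 1) + g (x + theta) -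
    (g x + g (x + 1 - theta)) - 2 * theta * ln x| <= C / x.
Proof.
move=> t0; pose X0 := 2 * theta + 4; pose m := Num.min theta 1.
have m0 : 0 < m by rewrite lt_min t0/=.
have [B B0 HB] := g_bounded (X0 + 1 + theta) m0.
pose L := `|ln theta| + `|ln X0|.
pose C1 := 2 * (theta + 1) * (2 * theta + 1).
pose C2 := (4 * B + 2 * theta * L) * X0.
have L0 : 0 <= L by rewrite addr_ge0.
have C10 : 0 <= C1 by rewrite !mulr_ge0//; lra.
have C20 : 0 <= C2.
  by rewrite mulr_ge0 ?addr_ge0 ?mulr_ge0//; rewrite /X0; lra.
exists (C1 + C2) => [|x tx]; first by rewrite addr_ge0.
have x0 : 0 < x by exact: lt_le_trans tx.
have [xX|Xx] := leP x X0.
  apply: (@le_trans _ _ (C2 / x)); last first.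
    by rewrite ler_pM2r ?invr_gt0// lerDr.
  rewrite ler_pdivlMr//.
  have mt : m <= theta by rewrite ge_min lexx.
  have m1 : m <= 1 by rewrite ge_min lexx orbT.
  have /HB : m <= x + 1 <= X0 + 1 + theta by lra.
  have /HB : m <= x + theta <= X0 + 1 + theta by lra.
  have /HB : m <= x <= X0 + 1 + theta by lra.
  have /HB : m <= x + 1 - theta <= X0 + 1 + theta by lra.
  have lnL : `|ln x| <= L.
    rewrite ler_norml /L.
    have : ln theta <= ln x by rewrite ler_ln ?posrE.
    have : ln x <= ln X0 by rewrite ler_ln ?posrE//; apply: lt_le_trans xX.
    have := ler_norm (ln X0); have : - ln theta <= `|ln theta| by rewrite -normrN ler_norm.
    have := normr_ge0 (ln X0); have := normr_ge0 (ln theta).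
    by move=> *; apply/andP; split; lra.
  move: lnL; rewrite !ler_norml => /andP[l1 l2] /andP[a1 a2] /andP[b1 b2] /andP[c1 c2] /andP[d1 d2].
  have e1 : theta * ln x <= theta * L by rewrite ler_pM2l.
  have e2 : theta * - L <= theta * ln x by rewrite ler_pM2l.
  rewrite /C2; apply: ler_pM => //; first exact: ltW.
  by rewrite ler_norml; apply/andP; split; lra.
apply: (@le_trans _ _ (C1 / x)); last by rewrite ler_pM2r ?invr_gt0// lerDl.
have X04 : 4 < X0 by rewrite /X0; lra.
rewrite g_rec; last by lra.
have key (s : R) : `|s| <= theta + 1 -> `|ln (x + s) - ln x| <= 2 * (theta + 1) / x.
  move=> s1; apply: le_trans (ln_shift_bound x0 _) _.
    by move: Xx; rewrite /X0; lra.
  by rewrite ler_pM2r ?invr_gt0// ler_pM2l.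
set E := 2 * (theta + 1) / x in key.
have E0 : 0 <= E by rewrite divr_ge0 ?mulr_ge0 ?ltW//; lra.
have -> : C1 / x = (2 * theta + 1) * E by rewrite /C1 /E; ring.
(* The point x + 1 - theta comes first when theta >= 1 / 2. *)
have [t2|t2] := leP (2^-1) theta.
  pose d := 2 * theta - 1; pose z := x + 1 - theta.
  have d0 : 0 <= d by rewrite /d; lra.
  have dt : d <= 2 * theta + 1 by rewrite /d; lra.
  have zd : z + d = x + theta by rewrite /z /d; ring.
  have z0 : 0 < z by rewrite /z; lra.
  have z2 : 2 < z by move: Xx; rewrite /z /X0; lra.
  have zd1 : 1 < z + d by lra.
  have := convex_slope_ge z2 d0; have := convex_slope_le z0 d0 zd1.
  rewrite zd (_ : z - 1 = x - theta); last by rewrite /z; ring.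
  rewrite -/z.
  have /key : `|theta| <= theta + 1 by rewrite gtr0_norm//; lra.
  have /key : `|- theta| <= theta + 1 by rewrite normrN gtr0_norm//; lra.
  rewrite !ler_norml => /andP[a1 a2] /andP[b1 b2] u1 u2.
  have e1 : d * ln (x + theta) <= d * (ln x + E) by rewrite ler_wpM2l//; lra.
  have e2 : d * (ln x - E) <= d * ln (x - theta) by rewrite ler_wpM2l//; lra.
  have e3 : d * E <= (2 * theta + 1) * E by rewrite ler_wpM2r.
  have e4 : d * ln x = 2 * theta * ln x - ln x by rewrite /d; ring.
  by apply/andP; split; lra.
pose d := 1 - 2 * theta; pose z := x + theta.
have d0 : 0 <= d by rewrite /d; lra.
have dt : d <= 2 * theta + 1 by rewrite /d; lra.
have zd : z + d = x + 1 - theta by rewrite /z /d; ring.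
have z0 : 0 < z by rewrite /z; lra.
have z2 : 2 < z by rewrite /z; lra.
have zd1 : 1 < z + d by lra.
have := convex_slope_ge z2 d0; have := convex_slope_le z0 d0 zd1.
rewrite zd (_ : z - 1 = x + (theta - 1)); last by rewrite /z; ring.
rewrite -/z -addrA.
have /key : `|1 - theta| <= theta + 1 by rewrite ler_norml; lra.
have /key : `|theta - 1| <= theta + 1 by rewrite ler_norml; lra.
rewrite !ler_norml => /andP[a1 a2] /andP[b1 b2] u1 u2.
have e1 : d * ln (x + (1 - theta)) <= d * (ln x + E) by rewrite ler_wpM2l//; lra.
have e2 : d * (ln x - E) <= d * ln (x + (theta - 1)) by rewrite ler_wpM2l//; lra.
have e3 : d * E <= (2 * theta + 1) * E by rewrite ler_wpM2r.
have e4 : d * ln x = ln x - 2 * theta * ln x by rewrite /d; ring.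
by apply/andP; split; lra.
Qed.

End ConvexRec.

Lemma ln_Gamma_rec (x : R) : 1 < x -> ln (Gamma (x + 1)) = ln x + ln (Gamma x).
Proof.
move=> x1; have x0 : 0 < x by exact: lt_trans x1.
by rewrite Gamma_rec// lnM ?posrE// Gamma_gt0.
Qed.

Lemma ln_Gamma_bounded (a b : R) : 0 < a -> exists2 B : R, 0 <= B &
  forall x, a <= x <= b -> `|ln (Gamma x)| <= B.
Proof.
move=> a0; pose B1 := ln (Gamma a + Gamma b); pose B2 := ln (2^-1 * expR (- 2) : R).
exists (`|B1| + `|B2|) => [|x /[dup] axb /andP[ax xb]]; first by rewrite addr_ge0.
have x0 : 0 < x by exact: lt_le_trans ax.
have b0 : 0 < b by exact: lt_le_trans xb.
have h1 : ln (Gamma x) <= B1.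
  by rewrite ler_ln ?posrE ?addr_gt0 ?Gamma_gt0// Gamma_le_add.
have h2 : B2 <= ln (Gamma x).
  have e0 : 0 < 2^-1 * expR (- 2) :> R by rewrite mulr_gt0 ?invr_gt0 ?expR_gt0.
  by rewrite /B2 ler_ln ?posrE ?Gamma_gt0// Gamma_ge.
have := ler_norm B1; have : - B2 <= `|B2| by rewrite -normrN ler_norm.
have := normr_ge0 B1; have := normr_ge0 B2.
by rewrite ler_norml => *; apply/andP; split; lra.
Qed.

Lemma interaction_gt0 (theta x : R) : 0 < theta -> theta <= x ->
  0 < interaction theta x.
Proof.
move=> t0 tx.
have x1 : 0 < x + 1 by lra.
have x2 : 0 < x + theta by lra.
have x3 : 0 < x by lra.
have x4 : 0 < x + 1 - theta by lra.
exact: divr_gt0 (mulr_gt0 (Gamma_gt0 x1) (Gamma_gt0 x2))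
  (mulr_gt0 (Gamma_gt0 x3) (Gamma_gt0 x4)).
Qed.

Lemma ln_interaction (theta x : R) : 0 < theta -> theta <= x ->
  ln (interaction theta x) = ln (Gamma (x + 1)) + ln (Gamma (x + theta)) -
    (ln (Gamma x) + ln (Gamma (x + 1 - theta))).
Proof.
move=> t0 tx.
have x1 : 0 < x + 1 by lra.
have x2 : 0 < x + theta by lra.
have x3 : 0 < x by lra.
have x4 : 0 < x + 1 - theta by lra.
move: (Gamma_gt0 x1) (Gamma_gt0 x2) (Gamma_gt0 x3) (Gamma_gt0 x4).
rewrite /interaction.
move: (Gamma (x + 1)) (Gamma (x + theta)) (Gamma x) (Gamma (x + 1 - theta)).
by move=> a b c d a0 b0 c0 d0; rewrite ln_div ?lnM ?posrE ?mulr_gt0.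
Qed.

(** The range [theta, +oo) contains all distances between two particles. *)
Lemma ln_interaction_bound (theta : R) : 0 < theta -> exists2 C : R, 0 <= C &
  forall x, theta <= x ->
    `|ln (interaction theta x) - 2 * theta * ln x| <= C / x.
Proof.
move=> t0; have [C C0 HC] := convex_rec_shift_bound (@ln_Gamma_convex R)
  ln_Gamma_rec ln_Gamma_bounded t0.
by exists C => // x tx; rewrite ln_interaction//; exact: HC.
Qed.

End Interaction.

(** * Bounded densities *)

Section Density.
Context {R : realType}.
Local Notation mu := (@lebesgue_measure R).
Local Notation mu2 := (@lebesgue_measure R \x @lebesgue_measure R)%E.
Implicit Types (f g h : R -> R) (k : R * R -> R) (a S : R).

(** These are the representatives of admissible classes that satisfy the
    constraints everywhere and vanish off [0, S], so that integrals over [0, S]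
    become integrals over the line; see [admissible_ae_density].  The bound [a]
    is theta^-1 in the applications. *)
Definition density a S f := [/\ measurable_fun [set: R] f,
  forall x, 0 <= f x <= a, forall x, ~~ (0 <= x <= S) -> f x = 0 &
  \int[mu]_x f x = 1].

Lemma density_measurable a S f : density a S f -> measurable_fun [set: R] f.
Proof. by case. Qed.

Lemma density_ge0 a S f x : density a S f -> 0 <= f x.
Proof. by case=> _ /(_ x)/andP[]. Qed.

Lemma density_le a S f x : density a S f -> f x <= a.
Proof. by case=> _ /(_ x)/andP[]. Qed.

Lemma density_sub a S T f : S <= T -> density a S f -> density a T f.
Proof.
move=> ST [mf fa f0 f1]; split=> // x xT; apply: f0; apply: contra xT.
by move=> /andP[-> /le_trans]; exact.
Qed.

Lemma density_restrict a S f : density a S f -> f = f \_ `[0, S].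
Proof.
case=> _ _ f0 _; apply/funext => x; rewrite patchE; case: ifPn => //.
by move=> xS; apply: f0; move: xS; rewrite notin_setE/= in_itv/= => /negP.
Qed.

Lemma integrable_density a S f : density a S f ->
  mu.-integrable [set: R] (EFin \o f).
Proof.
move=> df; rewrite (density_restrict df).
rewrite -restrict_EFin; apply/integrable_restrict => //; rewrite setTI.
apply: measurable_bounded_integrable => //.
- rewrite /= lebesgue_measure_itv/=; case: ifP => _; exact: ltry.
- exact: measurable_funTS (density_measurable df).
- exists a; split; first exact: num_real.
  move=> M aM x _; rewrite /= ger0_norm ?(density_ge0 _ df)//.
  exact: le_trans (density_le _ df) (ltW aM).
Qed.

Lemma integrable_bounded_density a S f h B : density a S f ->
  measurable_fun [set: R] h -> (forall x, `|h x| <= B) ->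
  mu.-integrable [set: R] (EFin \o (fun x => h x * f x)).
Proof.
move=> df mh hB.
have B0 : 0 <= B by exact: le_trans (hB 0).
have := @integrableZl _ _ _ mu [set: R] measurableT B _ (integrable_density df).
apply: le_integrable => //.
  apply/measurable_EFinP; apply: measurable_funM => //.
  exact: density_measurable df.
move=> x _; rewrite /= lee_fin !normrM (ger0_norm B0).
by rewrite ler_wpM2r.
Qed.

Lemma density_EFin_int a S f : density a S f -> (\int[mu]_x (f x)%:E = 1)%E.
Proof.
move=> df; have [_ _ _] := df; rewrite /Rintegral => <-.
by rewrite fineK//; apply: integrable_fin_num => //; exact: integrable_density df.
Qed.

Lemma le_density_int a S f h1 h2 B1 B2 : density a S f ->
  measurable_fun [set: R] h1 -> (forall x, `|h1 x| <= B1) ->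
  measurable_fun [set: R] h2 -> (forall x, `|h2 x| <= B2) ->
  (forall x, 0 <= x <= S -> h1 x <= h2 x) ->
  \int[mu]_x (h1 x * f x) <= \int[mu]_x (h2 x * f x).
Proof.
move=> df mh1 hB1 mh2 hB2 h12; apply: le_Rintegral => //.
- exact: integrable_bounded_density df mh1 hB1.
- exact: integrable_bounded_density df mh2 hB2.
- move=> x _; have [xS|xS] := boolP (0 <= x <= S).
    by rewrite ler_wpM2r ?(density_ge0 _ df) ?h12.
  by case: df => _ _ -> //; rewrite !mulr0.
Qed.

Lemma density_int_cst a S f c : density a S f -> \int[mu]_x (c * f x) = c.
Proof.
move=> df; rewrite RintegralZl//; last exact: integrable_density df.
by case: df => _ _ _ ->; rewrite mulr1.
Qed.

Lemma density_int_dist a S f h1 h2 B1 B2 c : density a S f ->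
  measurable_fun [set: R] h1 -> (forall x, `|h1 x| <= B1) ->
  measurable_fun [set: R] h2 -> (forall x, `|h2 x| <= B2) ->
  (forall x, 0 <= x <= S -> `|h1 x - h2 x| <= c) ->
  `|\int[mu]_x (h1 x * f x) - \int[mu]_x (h2 x * f x)| <= c.
Proof.
move=> df mh1 hB1 mh2 hB2 h12.
have mc h B : (forall x, `|h x| <= B) -> forall x, `|h x + c| <= B + `|c|.
  by move=> hB x; rewrite (le_trans (ler_normD _ _))// lerD2r.
have ic h B : measurable_fun [set: R] h -> (forall x, `|h x| <= B) ->
    \int[mu]_x ((h x + c) * f x) = \int[mu]_x (h x * f x) + c.
  move=> mh hB; under eq_Rintegral do rewrite mulrDl.
  rewrite RintegralD// ?(density_int_cst _ df)//.
  - exact: integrable_bounded_density df mh hB.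
  - by apply: (integrable_bounded_density df (h := cst c) (B := `|c|)).
have mhc h : measurable_fun [set: R] h -> measurable_fun [set: R] (fun x => h x + c).
  by move=> mh; exact: measurable_funD.
rewrite ler_norml; apply/andP; split.
  rewrite lerBrDr addrC lerBlDr -(ic _ _ mh1 hB1).
  apply: (le_density_int df mh2 hB2 (mhc _ mh1) (mc _ _ hB1)) => x xS.
  by move: (h12 x xS); rewrite ler_norml => /andP[h _]; lra.
rewrite lerBlDr addrC -(ic _ _ mh2 hB2).
apply: (le_density_int df mh1 hB1 (mhc _ mh2) (mc _ _ hB2)) => x xS.
by move: (h12 x xS); rewrite ler_norml => /andP[_ h]; lra.
Qed.

End Density.

(** * Quadrature *)

Section Quadrature.
Context {R : realType}.
Local Notation mu := (@lebesgue_measure R).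
Implicit Types (f g h : R -> R) (a S : R).

Lemma density_int_itvoc a S f h B : density a S f ->
  measurable_fun [set: R] h -> (forall x, `|h x| <= B) ->
  \int[mu]_x (h x * f x) = \int[mu]_(x in `]0, S]) (h x * f x).
Proof.
move=> df mh hB; have ih := integrable_bounded_density df mh hB.
rewrite Rintegral_itv_obnd_cbnd; last by apply: integrableS ih.
rewrite [RHS]Rintegral_mkcond; apply: eq_Rintegral => x _.
rewrite patchE; case: ifPn => //; rewrite notin_setE/= in_itv/= => xS.
by case: df => _ _ -> //; [rewrite mulr0|exact/negP].
Qed.

Lemma Rintegral_itvoc_cat (g : R -> R) (x y z : R) : x <= y <= z ->
  mu.-integrable [set: R] (EFin \o g) ->
  \int[mu]_(t in `]x, z]) g t =
  \int[mu]_(t in `]x, y]) g t + \int[mu]_(t in `]y, z]) g t.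
Proof.
move=> /andP[xy yz] ig.
have U : `]x, z]%classic = (`]x, y] `|` `]y, z])%classic :> set R.
  by rewrite -itv_bndbnd_setU ?bnd_simp.
rewrite U Rintegral_setU//.
- by apply: integrableS ig => //; apply: measurableU.
- apply/disj_setPS => t [/=]; rewrite !in_itv/= => /andP[_ ty].
  by rewrite ltNge ty.
Qed.

Variables (a S : R) (f : R -> R) (df : density a S f).
Variables (N : nat) (N0 : (0 < N)%N) (c z : nat -> R).
Hypothesis c0 : c 0 = 0.
Hypothesis cN : c N = S.
Hypothesis c_itv : forall k, (k <= N)%N -> 0 <= c k <= S.
Hypothesis c_nd : forall k, (k < N)%N -> c k <= c k.+1.
Hypothesis c_mass : forall k, (k < N)%N ->
  \int[mu]_(x in `]c k, c k.+1]) f x = N%:R^-1.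
Hypothesis z_itv : forall k, (k < N)%N -> c k <= z k <= c k.+1.

(** Inside the k-th cell, of mass 1 / N, the replacement of [h] by [h (z k)] costs
    at most (e + K * length of the cell) / N, and the lengths add up to S. *)
Lemma quadrature h B e K : measurable_fun [set: R] h ->
  (forall x, `|h x| <= B) -> 0 <= e -> 0 <= K ->
  (forall x y, 0 <= x <= S -> 0 <= y <= S -> `|h x - h y| <= e + K * `|x - y|) ->
  `|\int[mu]_x (h x * f x) - N%:R^-1 * \sum_(k < N) h (z k)| <=
  e + K * S / N%:R.
Proof.
move=> mh hB e0 K0 hK; have ih := integrable_bounded_density df mh hB.
have idf := integrable_density df.
rewrite (density_int_itvoc df mh hB) -cN.
have N0' : 0 < N%:R :> R by rewrite ltr0n.
have cell k : (k < N)%N ->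
    `|\int[mu]_(x in `]c k, c k.+1]) (h x * f x) - N%:R^-1 * h (z k)| <=
    (e + K * (c k.+1 - c k)) / N%:R.
  move=> kN; rewrite -(c_mass kN) mulrC.
  set J := `]c k, c k.+1]%classic.
  have mJ : measurable J by exact: measurable_itv.
  have iJ : mu.-integrable J (EFin \o f) by exact: integrableS idf.
  have ihJ : mu.-integrable J (EFin \o (fun x => h x * f x)) by exact: integrableS ih.
  have izJ (r : R) : mu.-integrable J (EFin \o (fun x => r * f x)).
    by have := @integrableZl _ _ _ mu J mJ r _ iJ; exact.
  rewrite -RintegralZl// -RintegralB//.
  have iB : mu.-integrable J (EFin \o (fun x => h x * f x - h (z k) * f x)).
    by have := @integrableB _ _ _ mu J mJ _ _ ihJ (izJ (h (z k))); exact.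
  apply: (le_trans (le_normr_Rintegral _ iB)) => //.
  rewrite -RintegralZl//; apply: le_Rintegral => //.
    exact: integrable_norm.
  move=> x; rewrite /J/= in_itv/= => /andP[cx xc].
  have f0 := density_ge0 x df.
  rewrite -mulrBl normrM (ger0_norm f0) ler_wpM2r//.
  have /andP[zl zr] := z_itv kN.
  have /andP[ck0 ckS] := c_itv (ltnW kN); have /andP[ck10 ck1S] := c_itv kN.
  apply: (le_trans (hK _ _ _ _)).
  - by rewrite (le_trans ck0 (ltW cx)) (le_trans xc).
  - by rewrite (le_trans ck0 zl) (le_trans zr).
  - by rewrite lerD2l ler_wpM2l// ler_norml; apply/andP; split; lra.
suff main n : (n <= N)%N ->
    `|\int[mu]_(x in `]0, c n]) (h x * f x) - N%:R^-1 * \sum_(k < n) h (z k)| <=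
    n%:R * e / N%:R + K * c n / N%:R.
  apply: le_trans (main N (leqnn N)) _.
  by rewrite lerD2r mulrAC divff ?gt_eqF// mul1r.
elim: n => [_|n IH nN].
  rewrite c0 set_itv_ge; last by rewrite bnd_simp ltxx.
  by rewrite Rintegral_set0 big_ord0 !mulr0 !mul0r subrr normr0 addr0.
rewrite (@Rintegral_itvoc_cat _ _ (c n))//; last first.
  by rewrite c_nd// andbT; have /andP[] := c_itv (ltnW nN).
rewrite big_ord_recr/= mulrDr opprD addrACA.
apply: (le_trans (ler_normD _ _)).
apply: (le_trans (lerD (IH (ltnW nN)) (cell n nN))).
rewrite -!mulrDl ler_pM2r ?invr_gt0// -[n.+1]addn1 natrD.
by rewrite addn1 le_eqVlt; apply/orP; left; apply/eqP; ring.
Qed.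

End Quadrature.

(** * Kernels and the truncated logarithm *)

Section Kernel.
Context {R : realType}.
Local Notation mu := (@lebesgue_measure R).
Local Notation mu2 := (@lebesgue_measure R \x @lebesgue_measure R)%E.
Implicit Types (f g h : R -> R) (k : R * R -> R) (a S : R).

Lemma measurable_tensor f g : measurable_fun [set: R] f ->
  measurable_fun [set: R] g ->
  measurable_fun [set: R * R] (fun z => f z.1 * g z.2).
Proof.
move=> mf mg; apply: measurable_funM.
  by apply: (measurableT_comp mf); exact: measurable_fst.
by apply: (measurableT_comp mg); exact: measurable_snd.
Qed.

Lemma integrable_tensor a S T f g : density a S f -> density a T g ->
  mu2.-integrable [set: R * R] (EFin \o (fun z => f z.1 * g z.2)).
Proof.
move=> df dg; have mf := density_measurable df; have mg := density_measurable dg.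
have mfg := measurable_tensor mf mg.
apply/integrable12ltyP; first exact/measurable_EFinP.
have E x : (\int[mu]_y `|(EFin \o (fun z : R * R => (f z.1 * g z.2)%R)) (x, y)|)%E =
    (f x)%:E.
  under eq_integral do rewrite /= ger0_norm ?mulr_ge0 ?(density_ge0 _ df)
    ?(density_ge0 _ dg)// EFinM.
  rewrite ge0_integralZl_EFin//.
  - by rewrite (density_EFin_int dg) mule1.
  - by move=> y _; rewrite lee_fin (density_ge0 _ dg).
  - exact/measurable_EFinP.
  - exact: density_ge0 df.
under eq_integral do rewrite E.
by rewrite (density_EFin_int df) ltry.
Qed.

Lemma integrable_bounded_tensor a S T f g k B : density a S f -> density a T g ->
  measurable_fun [set: R * R] k -> (forall z, `|k z| <= B) ->
  mu2.-integrable [set: R * R] (EFin \o (fun z => k z * f z.1 * g z.2)).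
Proof.
move=> df dg mk kB.
have B0 : 0 <= B by exact: le_trans (kB (0, 0)).
have := @integrableZl _ _ _ mu2 [set: R * R] measurableT B _ (integrable_tensor df dg).
apply: le_integrable => //.
  apply/measurable_EFinP; under eq_fun do rewrite -mulrA.
  apply: measurable_funM => //.
  by apply: measurable_tensor; [exact: density_measurable df|exact: density_measurable dg].
move=> z _; rewrite /= lee_fin -mulrA normrM [in leRHS]normrM (ger0_norm B0).
by rewrite ler_wpM2r.
Qed.

Lemma Rintegral_tensor a S T f g k B : density a S f -> density a T g ->
  measurable_fun [set: R * R] k -> (forall z, `|k z| <= B) ->
  \int[mu2]_z (k z * f z.1 * g z.2) =
  \int[mu]_x ((\int[mu]_y (k (x, y) * g y)) * f x).
Proof.
move=> df dg mk kB.
have ik := integrable_bounded_tensor df dg mk kB.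
rewrite /Rintegral -integral12_prod_meas1//; congr fine.
apply: eq_integral => x _; rewrite /fubini_F/=.
have mkx : measurable_fun [set: R] (fun y => k (x, y)).
  by apply: (measurableT_comp mk); exact: measurable_pair1.
have ikx := integrable_bounded_density dg mkx (fun y => kB (x, y)).
under eq_integral => y _ do rewrite mulrAC mulrC EFinM.
rewrite integralZl//.
by rewrite -[X in (_ * X)%E]fineK ?integrable_fin_num// -EFinM mulrC.
Qed.

Lemma lipschitz_continuous h (K : R) : 0 <= K ->
  (forall x y, `|h x - h y| <= K * `|x - y|) -> continuous h.
Proof.
move=> K0 hK x; apply/cvgrPdist_le => e e0; near=> y.
apply: (le_trans (hK x y)).
apply: (@le_trans _ _ ((K + 1) * `|x - y|)); first by rewrite ler_wpM2r//; lra.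
rewrite mulrC -ler_pdivlMr//; last by rewrite ltr_wpDl.
near: y; apply: cvgr_dist_le; first exact: cvg_id.
by rewrite divr_gt0// ltr_wpDl.
Unshelve. all: end_near. Qed.

Lemma lipschitz_measurable h (K : R) : 0 <= K ->
  (forall x y, `|h x - h y| <= K * `|x - y|) -> measurable_fun [set: R] h.
Proof.
by move=> K0 hK; apply: continuous_measurable_fun; exact: lipschitz_continuous hK.
Qed.

Lemma density_pot_bound a S g (h : R -> R) B : density a S g ->
  measurable_fun [set: R] h -> (forall y, `|h y| <= B) ->
  `|\int[mu]_y (h y * g y)| <= B.
Proof.
move=> dg mh hB.
have := @density_int_dist _ _ _ g h (cst 0) B 0 B dg mh hB.
rewrite (_ : \int[mu]_x (cst 0 x * g x) = 0) ?subr0; last exact: (density_int_cst 0 dg).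
apply=> //.
- by move=> x; rewrite /= normr0.
- by move=> x _; rewrite /= subr0.
Qed.

(** The logarithm of |u|, with |u| confined to [d, S]: it is bounded and Lipschitz,
    hence can be discretized, and for |u| <= S it differs from ln |u| only when
    |u| < d. *)
Definition tlog (d S u : R) : R := ln (Num.max d (Num.min `|u| S)).

Lemma tlog_bound d S u : 0 < d <= S -> `|tlog d S u| <= `|ln d| + `|ln S|.
Proof.
move=> /andP[d0 dS]; rewrite /tlog; set v := Num.max _ _.
have v1 : d <= v by rewrite le_max lexx.
have v2 : v <= S by rewrite ge_max dS ge_min lexx orbT.
have v0 : 0 < v by exact: lt_le_trans v1.
have S0 : 0 < S by exact: lt_le_trans dS.
have : ln d <= ln v by rewrite ler_ln ?posrE.
have : ln v <= ln S by rewrite ler_ln ?posrE.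
have := ler_norm (ln S); have : - ln d <= `|ln d| by rewrite -normrN ler_norm.
have := normr_ge0 (ln S); have := normr_ge0 (ln d).
by rewrite ler_norml => *; apply/andP; split; lra.
Qed.

Lemma max_min_dist (d S x y : R) :
  `|Num.max d (Num.min x S) - Num.max d (Num.min y S)| <= `|x - y|.
Proof.
wlog xy : x y / x <= y.
  move=> H; have [/H//|/ltW/H] := leP x y.
  by rewrite distrC (distrC y).
have h1 : Num.min x S <= Num.min y S by rewrite le_min !ge_min xy lexx orbT.
have h2 : Num.max d (Num.min x S) <= Num.max d (Num.min y S).
  by rewrite ge_max !le_max lexx h1 orbT.
rewrite distrC (distrC x) !ger0_norm ?subr_ge0//.
have [?|?] := leP x S; have [?|?] := leP y S;
  rewrite /Num.max; repeat case: ifPn => ? ; lra.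
Qed.

Definition clamp (s x : R) : R := Num.max 0 (Num.min x s).

Lemma clamp_itv (s x : R) : 0 <= s -> 0 <= clamp s x <= s.
Proof. by move=> s0; rewrite le_max lexx ge_max s0 ge_min lexx orbT. Qed.

Lemma clamp_id (s x : R) : 0 <= x <= s -> clamp s x = x.
Proof. by move=> /andP[x0 xT]; rewrite /clamp (min_idPl xT) (max_idPr x0). Qed.

Lemma clamp_lip (s x y : R) : `|clamp s x - clamp s y| <= 1 * `|x - y|.
Proof. by rewrite mul1r; exact: max_min_dist. Qed.

Lemma tlog_lip d S u v : 0 < d -> `|tlog d S u - tlog d S v| <= `|u - v| / d.
Proof.
move=> d0.
suff H (x y : R) : tlog d S x - tlog d S y <= `|x - y| / d.
  rewrite ler_norml H andbT lerNl opprB.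
  by have := H v u; rewrite distrC.
rewrite /tlog; set s := Num.max d (Num.min `|x| S); set t := Num.max d (Num.min `|y| S).
have s0 : 0 < s by rewrite lt_max d0.
have t0 : 0 < t by rewrite lt_max d0.
have td : d <= t by rewrite le_max lexx.
apply: (le_trans (ln_sub_le s0 t0)).
have st : s - t <= `|x - y|.
  apply: le_trans (ler_norm _) _.
  by apply: le_trans (max_min_dist _ _ _ _) _; exact: ler_dist_dist.
apply: (@le_trans _ _ (`|x - y| / t)); first by rewrite ler_pM2r ?invr_gt0.
by rewrite ler_wpM2l// lef_pV2 ?posrE.
Qed.

Lemma measurable_tlog d S : measurable_fun [set: R] (tlog d S).
Proof.
apply: measurableT_comp; first exact: measurable_ln.
apply: measurable_maxr => //; apply: measurable_minr => //.
Qed.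

Lemma measurable_diff_kernel (h : R -> R) : measurable_fun [set: R] h ->
  measurable_fun [set: R * R] (fun z => h (z.1 - z.2)).
Proof.
move=> mh; apply: (measurableT_comp mh); apply: measurable_funB.
  exact: measurable_fst.
exact: measurable_snd.
Qed.

Lemma tlogE d S u : d <= `|u| <= S -> tlog d S u = ln `|u|.
Proof. by move=> /andP[du uS]; rewrite /tlog (min_idPl uS) (max_idPr du). Qed.

End Kernel.

(** * The logarithmic singularity *)

Section LogKernel.
Context {R : realType}.
Local Notation mu := (@lebesgue_measure R).
Local Notation mu2 := (@lebesgue_measure R \x @lebesgue_measure R)%E.
Implicit Types (f g h : R -> R) (k : R * R -> R) (a S d : R).

Lemma integral_inv (s d : R) : 0 < s <= d ->
  (\int[mu]_(r in `[s, d]) (r `^ (- 1))%:E = (ln d - ln s)%:E)%E.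
Proof.
move=> /andP[s0 sd0]; transitivity (\int[mu]_(r in `[s, d]) (r^-1)%:E)%E.
  apply: eq_integral => r /set_mem/=; rewrite in_itv/= => /andP[sr _].
  by rewrite powR_inv1// ltW// (lt_le_trans s0).
move: sd0; rewrite le_eqVlt => /predU1P[<-|sd].
  rewrite subrr (@integral_Sset1 _ _ _ s)//.
  by move=> x /=; rewrite in_itv/= => /andP[? ?]; apply/eqP; rewrite eq_le; apply/andP.
have lnD (x : R) : 0 < x -> derivable (@ln R) x 1.
  by move=> x0; apply: ex_derive; exact: is_derive1_ln.
have cln (x : R) : 0 < x -> {for x, continuous (@ln R)} by exact: continuous_ln.
rewrite (@continuous_FTC2 _ _ (@ln R))//.
- apply: continuous_in_subspaceT => x /set_mem/=; rewrite in_itv/= => /andP[sx _].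
  apply: cvgV; last exact: cvg_id.
  by rewrite gt_eqF// (lt_le_trans s0).
- split.
  + by move=> x; rewrite in_itv/= => /andP[sx _]; apply: lnD; exact: lt_trans sx.
  + by apply: cvg_at_right_filter; exact: cln.
  + by apply: cvg_at_left_filter; apply: cln; exact: lt_trans sd.
- move=> x; rewrite in_itv/= => /andP[sx _].
  have h := is_derive1_ln (lt_trans s0 sx).
  by rewrite derive1E (@derive_val _ _ _ _ _ _ _ h).
Qed.

Lemma measurable_ler_nat dT (T : measurableType dT) (f g : T -> R) :
  measurable_fun [set: T] f -> measurable_fun [set: T] g ->
  measurable_fun [set: T] (fun z => (f z <= g z)%R%:R : R).
Proof.
move=> mf mg.
have -> : (fun z => (f z <= g z)%R%:R : R) = fun z => if f z <= g z then 1 else 0.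
  by apply/funext => z; case: ifP.
by apply: measurable_fun_ifT => //; exact: measurable_fun_ler.
Qed.

Lemma measurable_ltr_nat dT (T : measurableType dT) (f g : T -> R) :
  measurable_fun [set: T] f -> measurable_fun [set: T] g ->
  measurable_fun [set: T] (fun z => (f z < g z)%R%:R : R).
Proof.
move=> mf mg.
have -> : (fun z => (f z < g z)%R%:R : R) = fun z => if f z < g z then 1 else 0.
  by apply/funext => z; case: ifP.
by apply: measurable_fun_ifT => //; exact: measurable_fun_ltr.
Qed.

(** The weight 1 / r on ]0, d].  Its integral over r >= |u| is ln d - ln |u|, a form
    of the singularity in which Tonelli's theorem gives the integral over u. *)
Definition inv_weight d (r : R) : R := (0 < r)%R%:R * (r <= d)%R%:R * r `^ (- 1).

Lemma inv_weight_ge0 d (r : R) : 0 <= inv_weight d r.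
Proof. by rewrite !mulr_ge0 ?powR_ge0 ?ler0n. Qed.

Lemma measurable_inv_weight d : measurable_fun [set: R] (inv_weight d).
Proof.
apply: measurable_funM; last exact: measurable_powR.
by apply: measurable_funM; [exact: measurable_ltr_nat|exact: measurable_ler_nat].
Qed.

Lemma measurable_inv_weight_pair d (x : R) :
  measurable_fun [set: R * R]
    (fun z => (inv_weight d z.2 * (`|x - z.1| <= z.2)%R%:R)%:E).
Proof.
apply/measurable_EFinP; apply: measurable_funM.
  by apply: (measurableT_comp (measurable_inv_weight d)); exact: measurable_snd.
apply: measurable_ler_nat; last exact: measurable_snd.
by apply: measurableT_comp => //; exact: measurable_funB.
Qed.

Lemma measurable_inv_weight_integral d (x : R) : measurable_fun [set: R]
  (fun y => \int[mu]_r (inv_weight d r * (`|x - y| <= r)%R%:R)%:E)%E.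
Proof.
pose G (z : R * R) := (inv_weight d z.2 * (`|x - z.1| <= z.2)%R%:R)%:E.
apply: (@measurable_fun_fubini_tonelli_F _ _ _ _ _ mu G) => [|z].
  exact: measurable_inv_weight_pair.
by rewrite lee_fin mulr_ge0 ?inv_weight_ge0 ?ler0n.
Qed.

Lemma near_log_ge d (u s : R) : 0 < s <= d -> `|u| <= s ->
  ((ln d - ln s)%:E <= \int[mu]_r (inv_weight d r * (`|u| <= r)%R%:R)%:E)%E.
Proof.
move=> sd us; rewrite -integral_inv//.
have /andP[s0 _] := sd.
rewrite integral_mkcond; apply: ge0_le_integral => //=.
- by move=> r _; rewrite patchE; case: ifPn => // /set_mem/=; rewrite in_itv/= => /andP[sr _];
    rewrite lee_fin powR_ge0.
- apply: (measurable_restrictT _ (measurable_itv `[s, d])).1; apply: measurable_funTS.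
  by apply/measurable_EFinP; exact: measurable_powR.
- apply/measurable_EFinP; apply: measurable_funM.
    exact: measurable_inv_weight.
  by apply: measurable_ler_nat => //; exact: measurable_cst.
- move=> r _; rewrite patchE; case: ifPn => [/set_mem/=|_]; last first.
    by rewrite lee_fin mulr_ge0 ?inv_weight_ge0// ler0n.
  rewrite in_itv/= => /andP[sr rd].
  have r0 : 0 < r by exact: lt_le_trans sr.
  by rewrite lee_fin /inv_weight r0 rd (le_trans us sr) !mul1r mulr1.
Qed.

(** For 0 < |u| < d both sides are ln d - ln |u|.  At u = 0 the left-hand side is
    |ln d|, the logarithm of 0 being 0 by convention, and the right-hand side is
    infinite. *)
Lemma near_log d S (u : R) : 0 < d <= S -> `|u| <= S ->
  (`|ln `|u| - tlog d S u|%:E <=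
   \int[mu]_r (inv_weight d r * (`|u| <= r)%R%:R)%:E)%E.
Proof.
move=> /andP[d0 dS] uS.
have [du|ud] := leP d `|u|.
  rewrite tlogE ?du// subrr normr0; apply: integral_ge0 => r _.
  by rewrite lee_fin mulr_ge0 ?inv_weight_ge0// ler0n.
have -> : tlog d S u = ln d.
  by rewrite /tlog (min_idPl uS) (max_idPl (ltW ud)).
have [u0|u0] := eqVneq u 0.
  rewrite u0 normr0 ln0// sub0r normrN.
  (* With this s the difference ln d - ln s is |ln d|. *)
  pose s := d * expR (- `|ln d|).
  have s0 : 0 < s by rewrite mulr_gt0// expR_gt0.
  have sd : s <= d by rewrite ler_piMr ?(ltW d0)// expR_le1 oppr_le0.
  have := @near_log_ge d 0 s; rewrite normr0 s0 sd (ltW s0) => /(_ isT isT).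
  rewrite lnM ?posrE ?expR_gt0// expRK.
  by have -> : ln d - (ln d - `|ln d|) = `|ln d| by ring.
have un0 : 0 < `|u| by rewrite normr_gt0.
rewrite ler0_norm; last by rewrite subr_le0 ler_ln ?posrE// ltW.
by rewrite opprB; apply: near_log_ge => //; rewrite un0 ltW.
Qed.

(** By Tonelli this is the integral over r in ]0, d] of 1 / r times the length 2 r of
    {y : |x - y| <= r}. *)
Lemma integral_near_log d (x : R) : 0 < d ->
  (\int[mu]_y \int[mu]_r (inv_weight d r * (`|x - y| <= r)%R%:R)%:E = (2 * d)%:E)%E.
Proof.
move=> d0.
pose F (z : R * R) := (inv_weight d z.2 * (`|x - z.1| <= z.2)%R%:R)%:E.
have mF : measurable_fun [set: R * R] F.
  exact: measurable_inv_weight_pair.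
have F0 z : (0 <= F z)%E by rewrite lee_fin mulr_ge0 ?inv_weight_ge0// ler0n.
transitivity (\int[mu]_y \int[mu]_r F (y, r))%E => //.
rewrite fubini_tonelli// /F/=.
transitivity (\int[mu]_r (2 * \1_(`]0, d]) r)%:E)%E.
  apply: eq_integral => r _.
  have [r0|r0] := boolP (0 < r <= d); last first.
    rewrite integral0_eq; last first.
      move=> y _; rewrite /inv_weight.
      by move: r0; rewrite negb_and => /orP[]/negbTE ->; rewrite ?mul0r ?mulr0 ?mul0r.
    by rewrite indicE memNset ?mulr0//= in_itv/=; exact/negP.
  have /andP[r0' rd] := r0.
  rewrite indicE mem_set/= ?in_itv//= mulr1.
  under eq_integral do rewrite EFinM.
  rewrite ge0_integralZl_EFin//.
  - have -> : (\int[mu]_y (`|x - y| <= r)%R%:R%:E = (2 * r)%:E)%E.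
      transitivity (\int[mu]_y (\1_(`[x - r, x + r]) y)%:E)%E.
        apply: eq_integral => y _; rewrite indicE; congr ((nat_of_bool _)%:R%:E).
        apply/idP/idP; rewrite inE/= in_itv/= ler_norml => /andP[? ?];
          by apply/andP; split; lra.
      rewrite integral_indic// setIT /= lebesgue_measure_itv/= lte_fin.
      have -> : x - r < x + r by lra.
      by rewrite -EFinB; congr EFin; ring.
    rewrite -EFinM; congr EFin; rewrite /inv_weight r0' rd !mul1r powR_inv1 ?ltW//.
    by field; rewrite gt_eqF.
  - apply/measurable_EFinP; apply: measurable_ler_nat => //.
    apply: measurableT_comp => //; exact: measurable_funB.
  - exact: inv_weight_ge0.
under eq_integral do rewrite EFinM.
rewrite ge0_integralZl_EFin//.
- rewrite integral_indic// setIT /= lebesgue_measure_itv/= lte_fin d0 -EFinB -EFinM.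
  by rewrite subr0.
- by apply/measurable_EFinP; exact: measurable_indic.
Qed.

End LogKernel.

Section LogPair.
Context {R : realType}.
Local Notation mu := (@lebesgue_measure R).
Local Notation mu2 := (@lebesgue_measure R \x @lebesgue_measure R)%E.
Implicit Types (f g h : R -> R) (a S T d : R).

Definition log_pair f g : R := \int[mu2]_z (ln `|z.1 - z.2| * f z.1 * g z.2).

Definition tlog_pair d S f g : R :=
  \int[mu2]_z (tlog d S (z.1 - z.2) * f z.1 * g z.2).

Lemma measurable_log_kernel :
  measurable_fun [set: R * R] (fun z : R * R => ln `|z.1 - z.2|).
Proof.
apply: (@measurable_diff_kernel _ (fun u => ln `|u|)).
by apply: measurableT_comp.
Qed.

Lemma measurable_tlog_kernel d S :
  measurable_fun [set: R * R] (fun z : R * R => tlog d S (z.1 - z.2)).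
Proof. exact: measurable_diff_kernel (measurable_tlog d S). Qed.

Lemma dist_itv_le T (x y : R) : 0 <= x <= T -> 0 <= y <= T -> `|x - y| <= T.
Proof.
by move=> /andP[? ?] /andP[? ?]; rewrite ler_norml; apply/andP; split; lra.
Qed.

Lemma measurable_kernel_tensor (k : R * R -> R) f g :
  measurable_fun [set: R * R] k -> measurable_fun [set: R] f ->
  measurable_fun [set: R] g ->
  measurable_fun [set: R * R] (fun z => k z * f z.1 * g z.2).
Proof.
move=> mk mf mg; under eq_fun do rewrite -mulrA.
by apply: measurable_funM => //; exact: measurable_tensor.
Qed.

(** The density of [g] is at most [a] and the singularity has integral 2 d, whatever
    the position of the other point; [f] has mass 1. *)
Lemma near_log_pair_le a d S T f g : 0 < d <= S -> T <= S ->
  density a T f -> density a T g ->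
  (\int[mu2]_z (`|ln `|z.1 - z.2| - tlog d S (z.1 - z.2)| * f z.1 * g z.2)%:E <=
   (2 * a * d)%:E)%E.
Proof.
move=> dS TS df dg; have /andP[d0 _] := dS.
have mf := density_measurable df; have mg := density_measurable dg.
have a0 : 0 <= a by exact: le_trans (density_ge0 0 df) (density_le 0 df).
pose D (u : R) := `|ln `|u| - tlog d S u|.
have D0 u : 0 <= D u by exact: normr_ge0.
have mD : measurable_fun [set: R] D.
  apply: measurableT_comp => //; apply: measurable_funB.
    exact: measurableT_comp.
  exact: measurable_tlog.
pose F (z : R * R) := (D (z.1 - z.2) * f z.1 * g z.2)%:E.
have mF : measurable_fun [set: R * R] F.
  apply/measurable_EFinP; apply: measurable_kernel_tensor => //.
  exact: measurable_diff_kernel mD.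
have F0 z : (0 <= F z)%E.
  by rewrite lee_fin !mulr_ge0 ?D0 ?(density_ge0 _ df) ?(density_ge0 _ dg).
rewrite (_ : (\int[mu2]_z _)%E = \int[mu2]_z F z)%E // fubini_tonelli1//.
have E x : (fubini_F mu F x =
    (f x)%:E * \int[mu]_y (D (x - y) * g y)%:E)%E.
  rewrite /fubini_F /F/=.
  under eq_integral do rewrite mulrAC mulrC EFinM.
  rewrite ge0_integralZl_EFin// ?(density_ge0 _ df)//.
  - by move=> y _; rewrite lee_fin mulr_ge0 ?D0 ?(density_ge0 _ dg).
  - apply/measurable_EFinP; apply: measurable_funM => //.
    by apply: measurableT_comp => //; exact: measurable_funB.
apply: (@le_trans _ _ (\int[mu]_x ((f x)%:E * \int[mu]_y (D (x - y) * g y)%:E))%E).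
  by rewrite le_eqVlt; apply/orP; left; apply/eqP; apply: eq_integral => x _; exact: E.
have inner x : 0 <= x <= T -> (\int[mu]_y (D (x - y) * g y)%:E <= (2 * a * d)%:E)%E.
  move=> xT.
  apply: (@le_trans _ _ (\int[mu]_y (a%:E *
      \int[mu]_r (inv_weight d r * (`|x - y| <= r)%R%:R)%:E))%E).
    apply: ge0_le_integral => //.
    - by move=> y _; rewrite lee_fin mulr_ge0 ?D0 ?(density_ge0 _ dg).
    - apply/measurable_EFinP; apply: measurable_funM => //.
      by apply: measurableT_comp => //; exact: measurable_funB.
    - apply: measurable_funeM.
      exact: measurable_inv_weight_integral.
    - move=> y _; have [yT|yT] := boolP (0 <= y <= T); last first.
        case: dg => _ _ -> // _; rewrite mulr0 mule_ge0 ?lee_fin//.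
        by apply: integral_ge0 => r _; rewrite lee_fin mulr_ge0 ?inv_weight_ge0 ?ler0n.
      apply: (@le_trans _ _ (a%:E * (D (x - y))%:E)%E).
        by rewrite -EFinM lee_fin mulrC ler_wpM2r// (density_le _ dg).
      apply: lee_wpmul2l; first by rewrite lee_fin.
      by apply: near_log => //; apply: le_trans TS; exact: dist_itv_le.
  rewrite ge0_integralZl_EFin//.
  - by rewrite integral_near_log// -EFinM lee_fin mulrCA mulrA.
  - by move=> y _; apply: integral_ge0 => r _; rewrite lee_fin mulr_ge0 ?inv_weight_ge0 ?ler0n.
  - exact: measurable_inv_weight_integral.
apply: (@le_trans _ _ (\int[mu]_x ((2 * a * d)%:E * (f x)%:E))%E).
  apply: ge0_le_integral => //.
  - move=> x _; rewrite mule_ge0 ?lee_fin ?(density_ge0 _ df)//.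
    by apply: integral_ge0 => y _; rewrite lee_fin mulr_ge0 ?D0 ?(density_ge0 _ dg).
  - rewrite (_ : (fun _ => _) = fubini_F mu F); last first.
      by apply/funext => x; rewrite E.
    exact: measurable_fun_fubini_tonelli_F.
  - by apply: measurable_funeM; exact/measurable_EFinP.
  - move=> x _; have [xT|xT] := boolP (0 <= x <= T).
      by rewrite [leRHS]muleC; apply: lee_wpmul2l; rewrite ?lee_fin ?(density_ge0 _ df) ?inner.
    by case: df => _ _ -> // _; rewrite mul0e mule0.
rewrite ge0_integralZl_EFin//.
- by rewrite (density_EFin_int df) mule1.
- by move=> x _; rewrite lee_fin (density_ge0 _ df).
- exact/measurable_EFinP.
- by rewrite !mulr_ge0// ltW.
Qed.

Lemma integrable_near_log a d S T f g : 0 < d <= S -> T <= S ->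
  density a T f -> density a T g ->
  mu2.-integrable [set: R * R] (EFin \o (fun z : R * R =>
    (ln `|z.1 - z.2| - tlog d S (z.1 - z.2)) * f z.1 * g z.2)).
Proof.
move=> dS TS df dg.
have mf := density_measurable df; have mg := density_measurable dg.
apply/integrableP; split.
  apply/measurable_EFinP; apply: measurable_kernel_tensor => //.
  by apply: measurable_funB; [exact: measurable_log_kernel|exact: measurable_tlog_kernel].
apply: le_lt_trans (ltry (2 * a * d)).
apply: le_trans (near_log_pair_le dS TS df dg).
rewrite le_eqVlt; apply/orP; left; apply/eqP; apply: eq_integral => z _ /=.
by rewrite !normrM (ger0_norm (density_ge0 _ df)) (ger0_norm (density_ge0 _ dg)).
Qed.

Lemma integrable_tlog_pair a d S T f g : 0 < d <= S ->
  density a T f -> density a T g ->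
  mu2.-integrable [set: R * R] (EFin \o (fun z : R * R =>
    tlog d S (z.1 - z.2) * f z.1 * g z.2)).
Proof.
move=> dS df dg.
apply: (integrable_bounded_tensor df dg (measurable_tlog_kernel d S)).
by move=> z; exact: tlog_bound.
Qed.

Lemma integrable_log_pair a T f g :
  density a T f -> density a T g ->
  mu2.-integrable [set: R * R] (EFin \o (fun z : R * R =>
    ln `|z.1 - z.2| * f z.1 * g z.2)).
Proof.
move=> df dg; pose S := Num.max 1 T.
have dS : 0 < (1 : R) <= S by rewrite ltr01 le_max lexx.
have TS : T <= S by rewrite le_max lexx orbT.
have := integrableD measurableT (integrable_near_log dS TS df dg)
  (integrable_tlog_pair dS df dg).
apply: eq_integrable => // z _; rewrite /= -EFinD; congr EFin; ring.
Qed.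

Lemma log_pair_tlog a d S T f g : 0 < d <= S -> T <= S ->
  density a T f -> density a T g ->
  `|log_pair f g - tlog_pair d S f g| <= 2 * a * d.
Proof.
move=> dS TS df dg; rewrite /log_pair /tlog_pair.
rewrite -RintegralB//; last 2 first.
- exact: integrable_log_pair df dg.
- exact: integrable_tlog_pair dS df dg.
have inl := integrable_near_log dS TS df dg.
rewrite (_ : Rintegral _ _ _ = \int[mu2]_z
    ((ln `|z.1 - z.2| - tlog d S (z.1 - z.2)) * f z.1 * g z.2)); last first.
  by apply: eq_Rintegral => z _; ring.
apply: (le_trans (le_normr_Rintegral _ inl)) => //.
have := near_log_pair_le dS TS df dg.
rewrite /Rintegral (_ : (\int[mu2]_z _)%E = (\int[mu2]_z
    (`|ln `|z.1 - z.2| - tlog d S (z.1 - z.2)| * f z.1 * g z.2)%:E)%E); last first.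
  apply: eq_integral => z _ /=.
  by rewrite !normrM (ger0_norm (density_ge0 _ df)) (ger0_norm (density_ge0 _ dg)).
set I := (\int[mu2]_z _)%E => H.
rewrite -lee_fin fineK// ge0_fin_numE.
  exact: le_lt_trans H (ltry _).
by apply: integral_ge0 => z _; rewrite lee_fin !mulr_ge0 ?(density_ge0 _ df) ?(density_ge0 _ dg).
Qed.

End LogPair.

(** * The energy of a density *)

Section Admissible.
Context {R : realType}.
Local Notation mu := (@lebesgue_measure R).
Local Notation mu2 := (@lebesgue_measure R \x @lebesgue_measure R)%E.
Implicit Types (f g h U V : R -> R) (theta s t a d S T x y : R).

Definition density_energy theta U f : R :=
  - theta * log_pair f f + \int[mu]_x (U x * f x).

Lemma negligible_preimage_fst (A : set R) : mu.-negligible A ->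
  mu2.-negligible [set z : R * R | A z.1].
Proof.
move=> [B [mB B0 AB]]; exists (B `*` [set: R]); split.
- exact: measurableX.
- transitivity (mu B * mu [set: R])%E; first exact: product_measure1E.
  by rewrite B0 mul0e.
- by move=> z /= /AB.
Qed.

Lemma negligible_preimage_snd (A : set R) : mu.-negligible A ->
  mu2.-negligible [set z : R * R | A z.2].
Proof.
move=> [B [mB B0 AB]]; exists ([set: R] `*` B); split.
- exact: measurableX.
- transitivity (mu [set: R] * mu B)%E; first exact: product_measure1E.
  by rewrite B0 mule0.
- by move=> z /= /AB.
Qed.

Lemma log_pair_ae f g : measurable_fun [set: R] f -> measurable_fun [set: R] g ->
  {ae mu, forall x, f x = g x} -> log_pair f f = log_pair g g.
Proof.
move=> mf mg fg; rewrite /log_pair /Rintegral; congr fine.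
apply: ae_eq_integral => //.
- apply/measurable_EFinP; apply: measurable_kernel_tensor => //.
  exact: measurable_log_kernel.
- apply/measurable_EFinP; apply: measurable_kernel_tensor => //.
  exact: measurable_log_kernel.
- have := negligibleU (negligible_preimage_fst fg) (negligible_preimage_snd fg).
  apply: negligibleS => z /= H.
  have [z1|] := pselect (f z.1 = g z.1); last by left.
  have [z2|] := pselect (f z.2 = g z.2); last by right.
  by exfalso; apply: H => _; rewrite z1 z2.
Qed.

Lemma energyE theta V U s f : (forall x, 0 <= x <= s -> V x = U x) ->
  (forall x, ~~ (0 <= x <= s) -> f x = 0) ->
  energy theta V s f = density_energy theta U f.
Proof.
move=> VU f0; rewrite /energy /density_energy /log_pair; congr (_ * _ + _).
  rewrite Rintegral_mkcond; apply: eq_Rintegral => z _; rewrite patchE.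
  case: ifPn => //; rewrite notin_setE/= !in_itv/= => /not_andP[/negP|/negP] zs.
    by rewrite (f0 z.1)// mulr0 mul0r.
  by rewrite (f0 z.2)// mulr0.
rewrite Rintegral_mkcond; apply: eq_Rintegral => x _; rewrite patchE.
case: ifPn; first by move=> /set_mem/=; rewrite in_itv/= => /VU ->.
by rewrite notin_setE/= in_itv/= => /negP/f0 ->; rewrite mulr0.
Qed.

Lemma admissible_density theta s f : density theta^-1 s f ->
  admissible theta s f.
Proof.
move=> df; split.
- exact: integrableS (integrable_density df).
- apply: (@aeW _ _ _ mu) => x _.
  by rewrite (density_ge0 _ df) (density_le _ df).
- have [_ _ _ <-] := df; rewrite Rintegral_mkcond; congr Rintegral.
  by apply/esym; exact: density_restrict df.
Qed.

(** Cutting [phi] off to values in [0, theta^-1] on [0, s], and to 0 elsewhere,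
    changes it on a null set of [0, s] only; in the double integral the null set
    becomes two null strips of the plane.  The energy sees the potential on
    [0, s] only, which allows for a [U] that is measurable on the whole line. *)
Lemma admissible_ae_density theta s phi : 0 < theta -> admissible theta s phi ->
  exists f, [/\ density theta^-1 s f,
    (forall V U, measurable_fun [set: R] U ->
      (forall x, 0 <= x <= s -> V x = U x) ->
      energy theta V s phi = density_energy theta U f) &
    forall E, measurable E ->
      \int[mu]_(x in E `&` `[0, s]) phi x = \int[mu]_(x in E) f x].
Proof.
move=> theta0 [iphi bphi phi1].
have a0 : 0 <= theta^-1 by rewrite invr_ge0 ltW.
pose phi0 := phi \_ `[0, s].
pose f := (fun x => Num.max 0 (Num.min (phi x) theta^-1)) \_ `[0, s].
have mphi : measurable_fun `[0, s] phi.
  by apply/measurable_EFinP; exact: measurable_int iphi.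
have mphi0 : measurable_fun [set: R] phi0.
  by apply: (measurable_restrictT _ (measurable_itv `[0, s])).1.
have mf : measurable_fun [set: R] f.
  apply: (measurable_restrictT _ (measurable_itv `[0, s])).1.
  by apply: measurable_maxr => //; exact: measurable_minr.
have phi0f : {ae mu, forall x, phi0 x = f x}.
  apply: (@filterS _ _ (ae_filter_ringOfSetsType mu) _ _ _ bphi) => x H; rewrite /phi0 /f !patchE; case: ifPn => // /set_mem/= xs.
  have /andP[p0 pa] := H xs.
  by rewrite (min_idPl pa) (max_idPr p0).
have int_eq (h : R -> R) E : measurable_fun [set: R] h -> measurable E ->
    \int[mu]_(x in E `&` `[0, s]) (h x * phi x) = \int[mu]_(x in E) (h x * f x).
  move=> mh mE.
  transitivity (\int[mu]_(x in E) (h x * phi0 x)).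
    rewrite Rintegral_mkcondr; apply: eq_Rintegral => x _.
    by rewrite /phi0 !patchE; case: ifPn => // _; rewrite mulr0.
  rewrite /Rintegral; congr fine; apply: ae_eq_integral => //.
  - by apply: measurable_funTS; apply/measurable_EFinP; exact: measurable_funM.
  - by apply: measurable_funTS; apply/measurable_EFinP; exact: measurable_funM.
  - by apply: (@filterS _ _ (ae_filter_ringOfSetsType mu) _ _ _ phi0f) => x -> _.
have int_eq1 E : measurable E ->
    \int[mu]_(x in E `&` `[0, s]) phi x = \int[mu]_(x in E) f x.
  move=> mE; have := int_eq (cst 1) E (measurable_cst _) mE => H.
  transitivity (\int[mu]_(x in E `&` `[0, s]) (cst 1 x * phi x)).
    by apply: eq_Rintegral => x _; rewrite mul1r.
  by rewrite H; apply: eq_Rintegral => x _; rewrite mul1r.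
exists f; split => //.
- split => //.
  + move=> x; rewrite /f patchE; case: ifPn => _; last by rewrite lexx a0.
    by rewrite le_max lexx/= ge_max a0 ge_min lexx orbT.
  + move=> x xs; rewrite /f patchE memNset//= in_itv/=; exact/negP.
  + by rewrite -int_eq1// setTI.
- move=> V U mU VU.
  rewrite (_ : energy theta V s phi = energy theta V s phi0).
    rewrite (energyE theta VU); last first.
      by move=> x xs; rewrite /phi0 patchE memNset//= in_itv/=; exact/negP.
    rewrite /density_energy (log_pair_ae mphi0 mf phi0f); congr (_ + _).
    rewrite -int_eq// setTI [RHS]Rintegral_mkcond.
    apply: eq_Rintegral => x _.
    by rewrite /phi0 !patchE; case: ifPn => // _; rewrite mulr0.
  rewrite /energy; congr (_ * _ + _); apply: eq_Rintegral.
    move=> z /set_mem[z1 z2].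
    by rewrite /phi0 !patchE !mem_set.
  by move=> x xs; rewrite /phi0 patchE xs.
Qed.

Definition tlog_pot d S g x : R := \int[mu]_y (tlog d S (x - y) * g y).

Lemma measurable_tlog_shift d S x : measurable_fun [set: R] (fun y => tlog d S (x - y)).
Proof. by apply: (measurableT_comp (measurable_tlog d S)); exact: measurable_funB. Qed.

Lemma tlog_pot_bound a T d S g x : 0 < d <= S -> density a T g ->
  `|tlog_pot d S g x| <= `|ln d| + `|ln S|.
Proof.
move=> dS dg; apply: (density_pot_bound dg); first exact: measurable_tlog_shift.
by move=> y; exact: tlog_bound.
Qed.

Lemma tlog_pot_lip a T d S g x y : 0 < d <= S -> density a T g ->
  `|tlog_pot d S g x - tlog_pot d S g y| <= d^-1 * `|x - y|.
Proof.
move=> dS dg; have /andP[d0 _] := dS.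
apply: (density_int_dist dg (measurable_tlog_shift d S x) (fun=> tlog_bound _ dS)
  (measurable_tlog_shift d S y) (fun=> tlog_bound _ dS)) => z _.
apply: (le_trans (tlog_lip _ _ _ d0)); rewrite mulrC.
by have -> : x - z - (y - z) = x - y by ring.
Qed.

Lemma measurable_tlog_pot a T d S g : 0 < d <= S -> density a T g ->
  measurable_fun [set: R] (tlog_pot d S g).
Proof.
move=> dS dg; have /andP[d0 _] := dS.
apply: (@lipschitz_measurable _ _ d^-1); first by rewrite invr_ge0 ltW.
by move=> x y; exact: tlog_pot_lip dS dg.
Qed.

Lemma tlog_pairE a T d S f g : 0 < d <= S -> density a T f -> density a T g ->
  tlog_pair d S f g = \int[mu]_x (tlog_pot d S g x * f x).
Proof.
move=> dS df dg; rewrite /tlog_pair.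
exact: (Rintegral_tensor df dg (measurable_tlog_kernel d S) (fun z => tlog_bound _ dS)).
Qed.

(** The truncated logarithm is bounded and the truncation costs at most 2 a. *)
Lemma density_energy_lb a theta T U B : 0 < a -> 0 < theta -> measurable_fun [set: R] U ->
  (forall x, `|U x| <= B) -> exists L : R, forall f, density a T f ->
    L <= density_energy theta U f.
Proof.
(* Truncation at d = 1; S has to be at least d and T. *)
move=> a0 theta0 mU UB; pose S := Num.max 1 T.
have dS : 0 < (1 : R) <= S by rewrite ltr01 le_max lexx.
have TS : T <= S by rewrite le_max lexx orbT.
exists (- theta * ((`|ln 1| + `|ln S|) + 2 * a * 1) - B) => f df.
apply: lerD; last first.
  have := density_pot_bound df mU UB.
  by rewrite ler_norml => /andP[].
rewrite !mulNr lerN2 ler_pM2l//.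
have := log_pair_tlog dS TS df df; rewrite ler_norml => /andP[_ h].
suff : tlog_pair 1 S f f <= `|ln 1| + `|ln S| by lra.
rewrite (tlog_pairE dS df df).
have := density_pot_bound df (measurable_tlog_pot dS df) (fun x => tlog_pot_bound x dS df).
by rewrite ler_norml => /andP[].
Qed.

End Admissible.

(** * Strict convexity of the logarithmic energy *)

Section TentKernel.
Context {R : realType}.
Local Notation mu := (@lebesgue_measure R).
Local Notation mu2 := (@lebesgue_measure R \x @lebesgue_measure R)%E.
Implicit Types (f g : R -> R) (w : R * R) (a L T t u x y z r : R).

(** The pair w = (r, z) stands for the interval [z, z + r]. *)
Definition window w x : R := (w.2 <= x)%R%:R * (x <= w.2 + w.1)%R%:R.

(** The factor r^-2 is dictated by [integral_tent]: it is the second derivative of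
    - ln r.  The cutoff at [L] makes the integral finite. *)
Definition window_weight L r : R := (0 < r)%R%:R * (r <= L)%R%:R * r `^ (- 2).

Lemma window_ge0 w x : 0 <= window w x.
Proof. by rewrite mulr_ge0 ?ler0n. Qed.

Lemma window_le1 w x : window w x <= 1.
Proof. by rewrite /window; case: (_ <= x); case: (x <= _); rewrite ?mulr1 ?mulr0 ?ler01. Qed.

Lemma window_weight_ge0 L r : 0 <= window_weight L r.
Proof. by rewrite !mulr_ge0 ?powR_ge0 ?ler0n. Qed.

Lemma measurable_window_weight L : measurable_fun [set: R] (window_weight L).
Proof.
apply: measurable_funM; last exact: measurable_powR.
by apply: measurable_funM; [exact: measurable_ltr_nat|exact: measurable_ler_nat].
Qed.

Lemma measurable_window_gen d (T0 : measurableType d) (W : T0 -> R * R) (X : T0 -> R) :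
  measurable_fun [set: T0] W -> measurable_fun [set: T0] X ->
  measurable_fun [set: T0] (fun p => window (W p) (X p)).
Proof.
move=> mW mX.
have m2 : measurable_fun [set: T0] (fun p => (W p).2).
  by apply: (measurableT_comp _ mW); exact: measurable_snd.
have m1 : measurable_fun [set: T0] (fun p => (W p).1).
  by apply: (measurableT_comp _ mW); exact: measurable_fst.
apply: measurable_funM; first exact: measurable_ler_nat.
by apply: measurable_ler_nat => //; exact: measurable_funD.
Qed.

(** The z for which [z, z + r] contains x and y form an interval of length
    r - |x - y|, if this is positive. *)
Lemma integral_window_pair r x y : 0 < r ->
  (\int[mu]_z (window (r, z) x * window (r, z) y)%:E =
   (Num.max 0 (r - `|x - y|))%:E)%E.
Proof.
move=> r0.
wlog xy : x y / x <= y.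
  move=> H; have [/H//|/ltW/H] := leP x y.
  by rewrite distrC => <-; apply: eq_integral => z _; rewrite mulrC.
have -> : `|x - y| = y - x by rewrite distrC ger0_norm// subr_ge0.
transitivity (\int[mu]_z (\1_(`[y - r, x]) z)%:E)%E.
  apply: eq_integral => z _; rewrite indicE /window/=; congr EFin.
  have [zx|zx] := leP z x; last first.
    by rewrite !mul0r memNset//= in_itv/= (leNgt z x) zx andbF.
  have [yz|yz] := leP y (z + r); last first.
    rewrite !mulr0 memNset//= in_itv/= => /andP[h _].
    by move: yz; rewrite ltNge -lerBlDr h.
  rewrite (le_trans zx xy) (le_trans xy yz) !mulr1 mem_set//= in_itv/= zx andbT.
  by rewrite lerBlDr.
rewrite integral_indic// setIT /= lebesgue_measure_itv/= lte_fin.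
have [h|h] := ltP (y - r) x.
  rewrite -EFinB (max_idPr _); last by lra.
  by congr EFin; ring.
by rewrite (max_idPl _)//; lra.
Qed.

(** The integrand is r^-1 - u r^-2 on [u, L], with primitive ln r + u / r. *)
Lemma integral_tent L u : 0 < u < L ->
  (\int[mu]_r (window_weight L r * Num.max 0 (r - u))%:E =
   (ln L - 1 + u / L - ln u)%:E)%E.
Proof.
move=> /andP[u0 uL]; have L0 : 0 < L by exact: lt_trans uL.
transitivity (\int[mu]_(r in `[u, L]) (r `^ (- 1) - u * r `^ (- 2))%:E)%E.
  rewrite [RHS]integral_mkcond; apply: eq_integral => r _; rewrite patchE.
  case: ifPn => [/set_mem/=|]; rewrite ?notin_setE/= in_itv/=.
    move=> /andP[ur rL]; have r0 : 0 < r by exact: lt_le_trans ur.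
    rewrite /window_weight r0 rL !mul1r (max_idPr _) ?subr_ge0// mulrBr; congr EFin.
    congr (_ - _); last exact: mulrC.
    have h : (- 2 + 1 == 0 :> R) ==> (r != 0) by rewrite (gt_eqF r0) implybT.
    rewrite -[X in _ * X](powRr1 (ltW r0)) -(powRD h).
    by congr (_ `^ _); ring.
  move=> /negP; rewrite negb_and -!ltNge => /orP[ru|Lr].
    by rewrite (max_idPl _) ?mulr0// subr_le0 ltW.
  by rewrite /window_weight (leNgt r L) Lr mulr0 !mul0r.
have dln r : 0 < r -> is_derive r (1:R) (fun r => ln r + u * r `^ (- 1))
    (r `^ (- 1) - u * r `^ (- 2)).
  move=> r0.
  have h1 := is_derive1_ln r0.
  have h2 : is_derive r (1:R) (fun r : R => r `^ (- 1)) ((- 1) * r `^ (- 1 - 1)).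
    exact: is_derive1_powR.
  have h3 := is_deriveZ u h2.
  have h := is_deriveD h1 h3; apply: is_derive_eq h _.
  rewrite powR_inv1 ?ltW// /GRing.scale/=.
  have -> : - 1 - 1 = - 2 :> R by ring.
  ring.
have cF r : 0 < r -> {for r, continuous (fun r => ln r + u * r `^ (- 1))}.
  move=> r0; apply: differentiable_continuous; apply/derivable1_diffP.
  by apply: ex_derive; exact: dln.
rewrite (@continuous_FTC2 _ _ (fun r => ln r + u * r `^ (- 1)))//.
- rewrite -EFinB !powR_inv1 ?ltW// divff ?gt_eqF//; congr EFin; ring.
- apply: continuous_in_subspaceT => r /set_mem/=; rewrite in_itv/= => /andP[ur _].
  have r0 : 0 < r by exact: lt_le_trans ur.
  have cp (e : R) : {for r, continuous (@powR R ^~ e)}.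
    apply: differentiable_continuous; apply/derivable1_diffP.
    by apply: derivable_powR; rewrite in_itv/= r0.
  apply: cvgB; first exact: cp.
  by apply: cvgM; [exact: cvg_cst|exact: cp].
- split.
  + move=> r; rewrite in_itv/= => /andP[ur _]; apply: ex_derive; apply: dln.
    exact: lt_trans ur.
  + by apply: cvg_at_right_filter; exact: cF.
  + by apply: cvg_at_left_filter; apply: cF.
- move=> r; rewrite in_itv/= => /andP[ur _].
  have h := dln _ (lt_trans u0 ur).
  by rewrite derive1E (@derive_val _ _ _ _ _ _ _ h).
Qed.

(** A kernel [window w x * window w y] is positive definite, being a square as a
    bilinear form.  So - ln |x - y| is positive definite up to a constant, which
    disappears on differences of densities, and a term of order 1 / L. *)
Lemma log_kernel_window L x y : x != y -> `|x - y| < L ->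
  (\int[mu2]_w (window_weight L w.1 * (window w x * window w y))%:E =
   (ln L - 1 + `|x - y| / L - ln `|x - y|)%:E)%E.
Proof.
move=> xy xyL; pose F w := (window_weight L w.1 * (window w x * window w y))%:E.
have mF : measurable_fun [set: R * R] F.
  apply/measurable_EFinP; apply: measurable_funM.
    by apply: (measurableT_comp (measurable_window_weight L)); exact: measurable_fst.
  by apply: measurable_funM; apply: measurable_window_gen.
have F0 w : (0 <= F w)%E by rewrite lee_fin mulr_ge0 ?window_weight_ge0 ?mulr_ge0 ?window_ge0.
have u0 : 0 < `|x - y| by rewrite normr_gt0 subr_eq0.
rewrite -integral_tent ?u0//.
rewrite (_ : (\int[mu2]_w _)%E = \int[mu2]_w F w)%E // fubini_tonelli1//.
apply: eq_integral => r _; rewrite /fubini_F /F/=.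
have [r0|r0] := ltP 0 r; last first.
  rewrite /window_weight ltNge r0 !mul0r integral0_eq// => z _.
  by rewrite !mul0r.
under eq_integral do rewrite EFinM.
rewrite ge0_integralZl_EFin// ?window_weight_ge0//.
- by rewrite integral_window_pair.
- by move=> z _; rewrite lee_fin mulr_ge0 ?window_ge0.
- apply/measurable_EFinP; apply: measurable_funM; apply: measurable_window_gen => //.
Qed.

End TentKernel.

Section Plane.
Context {R : realType}.
Local Notation mu := (@lebesgue_measure R).
Local Notation mu2 := (@lebesgue_measure R \x @lebesgue_measure R)%E.

(** A name for the Lebesgue measure of the plane that carries its sigma-finiteness,
    which Tonelli's theorem on a product of two planes asks for. *)
Definition plane_measure : set (measurableTypeR R * measurableTypeR R) -> \bar R :=
  mu2.

HB.instance Definition _ := Measure.on plane_measure.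

Lemma plane_measure_sigma_finite : sigma_finite setT plane_measure.
Proof.
exists (fun n => `[- n%:R, n%:R] `*` `[- n%:R, n%:R]).
  apply/seteqP; split=> // -[x y] _.
  exists (maxn (Num.truncn `|x|).+1 (Num.truncn `|y|).+1) => //.
  have h (u : R) m : ((Num.truncn `|u|).+1 <= m)%N -> `[- m%:R, m%:R]%classic u.
    move=> um; rewrite /= in_itv/= -ler_norml.
    by rewrite (le_trans (ltW (truncnS_gt _)))// ler_nat.
  by split; apply: h; rewrite ?leq_maxl ?leq_maxr.
move=> n; split; first exact: measurableX.
rewrite /plane_measure product_measure1E//= !lebesgue_measure_itv/=.
by case: ifP => _; rewrite ?mule0 ?ltry// -EFinM ltry.
Qed.

HB.instance Definition _ := Measure_isSigmaFinite.Build _ _ _ plane_measure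
  plane_measure_sigma_finite.

Lemma plane_tonelli (G : (R * R) * (R * R) -> \bar R) : 
  measurable_fun [set: (R * R) * (R * R)] G -> (forall p, (0 <= G p)%E) ->
  (\int[mu2]_z \int[mu2]_w G (z, w) = \int[mu2]_w \int[mu2]_z G (z, w))%E.
Proof.
move=> mG G0; have := @fubini_tonelli _ _ _ _ R plane_measure plane_measure G mG G0.
exact.
Qed.

Lemma plane_tonelli_measurable (G : (R * R) * (R * R) -> \bar R) : 
  measurable_fun [set: (R * R) * (R * R)] G -> (forall p, (0 <= G p)%E) ->
  measurable_fun [set: R * R] (fun z => \int[mu2]_w G (z, w))%E.
Proof.
move=> mG G0; have := @measurable_fun_fubini_tonelli_F _ _ _ _ R plane_measure G mG G0.
exact.
Qed.
End Plane.

Section WindowEnergy.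
Context {R : realType}.
Local Notation mu := (@lebesgue_measure R).
Local Notation mu2 := (@lebesgue_measure R \x @lebesgue_measure R)%E.
Implicit Types (f g : R -> R) (w : R * R) (a L T t u x y r : R).

Definition window_mass f w : R := \int[mu]_x (window w x * f x).

Lemma window_norm_le1 w x : `|window w x| <= 1.
Proof. by rewrite ger0_norm ?window_ge0 ?window_le1. Qed.

Lemma measurable_window w : measurable_fun [set: R] (window w).
Proof. by apply: (measurable_window_gen (W := fun=> w) (X := id)). Qed.

Lemma window_mass_EFin a T f w : density a T f ->
  (\int[mu]_x (window w x * f x)%:E = (window_mass f w)%:E)%E.
Proof.
move=> df; rewrite /window_mass /Rintegral fineK//.
apply: integrable_fin_num => //.
exact: (integrable_bounded_density df (measurable_window w) (window_norm_le1 w)).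
Qed.

Lemma window_mass_ge0 a T f w : density a T f -> 0 <= window_mass f w.
Proof.
by move=> df; apply: Rintegral_ge0 => x _; rewrite mulr_ge0 ?window_ge0 ?(density_ge0 _ df).
Qed.

Lemma measurable_window_mass a T f : density a T f ->
  measurable_fun [set: R * R] (window_mass f).
Proof.
move=> df; apply/measurable_EFinP.
pose F (p : (R * R) * R) := (window p.1 p.2 * f p.2)%:E.
rewrite (_ : EFin \o _ = fubini_F mu F); last first.
  by apply/funext => w; rewrite /= -(window_mass_EFin _ df).
apply: measurable_fun_fubini_tonelli_F.
  apply/measurable_EFinP; apply: measurable_funM.
    by apply: measurable_window_gen; [exact: measurable_fst|exact: measurable_snd].
  by apply: (measurableT_comp (density_measurable df)); exact: measurable_snd.
by move=> p; rewrite lee_fin mulr_ge0 ?window_ge0 ?(density_ge0 _ df).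
Qed.

(** The identity [log_kernel_window] leaves out the diagonal. *)
Lemma negligible_diag : mu2.-negligible [set z : R * R | z.1 = z.2].
Proof.
have mA : measurable [set z : R * R | z.1 = z.2].
  have h : measurable ((fun z : R * R => z.1 == z.2) @^-1` [set true]).
    rewrite -[X in measurable X]setTI.
    exact: (measurable_fun_eqr measurable_fst measurable_snd).
  rewrite (_ : [set z | _] = (fun z : R * R => z.1 == z.2) @^-1` [set true])//.
  by apply/seteqP; split=> z /= /eqP.
exists [set z : R * R | z.1 = z.2]; split => //.
rewrite /= /product_measure1/= integral0_eq// => x _ /=.
rewrite (_ : xsection _ _ = [set x]) ?lebesgue_measure_set1//.
apply/seteqP; split=> y.
  by rewrite /xsection/= inE/= => ->.
by move=> /= ->; rewrite /xsection/= inE.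
Qed.

Definition dist_pair f g : R := \int[mu2]_z (`|z.1 - z.2| * f z.1 * g z.2).

Lemma tensor_sub_eq (k1 k2 : R * R -> R) a T f g :
  density a T f -> density a T g ->
  (forall z, 0 <= z.1 <= T -> 0 <= z.2 <= T -> k1 z = k2 z) ->
  (fun z => k1 z * f z.1 * g z.2) = (fun z => k2 z * f z.1 * g z.2).
Proof.
move=> df dg k12; apply/funext => z.
have [z1|z1] := boolP (0 <= z.1 <= T); last first.
  by case: df => _ _ -> // _; rewrite !mulr0 !mul0r.
have [z2|z2] := boolP (0 <= z.2 <= T); last first.
  by case: dg => _ _ -> // _; rewrite !mulr0.
by rewrite k12.
Qed.

(** On the square [0, T]^2 the distance is bounded by T, which puts it into the scope
    of the lemmas on bounded kernels. *)
Lemma dist_pair_clamp a T f g : density a T f -> density a T g ->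
  (fun z : R * R => `|z.1 - z.2| * f z.1 * g z.2) =
  (fun z => Num.min `|z.1 - z.2| T * f z.1 * g z.2).
Proof.
move=> df dg; apply: (tensor_sub_eq df dg) => z z1 z2.
by rewrite (min_idPl _)// dist_itv_le.
Qed.

Lemma measurable_dist_clamp T :
  measurable_fun [set: R * R] (fun z : R * R => Num.min `|z.1 - z.2| T).
Proof.
apply: measurable_minr => //.
by apply: (@measurable_diff_kernel _ (fun u => `|u|)).
Qed.

Lemma integrable_dist_pair a T f g : 0 <= T -> density a T f -> density a T g ->
  mu2.-integrable [set: R * R]
    (EFin \o (fun z : R * R => `|z.1 - z.2| * f z.1 * g z.2)).
Proof.
move=> T0 df dg; rewrite (dist_pair_clamp df dg).
apply: (integrable_bounded_tensor df dg (measurable_dist_clamp T) (B := T)) => z.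
by rewrite ger0_norm ?ge_min ?lexx ?orbT// le_min normr_ge0.
Qed.

Lemma tensor_int1 a T f g : density a T f -> density a T g ->
  \int[mu2]_z (f z.1 * g z.2) = 1.
Proof.
move=> df dg.
transitivity (\int[mu2]_z ((cst 1 z) * f z.1 * g z.2)).
  by apply: eq_Rintegral => z _; rewrite mul1r.
have c1 : forall z : R * R, `|cst 1 z| <= 1 :> R by move=> z; rewrite /= normr1.
rewrite (Rintegral_tensor df dg (measurable_cst _) c1).
transitivity (\int[mu]_x (1 * f x)); last exact: density_int_cst df.
by apply: eq_Rintegral => x _; rewrite (density_int_cst 1 dg).
Qed.

Lemma dist_pair_itv a T f g : 0 <= T -> density a T f -> density a T g ->
  0 <= dist_pair f g <= T.
Proof.
move=> T0 df dg; apply/andP; split.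
  by apply: Rintegral_ge0 => z _; rewrite !mulr_ge0 ?(density_ge0 _ df) ?(density_ge0 _ dg).
rewrite -[leRHS]mulr1 -(tensor_int1 df dg) -RintegralZl//; last first.
  exact: integrable_tensor df dg.
apply: le_Rintegral => //.
- exact: integrable_dist_pair T0 df dg.
- by have := @integrableZl _ _ _ mu2 [set: R * R] measurableT T _ (integrable_tensor df dg); exact.
- move=> z _; rewrite -mulrA.
  have [z1|z1] := boolP (0 <= z.1 <= T); last first.
    by case: df => _ _ -> // _; rewrite !mul0r !mulr0.
  have [z2|z2] := boolP (0 <= z.2 <= T); last first.
    by case: dg => _ _ -> // _; rewrite !mulr0.
  by rewrite ler_wpM2r ?mulr_ge0 ?(density_ge0 _ df) ?(density_ge0 _ dg) ?dist_itv_le.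
Qed.

(** Integrate [log_kernel_window] against f(x) g(y), and exchange the two
    integrals; for a fixed window the inner one is a product. *)
Lemma window_energyE a L T f g : 0 <= T < L -> density a T f -> density a T g ->
  (\int[mu2]_w (window_weight L w.1 * window_mass f w * window_mass g w)%:E =
   (ln L - 1 + dist_pair f g / L - log_pair f g)%:E)%E.
Proof.
move=> /andP[T0 TL] df dg.
have mf := density_measurable df; have mg := density_measurable dg.
pose G (p : (R * R) * (R * R)) : \bar R :=
  (window_weight L p.2.1 * (window p.2 p.1.1 * window p.2 p.1.2) *
   (f p.1.1 * g p.1.2))%:E.
have m11 : measurable_fun [set: (R * R) * (R * R)] (fun p => p.1.1).
  by apply: (measurableT_comp (@measurable_fst _ _ R R)); exact: measurable_fst.
have m12 : measurable_fun [set: (R * R) * (R * R)] (fun p => p.1.2).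
  by apply: (measurableT_comp (@measurable_snd _ _ R R)); exact: measurable_fst.
have m21 : measurable_fun [set: (R * R) * (R * R)] (fun p => p.2.1).
  by apply: (measurableT_comp (@measurable_fst _ _ R R)); exact: measurable_snd.
have mG : measurable_fun [set: (R * R) * (R * R)] G.
  apply/measurable_EFinP; apply: measurable_funM; first apply: measurable_funM.
  - exact: (measurableT_comp (measurable_window_weight L) m21).
  - by apply: measurable_funM; apply: measurable_window_gen => //; exact: measurable_snd.
  - apply: measurable_funM; first exact: (measurableT_comp mf m11).
    exact: (measurableT_comp mg m12).
have fg0 z : 0 <= f z.1 * g z.2.
  by rewrite mulr_ge0 ?(density_ge0 _ df) ?(density_ge0 _ dg).
have G0 p : (0 <= G p)%E.
  rewrite lee_fin; apply: mulr_ge0 => //; apply: mulr_ge0; first exact: window_weight_ge0.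
  by apply: mulr_ge0; exact: window_ge0.
have Gz w : (\int[mu2]_z G (z, w) =
    (window_weight L w.1 * window_mass f w * window_mass g w)%:E)%E.
  rewrite /G/=.
  transitivity (\int[mu2]_z ((window_weight L w.1)%:E *
    ((window w z.1 * f z.1) * (window w z.2 * g z.2))%:E))%E.
    by apply: eq_integral => z _; rewrite -EFinM; congr EFin; ring.
  have mwf : measurable_fun [set: R] (fun x => window w x * f x).
    by apply: measurable_funM => //; exact: measurable_window.
  have mwg : measurable_fun [set: R] (fun x => window w x * g x).
    by apply: measurable_funM => //; exact: measurable_window.
  have wf0 x : 0 <= window w x * f x by rewrite mulr_ge0 ?window_ge0 ?(density_ge0 _ df).
  have wg0 x : 0 <= window w x * g x by rewrite mulr_ge0 ?window_ge0 ?(density_ge0 _ dg).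
  rewrite ge0_integralZl_EFin ?window_weight_ge0//; last 2 first.
  - by move=> z _; rewrite lee_fin mulr_ge0.
  - by apply/measurable_EFinP; exact: (measurable_tensor mwf mwg).
  rewrite -[in RHS]mulrA [RHS]EFinM; congr (_ * _)%E.
  pose H (z : R * R) := ((window w z.1 * f z.1) * (window w z.2 * g z.2))%:E.
  rewrite (_ : (\int[mu2]_z _)%E = \int[mu2]_z H z)%E // fubini_tonelli1//; last 2 first.
  - by apply/measurable_EFinP; exact: (measurable_tensor mwf mwg).
  - by move=> z; rewrite lee_fin mulr_ge0.
  transitivity (\int[mu]_x ((window_mass g w)%:E * (window w x * f x)%:E))%E.
    apply: eq_integral => x _; rewrite /fubini_F /H/=.
    under eq_integral do rewrite EFinM.
    rewrite ge0_integralZl_EFin//.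
    - by rewrite (window_mass_EFin _ dg) muleC.
    - by move=> y _; rewrite lee_fin.
    - exact/measurable_EFinP.
  rewrite ge0_integralZl_EFin ?(window_mass_ge0 _ dg)//.
  - by rewrite (window_mass_EFin _ df) -EFinM mulrC.
  - by move=> y _; rewrite lee_fin.
  - exact/measurable_EFinP.
transitivity (\int[mu2]_w \int[mu2]_z G (z, w))%E.
  by apply: eq_integral => w _; rewrite Gz.
transitivity (\int[mu2]_z \int[mu2]_w G (z, w))%E.
  by rewrite (plane_tonelli mG G0).
pose k (z : R * R) := ln L - 1 + `|z.1 - z.2| / L - ln `|z.1 - z.2|.
have mk : measurable_fun [set: R * R] k.
  apply: measurable_funB; last exact: measurable_log_kernel.
  apply: measurable_funD => //; apply: measurable_funM => //.
  by apply: (@measurable_diff_kernel _ (fun u => `|u|)).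
transitivity (\int[mu2]_z (k z * f z.1 * g z.2)%:E)%E.
  apply: ae_eq_integral => //.
  - exact: plane_tonelli_measurable mG G0.
  - by apply/measurable_EFinP; exact: measurable_kernel_tensor.
  - apply: negligibleS negligible_diag => z /= H; apply: contrapT => z12.
    apply: H => _.
    have [z1|z1] := boolP (0 <= z.1 <= T); last first.
      have -> : f z.1 = 0 by case: df => _ _ ->.
      rewrite mulr0 mul0r integral0_eq// => w _; rewrite /G/=.
      have -> : f z.1 = 0 by case: df => _ _ ->.
      by rewrite mul0r mulr0.
    have [z2|z2] := boolP (0 <= z.2 <= T); last first.
      have -> : g z.2 = 0 by case: dg => _ _ ->.
      rewrite mulr0 integral0_eq// => w _; rewrite /G/=.
      have -> : g z.2 = 0 by case: dg => _ _ ->.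
      by rewrite !mulr0.
    transitivity (\int[mu2]_w ((f z.1 * g z.2)%:E *
      (window_weight L w.1 * (window w z.1 * window w z.2))%:E))%E.
      by apply: eq_integral => w _; rewrite /G/= -EFinM mulrC.
    rewrite ge0_integralZl_EFin//.
    - rewrite log_kernel_window//; last by apply: le_lt_trans TL; exact: dist_itv_le.
        by rewrite -EFinM -/(k z) -mulrA mulrC.
      exact/eqP.
    - move=> w _; rewrite lee_fin; apply: mulr_ge0; first exact: window_weight_ge0.
      by apply: mulr_ge0; exact: window_ge0.
    - apply/measurable_EFinP; apply: measurable_funM.
        by apply: (measurableT_comp (measurable_window_weight L)); exact: measurable_fst.
      by apply: measurable_funM; apply: measurable_window_gen.
have ilog := integrable_log_pair df dg.
have idist := integrable_dist_pair T0 df dg.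
have i1 := integrable_tensor df dg.
have iZ (c : R) (h : R * R -> R) : mu2.-integrable [set: R * R] (EFin \o h) ->
    mu2.-integrable [set: R * R] (EFin \o (fun z => c * h z)).
  by move=> ih; have := @integrableZl _ _ _ mu2 [set: R * R] measurableT c _ ih; exact.
have kE z : k z * f z.1 * g z.2 = (ln L - 1) * (f z.1 * g z.2) +
    L^-1 * (`|z.1 - z.2| * f z.1 * g z.2) - ln `|z.1 - z.2| * f z.1 * g z.2.
  by rewrite /k; ring.
have iD : mu2.-integrable [set: R * R] (EFin \o (fun z => (ln L - 1) * (f z.1 * g z.2) +
    L^-1 * (`|z.1 - z.2| * f z.1 * g z.2))).
  by have := @integrableD _ _ _ mu2 [set: R * R] measurableT _ _
    (iZ (ln L - 1) _ i1) (iZ L^-1 _ idist); exact.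
have ik : mu2.-integrable [set: R * R] (EFin \o (fun z => k z * f z.1 * g z.2)).
  rewrite (_ : (fun z => _) = (fun z => (ln L - 1) * (f z.1 * g z.2) +
    L^-1 * (`|z.1 - z.2| * f z.1 * g z.2) - ln `|z.1 - z.2| * f z.1 * g z.2)); last first.
    exact/funext.
  by have := @integrableB _ _ _ mu2 [set: R * R] measurableT _ _ iD ilog; exact.
rewrite -[LHS]fineK; last exact: integrable_fin_num ik.
congr EFin; rewrite -/(Rintegral mu2 setT (fun z => k z * f z.1 * g z.2)).
under eq_Rintegral do rewrite kE.
rewrite RintegralB// RintegralD//; last 2 first.
- exact: iZ.
- exact: iZ.
by rewrite !RintegralZl// (tensor_int1 df dg) mulr1 [_ / L]mulrC.
Qed.

End WindowEnergy.

Section LogGap.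
Context {R : realType}.
Local Notation mu := (@lebesgue_measure R).
Local Notation mu2 := (@lebesgue_measure R \x @lebesgue_measure R)%E.
Implicit Types (f g U : R -> R) (w : R * R) (a L T t u x y r theta : R).

Lemma window_mass_out a t g w : density a t g -> t < w.2 -> window_mass g w = 0.
Proof.
move=> dg tw; rewrite /window_mass.
transitivity (\int[mu]_x (0 * g x)); last exact: density_int_cst dg.
apply: eq_Rintegral => x _; have [xt|xt] := boolP (0 <= x <= t).
  rewrite /window (_ : (w.2 <= x)%R = false) ?mul0r//.
  by apply/negbTE; rewrite -ltNge; move: xt => /andP[_ /le_lt_trans]; apply.
by case: dg => _ _ -> //; rewrite !mulr0.
Qed.

Lemma window_mass_in a T f s w : density a T f -> w.2 <= s -> T <= w.2 + w.1 ->
  \int[mu]_(x in `]s, T]) f x <= window_mass f w.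
Proof.
move=> df ws Tw; rewrite /window_mass Rintegral_mkcond.
have idf := integrable_density df.
apply: le_Rintegral => //.
- rewrite -restrict_EFin; apply/integrable_restrict => //; rewrite setTI.
  exact: integrableS idf.
- exact: (integrable_bounded_density df (measurable_window w) (window_norm_le1 w)).
- move=> x _; rewrite patchE; case: ifPn => [/set_mem/=|_].
    rewrite in_itv/= => /andP[sx xT].
    by rewrite /window (le_trans ws (ltW sx)) (le_trans xT Tw) !mul1r.
  by rewrite mulr_ge0 ?window_ge0 ?(density_ge0 _ df).
Qed.

(** The logarithmic energy of the signed density f - g, of total mass 0. *)
Definition log_gap f g : R :=
  - (log_pair f f - log_pair f g - log_pair g f + log_pair g g).

(** In the window representation of the energy of f - g the constant ln L - 1
    cancels, the distance terms are O(1/L), and what remains is the weighted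
    integral of the square of the mass of f - g in a window.  The windows with
    t < z <= s and T <= r <= 2 T contain ]s, T] and miss [0, t]: there [f] has at
    least its mass beyond s, while [g] has none. *)
Lemma log_gap_ge a t s T f g L : 0 <= t -> t < s -> s <= T -> 2 * T < L ->
  density a T f -> density a t g ->
  (s - t) * T * ((2 * T) `^ (- 2) * (\int[mu]_(x in `]s, T]) f x) ^+ 2) -
    2 * T / L <= log_gap f g.
Proof.
move=> t0 ts sT TL df dg0; have tT : t < T by exact: lt_le_trans sT.
have T0 : 0 < T by exact: le_lt_trans tT.
have dg : density a T g by apply: density_sub dg0; exact: ltW.
have TL' : 0 <= T < L by rewrite ltW//=; lra.
have L0 : 0 < L by lra.
set m := \int[mu]_(x in _) _; set k := _ `^ (- 2) * m ^+ 2.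
have m0 : 0 <= m by apply: Rintegral_ge0 => x _; exact: density_ge0 df.
have k0 : 0 <= k by rewrite mulr_ge0 ?powR_ge0 ?sqr_ge0.
pose W h1 h2 w := window_weight L w.1 * window_mass h1 w * window_mass h2 w.
have mW h1 h2 : density a T h1 -> density a T h2 ->
    measurable_fun [set: R * R] (W h1 h2).
  move=> d1 d2; apply: measurable_funM; first apply: measurable_funM.
  - by apply: (measurableT_comp (measurable_window_weight L)); exact: measurable_fst.
  - exact: measurable_window_mass d1.
  - exact: measurable_window_mass d2.
have W0 h1 h2 w : density a T h1 -> density a T h2 -> 0 <= W h1 h2 w.
  move=> d1 d2; apply: mulr_ge0; last exact: window_mass_ge0 d2.
  by apply: mulr_ge0; [exact: window_weight_ge0|exact: window_mass_ge0 d1].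
have iW h1 h2 : density a T h1 -> density a T h2 ->
    mu2.-integrable [set: R * R] (EFin \o W h1 h2).
  move=> d1 d2; apply/integrableP; split; first by apply/measurable_EFinP; exact: mW.
  under eq_integral do rewrite /= ger0_norm ?W0//.
  by rewrite (window_energyE TL' d1 d2) ltry.
have WE h1 h2 : density a T h1 -> density a T h2 ->
    \int[mu2]_w W h1 h2 w = ln L - 1 + dist_pair h1 h2 / L - log_pair h1 h2.
  by move=> d1 d2; rewrite /Rintegral (window_energyE TL' d1 d2).
have iB h1 h2 : mu2.-integrable [set: R * R] (EFin \o h1) ->
    mu2.-integrable [set: R * R] (EFin \o h2) ->
    mu2.-integrable [set: R * R] (EFin \o (fun w => h1 w - h2 w)).
  by move=> i1 i2; have := @integrableB _ _ _ mu2 [set: R * R] measurableT _ _ i1 i2; exact.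
have iD h1 h2 : mu2.-integrable [set: R * R] (EFin \o h1) ->
    mu2.-integrable [set: R * R] (EFin \o h2) ->
    mu2.-integrable [set: R * R] (EFin \o (fun w => h1 w + h2 w)).
  by move=> i1 i2; have := @integrableD _ _ _ mu2 [set: R * R] measurableT _ _ i1 i2; exact.
pose X w := W f f w - W f g w - W g f w + W g g w.
have i1 : mu2.-integrable [set: R * R] (EFin \o (fun w => W f f w - W f g w)).
  by apply: iB; exact: iW.
have i2 : mu2.-integrable [set: R * R] (EFin \o (fun w => W f f w - W f g w - W g f w)).
  by apply: iB => //; exact: iW.
have iX : mu2.-integrable [set: R * R] (EFin \o X) by apply: iD => //; exact: iW.
have XE : \int[mu2]_w X w = log_gap f g +
    (dist_pair f f - dist_pair f g - dist_pair g f + dist_pair g g) / L.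
  rewrite /X RintegralD//; last exact: iW.
  rewrite RintegralB//; last exact: iW.
  rewrite RintegralB//; [|exact: iW..].
  by rewrite !WE// /log_gap; ring.
have Xsq w : X w = window_weight L w.1 * (window_mass f w - window_mass g w) ^+ 2.
  by rewrite /X /W; ring.
have X0 w : 0 <= X w by rewrite Xsq mulr_ge0 ?window_weight_ge0 ?sqr_ge0.
have lower : (s - t) * T * k <= \int[mu2]_w X w.
  rewrite -lee_fin [leRHS]fineK; last exact: integrable_fin_num iX.
  pose A := `[T, 2 * T] `*` `]t, s].
  have mA : measurable A by exact: measurableX.
  apply: (@le_trans _ _ (\int[mu2]_w (k%:E * (\1_A w)%:E))%E).
    rewrite ge0_integralZl_EFin//; last first.
      by apply/measurable_EFinP; exact: measurable_indic.
    rewrite integral_indic// setIT /A.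
    rewrite [X in (_ <= _ * X)%E](_ : _ = ((T * (s - t))%:E)).
      by rewrite -EFinM lee_fin le_eqVlt; apply/orP; left; apply/eqP; ring.
    transitivity (mu `[T, (2 * T)%R]%classic * mu `]t, s]%classic)%E; first exact: product_measure1E.
    rewrite /= !lebesgue_measure_itv/= !lte_fin ts.
    have -> : T < 2 * T by lra.
    by rewrite -!EFinB -EFinM; congr EFin; ring.
  apply: ge0_le_integral => //.
  - by move=> w _; rewrite mule_ge0 ?lee_fin.
  - apply: measurable_funeM; apply/measurable_EFinP; exact: measurable_indic.
  - by case/integrableP : iX.
  - move=> w _; rewrite -EFinM lee_fin indicE.
    have [wA|wA] := boolP (w \in A); last by rewrite mulr0.
    rewrite mulr1 Xsq; move: wA => /set_mem[/=]; rewrite !in_itv/=.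
    move=> /andP[Tw wT] /andP[tw ws].
    rewrite (window_mass_out dg0 tw) subr0.
    apply: ler_pM => //; rewrite ?powR_ge0 ?sqr_ge0//.
      rewrite /window_weight (lt_le_trans T0 Tw) (le_trans wT (ltW TL)) !mul1r.
      rewrite !powRN lef_pV2 ?posrE ?powR_gt0//; last 2 first.
      - by rewrite mulr_gt0.
      - exact: lt_le_trans Tw.
      apply: ge0_ler_powR => //; rewrite nnegrE; first exact: le_trans (ltW T0) Tw.
      by rewrite mulr_ge0// ltW.
    rewrite ler_pXn2r ?nnegrE// ?(window_mass_ge0 _ df)//.
    by apply: (window_mass_in df ws); lra.
have /andP[d1 d1'] := dist_pair_itv (ltW T0) df df.
have /andP[d2 d2'] := dist_pair_itv (ltW T0) df dg.
have /andP[d3 d3'] := dist_pair_itv (ltW T0) dg df.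
have /andP[d4 d4'] := dist_pair_itv (ltW T0) dg dg.
have : (dist_pair f f - dist_pair f g - dist_pair g f + dist_pair g g) / L <= 2 * T / L.
  rewrite ler_pM2r ?invr_gt0//.
  by move: d1 d1' d2 d2' d3 d3' d4 d4' {lower XE}; clear; lra.
by move: lower; rewrite XE; clear; lra.
Qed.

Lemma log_gap_gt0 a t s T f : 0 <= t -> t < s -> s <= T ->
  density a T f -> 0 < \int[mu]_(x in `]s, T]) f x ->
  exists2 c : R, 0 < c & forall g, density a t g -> c <= log_gap f g.
Proof.
move=> t0 ts sT df m0; have T0 : 0 < T by apply: lt_le_trans sT; exact: le_lt_trans ts.
pose c := (s - t) * T * ((2 * T) `^ (- 2) * (\int[mu]_(x in `]s, T]) f x) ^+ 2).
have c0 : 0 < c.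
  by rewrite !mulr_gt0 ?subr_gt0 ?powR_gt0 ?mulr_gt0 ?exprn_gt0.
(* The distance terms 2 T / L are at most c / 2 for this L. *)
pose L := 4 * T / c + 2 * T + 1.
have Tc0 : 0 < 4 * T / c by apply: divr_gt0 => //; apply: mulr_gt0.
have TL : 2 * T < L by rewrite /L; lra.
have L0 : 0 < L by lra.
exists (c / 2); first by rewrite divr_gt0.
move=> g dg; have := log_gap_ge t0 ts sT TL df dg; rewrite -/c.
suff : 2 * T / L <= c / 2 by lra.
rewrite ler_pdivrMr//.
have : c * (4 * T / c) <= c * L by rewrite ler_pM2l// /L; lra.
have -> : c * (4 * T / c) = 4 * T by field; rewrite gt_eqF.
lra.
Qed.

Lemma log_pairD a T f1 f2 g : density a T f1 -> density a T f2 -> density a T g ->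
  log_pair (fun x => (f1 x + f2 x) / 2) g = (log_pair f1 g + log_pair f2 g) / 2.
Proof.
move=> d1 d2 dg; rewrite /log_pair -RintegralD//;
  [|exact: (integrable_log_pair d1 dg)|exact: (integrable_log_pair d2 dg)].
rewrite -RintegralZr//; first by apply: eq_Rintegral => z _; field.
have := @integrableD _ _ _ mu2 [set: R * R] measurableT _ _
  (integrable_log_pair d1 dg) (integrable_log_pair d2 dg); exact.
Qed.

Lemma log_pairDr a T f1 f2 g : density a T f1 -> density a T f2 -> density a T g ->
  log_pair g (fun x => (f1 x + f2 x) / 2) = (log_pair g f1 + log_pair g f2) / 2.
Proof.
move=> d1 d2 dg; rewrite /log_pair -RintegralD//;
  [|exact: (integrable_log_pair dg d1)|exact: (integrable_log_pair dg d2)].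
rewrite -RintegralZr//; first by apply: eq_Rintegral => z _; field.
have := @integrableD _ _ _ mu2 [set: R * R] measurableT _ _
  (integrable_log_pair dg d1) (integrable_log_pair dg d2); exact.
Qed.

Lemma density_mid a T f g : density a T f -> density a T g ->
  density a T (fun x => (f x + g x) / 2).
Proof.
move=> df dg; have if0 := integrable_density df; have ig0 := integrable_density dg.
split.
- apply: measurable_funM => //; apply: measurable_funD.
    exact: density_measurable df.
  exact: density_measurable dg.
- move=> x; have f0 := density_ge0 x df; have g0 := density_ge0 x dg.
  have fa := density_le x df; have ga := density_le x dg.
  by apply/andP; split; lra.
- move=> x xT; have -> : f x = 0 by case: df => _ _ ->.
  have -> : g x = 0 by case: dg => _ _ ->.
  by rewrite addr0 mul0r.
- rewrite RintegralZr//; last first.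
    by have := @integrableD _ _ _ mu [set: R] measurableT _ _ if0 ig0; exact.
  rewrite RintegralD//; case: df => _ _ _ ->; case: dg => _ _ _ ->.
  by field.
Qed.

(** The midpoint h = (f + g) / 2 has the mean energy of [f] and [g] less
    theta / 4 times [log_gap f g], and this cannot be below the energy of [f]. *)
Lemma minimizer_gap theta t s T B U f : 0 < theta -> 0 <= t -> t < s -> s <= T ->
  measurable_fun [set: R] U -> (forall x, `|U x| <= B) ->
  density theta^-1 T f -> 0 < \int[mu]_(x in `]s, T]) f x ->
  (forall h, density theta^-1 T h -> density_energy theta U f <= density_energy theta U h) ->
  exists2 c : R, 0 < c & forall g, density theta^-1 t g ->
    density_energy theta U f + c <= density_energy theta U g.
Proof.
move=> theta0 t0 ts sT mU UB df m0 fmin.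
have [c c0 hc] := log_gap_gt0 t0 ts sT df m0.
exists (theta * c / 2); first by rewrite divr_gt0// mulr_gt0.
move=> g dg0; have gap := hc g dg0.
have dg : density theta^-1 T g.
  by apply: density_sub dg0; apply: ltW; exact: lt_le_trans sT.
have dh := density_mid df dg.
have := fmin _ dh; rewrite /density_energy.
rewrite (log_pairD df dg dh) (log_pairDr df dg df) (log_pairDr df dg dg).
have -> : \int[mu]_x (U x * ((f x + g x) / 2)) =
    (\int[mu]_x (U x * f x) + \int[mu]_x (U x * g x)) / 2.
  have i1 := integrable_bounded_density df mU UB.
  have i2 := integrable_bounded_density dg mU UB.
  rewrite -RintegralD// -RintegralZr//; first by apply: eq_Rintegral => x _; field.
  by have := @integrableD _ _ _ mu [set: R] measurableT _ _ i1 i2; exact.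
move: gap; rewrite /log_gap -(ler_pM2l theta0).
set ff := log_pair f f; set fg := log_pair f g; set gf := log_pair g f.
set gg := log_pair g g; set uf := Rintegral _ _ _; set ug := Rintegral _ _ _.
nra.
Qed.

End LogGap.

(** * Gibbs weights and discrete energies *)

Section PairSums.
Context {R : realType}.

Lemma ln_prod (I : Type) (r : seq I) (P : pred I) (F : I -> R) :
  (forall i, P i -> 0 < F i) ->
  ln (\prod_(i <- r | P i) F i) = \sum_(i <- r | P i) ln (F i).
Proof.
move=> F0; rewrite -[RHS]expRK expR_sum; congr ln.
by apply: eq_bigr => i Pi; rewrite lnK// posrE F0.
Qed.

Lemma sum_pairs_sym (N : nat) (g : 'I_N -> 'I_N -> R) :
  (forall i j, g i j = g j i) ->
  \sum_(i < N) \sum_(j < N) g i j =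
  \sum_(i < N) g i i + 2 * \sum_(i < N) \sum_(j < N | (i < j)%N) g i j.
Proof.
move=> gC.
have sw : \sum_(i < N) \sum_(j < N | (j < i)%N) g i j =
    \sum_(i < N) \sum_(j < N | (i < j)%N) g i j.
  rewrite (exchange_big_dep xpredT)//=; apply: eq_bigr => i _.
  by apply: eq_bigr => j _; exact: gC.
rewrite mulr_natl mulr2n -{2}sw addrA -!big_split/=; apply: eq_bigr => i _.
rewrite (bigD1 i)//= -addrA; congr (_ + _).
rewrite (bigID (fun j : 'I_N => (i < j)%N))/=; congr (_ + _).
  by apply: eq_bigl => j; have [->|] := eqVneq j i; rewrite ?ltnn.
apply: eq_bigl => j; rewrite -leqNgt leq_eqVlt.
by have [->|ji] := eqVneq j i; rewrite ?ltnn//= (negbTE (_ : nat_of_ord j != i)).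
Qed.

Lemma sum_pairs_cst (N : nat) (c : R) :
  \sum_(i < N) \sum_(j < N | (i < j)%N) c = c * N%:R * (N%:R - 1) / 2.
Proof.
have := @sum_pairs_sym N (fun _ _ => c) (fun _ _ => erefl).
rewrite !sumr_const card_ord => H.
set s := \sum_(i < N) _ in H *.
have -> : s = (c *+ N *+ N - c *+ N) / 2 by rewrite H; field.
by rewrite -(mulr_natr (c *+ N) N) -(mulr_natr c N); field.
Qed.

Lemma sqrt_step (k : nat) :
  2 * Num.sqrt k%:R + (Num.sqrt k.+1%:R)^-1 <= 2 * Num.sqrt k.+1%:R :> R.
Proof.
set a := Num.sqrt k%:R; set b := Num.sqrt k.+1%:R.
have b0 : 0 < b by rewrite sqrtr_gt0 ltr0n.
have a0 : 0 <= a by exact: sqrtr_ge0.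
have a2 : a ^+ 2 = k%:R by rewrite sqr_sqrtr ?ler0n.
have b2 : b ^+ 2 = k%:R + 1 by rewrite sqr_sqrtr ?ler0n// natr1.
rewrite -(ler_pM2r b0) mulrDl mulVf ?gt_eqF//.
have := sqr_ge0 (b - a); nra.
Qed.

(** The sum telescopes, for 1 / sqrt (k + 1) <= 2 (sqrt (k + 1) - sqrt k). *)
Lemma sum_inv_sqrt (n i : nat) :
  \sum_(j < n | (i < j)%N) (Num.sqrt (j - i)%:R)^-1 <=
  2 * Num.sqrt (n.-1 - i)%:R :> R.
Proof.
elim: n => [|n IH]; first by rewrite big_ord0 mulr_ge0 ?sqrtr_ge0.
rewrite big_mkcond big_ord_recr -big_mkcond/=.
have [ni|ni] := leqP n i.
  rewrite addr0; apply: (le_trans IH); rewrite ler_pM2l//.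
  by rewrite ler_sqrt ?ler0n// ler_nat leq_sub2r// leq_pred.
apply: (le_trans (lerD IH (lexx _))).
have -> : (n - i = (n.-1 - i).+1)%N by case: (n) ni => // k ik; rewrite /= subSn.
exact: sqrt_step.
Qed.

Lemma sum_pairs_inv_sqrt (N : nat) :
  \sum_(i < N) \sum_(j < N | (i < j)%N) (Num.sqrt (j - i)%:R)^-1 <=
  2 * N%:R * Num.sqrt N%:R :> R.
Proof.
apply: (@le_trans _ _ (\sum_(i < N) 2 * Num.sqrt N%:R)).
  apply: ler_sum => i _; apply: (le_trans (sum_inv_sqrt _ _)).
  rewrite ler_pM2l// ler_sqrt ?ler0n// ler_nat.
  by rewrite (leq_trans (leq_subr _ _))// leq_pred.
by rewrite sumr_const card_ord -(mulr_natr (2 * _) N) mulrAC.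
Qed.

Lemma ln_le_sqrt (x : R) : 0 < x -> ln x <= 2 * Num.sqrt x.
Proof.
move=> x0; have s0 : 0 < Num.sqrt x by rewrite sqrtr_gt0.
have -> : ln x = 2 * ln (Num.sqrt x).
  by rewrite -[in LHS](sqr_sqrtr (ltW x0)) lnXn// mulr_natl.
by rewrite ler_pM2l//; apply/ltW/ln_sublinear.
Qed.

End PairSums.

Section Weights.
Context {R : realType}.
Implicit Types (d S u theta : R) (N M : nat).

Lemma tlogN d S u : tlog d S (- u) = tlog d S u.
Proof. by rewrite /tlog normrN. Qed.

Lemma tlog0 d S : 0 < d <= S -> tlog d S 0 = ln d.
Proof.
move=> /andP[d0 dS]; have S0 : 0 < S by exact: lt_le_trans dS.
by rewrite /tlog normr0 (min_idPl (ltW S0)) (max_idPl (ltW d0)).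
Qed.

Lemma ln_le_tlog d S u : 0 < u <= S -> ln u <= tlog d S u.
Proof.
move=> /andP[u0 uS]; rewrite /tlog (gtr0_norm u0) (min_idPl uS).
by rewrite ler_ln ?posrE ?lt_max ?u0 ?orbT// le_max lexx orbT.
Qed.

(** For u < d the truncation raises ln u to ln d, and ln (d / u) is at most
    2 sqrt (d / u).  The square root keeps the sum of this cost over all pairs of
    particles of order N^2 sqrt d. *)
Lemma tlog_le_ln d S u : 0 < d -> 0 < u <= S ->
  tlog d S u - 2 * Num.sqrt (d / u) <= ln u.
Proof.
move=> d0 /andP[u0 uS]; have s0 := sqrtr_ge0 (d / u).
have [du|ud] := leP d u; first by rewrite tlogE gtr0_norm ?du//; lra.
rewrite /tlog (gtr0_norm u0) (min_idPl uS) (max_idPl (ltW ud)).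
have := ln_le_sqrt (divr_gt0 d0 u0); rewrite ln_div ?posrE//; lra.
Qed.

Lemma configurationsP N M (lambda : {ffun 'I_N -> 'I_M.+1}) :
  lambda \in configurations N M ->
  forall i j : 'I_N, (i <= j)%N -> (lambda j <= lambda i)%N.
Proof. by rewrite inE => /forallP H i j; have /forallP/(_ j)/implyP := H i. Qed.

Lemma particle_gap theta N M (lambda : {ffun 'I_N -> 'I_M.+1}) (i j : 'I_N) :
  lambda \in configurations N M -> (i <= j)%N ->
  (j - i)%:R * theta <= particle theta lambda i - particle theta lambda j.
Proof.
move=> lc ij; rewrite /particle.
have h := configurationsP lc ij.
have -> : (N - i.+1)%:R = (N - j.+1)%:R + (j - i)%:R :> R.
  rewrite -natrD; congr (_%:R).
  by have := ltn_ord j; lia.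
have : (lambda j)%:R <= (lambda i)%:R :> R by rewrite ler_nat.
by rewrite mulrDl; lra.
Qed.

Lemma particle_ge0 theta N M (lambda : {ffun 'I_N -> 'I_M.+1}) (i : 'I_N) :
  0 <= theta -> 0 <= particle theta lambda i.
Proof. by move=> t0; rewrite addr_ge0// mulr_ge0. Qed.

Section Weight.
Variables (theta : R) (N M : nat) (lambda : {ffun 'I_N -> 'I_M.+1}).
Hypothesis theta0 : 0 < theta.
Hypothesis lc : lambda \in configurations N M.
Local Notation l := (particle theta lambda).

Lemma particle_gap_theta (i j : 'I_N) : (i < j)%N -> theta <= l i - l j.
Proof.
move=> ij; apply: le_trans (particle_gap theta lc (ltnW ij)).
by rewrite ler_peMl ?(ltW theta0)// ler1n subn_gt0.
Qed.

Lemma gibbs_weight_gt0 VN : 0 < gibbs_weight theta VN lambda.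
Proof.
apply: mulr_gt0; last by apply: prodr_gt0 => i _; exact: expR_gt0.
apply: prodr_gt0 => i _; apply: prodr_gt0 => j ij.
by apply: interaction_gt0 => //; exact: particle_gap_theta.
Qed.

Lemma ln_gibbs_weight VN : ln (gibbs_weight theta VN lambda) =
  \sum_(i < N) \sum_(j < N | (i < j)%N) ln (interaction theta (l i - l j)) -
  N%:R * \sum_(i < N) VN (l i / N%:R).
Proof.
have p0 (i j : 'I_N) : (i < j)%N -> 0 < interaction theta (l i - l j).
  by move=> ij; apply: interaction_gt0 => //; exact: particle_gap_theta.
rewrite /gibbs_weight lnM ?posrE; last 2 first.
- by apply: prodr_gt0 => i _; apply: prodr_gt0 => j; exact: p0.
- by apply: prodr_gt0 => i _; exact: expR_gt0.
congr (_ + _).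
  rewrite ln_prod; last by move=> i _; apply: prodr_gt0 => j; exact: p0.
  by apply: eq_bigr => i _; rewrite ln_prod//; exact: p0.
rewrite ln_prod; last by move=> i _; exact: expR_gt0.
rewrite -mulNr mulr_sumr; apply: eq_bigr => i _.
by rewrite expRK.
Qed.

End Weight.

(** The energy of the empirical measure of the points, diagonal included: with the
    truncated logarithm the diagonal adds only - theta ln d / N. *)
Definition discrete_energy theta d S (U : R -> R) N (y : 'I_N -> R) : R :=
  - theta * ((N%:R ^+ 2)^-1 * \sum_(i < N) \sum_(j < N) tlog d S (y i - y j)) +
  N%:R^-1 * \sum_(i < N) U (y i).

(** Each pair contributes 2 theta (ln N + ln (y_i - y_j)) up to C / (l_i - l_j).
    As l_i - l_j >= (j - i) theta, these errors add up to O(N^(3/2)).  Replacing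
    the logarithm by the truncated one only increases the sum, hence is free in
    the upper bound; in the lower bound it costs sqrt (d / (y_i - y_j)), at most
    sqrt (d N / ((j - i) theta)), for each pair, in total O(N^2 sqrt d). *)
Lemma ln_gibbs_weight_bounds theta : 0 < theta -> exists2 C : R, 0 <= C &
  forall N M (lambda : {ffun 'I_N -> 'I_M.+1}) (VN U : R -> R) d S P,
  (0 < N)%N -> lambda \in configurations N M -> 0 < d <= S ->
  (forall i, particle theta lambda i / N%:R <= S) ->
  (forall i, `|VN (particle theta lambda i / N%:R) -
               U (particle theta lambda i / N%:R)| <= P) ->
  - discrete_energy theta d S U (fun i => particle theta lambda i / N%:R) -
    ((C + theta * `|ln d|) / Num.sqrt N%:R + P) -
    8 * theta * Num.sqrt (d / theta) <=
    (N%:R ^+ 2)^-1 * ln (gibbs_weight theta VN lambda) - theta * ln N%:R <=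
  - discrete_energy theta d S U (fun i => particle theta lambda i / N%:R) +
    ((C + theta * `|ln d|) / Num.sqrt N%:R + P).
Proof.
move=> theta0; have [C0 C00 HC] := ln_interaction_bound theta0.
exists (2 * (C0 / theta) + 2 * theta).
  by rewrite addr_ge0// mulr_ge0// ?divr_ge0// ltW.
move=> N M lambda VN U d S P N0 lc dS lS VU.
set H := discrete_energy _ _ _ _ _; set E := (_ / Num.sqrt _ + P).
have /andP[d0 _] := dS.
set l := particle theta lambda in lS VU H *.
pose y i := l i / N%:R.
pose n : R := N%:R; have n0 : 0 < n by rewrite ltr0n.
have n1 : 1 <= n by rewrite ler1n.
pose s := Num.sqrt n; have s0 : 0 < s by rewrite sqrtr_gt0.
have s2 : s * s = n by rewrite -expr2 sqr_sqrtr// ltW.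
have s1 : 1 <= s by rewrite -[leLHS](sqrtr1 R) ler_sqrt.
(* A common bound, up to constants, for the error and the truncation cost of a pair. *)
pose h (i j : 'I_N) : R := (Num.sqrt (j - i)%:R)^-1.
pose D := \sum_(i < N) \sum_(j < N | (i < j)%N) tlog d S (y i - y j).
pose X := \sum_(i < N) \sum_(j < N | (i < j)%N) h i j.
have X0 : X <= 2 * n * s by exact: sum_pairs_inv_sqrt.
have ge0X : 0 <= X.
  by apply: sumr_ge0 => i _; apply: sumr_ge0 => j _; rewrite invr_ge0 sqrtr_ge0.
have SD : \sum_(i < N) \sum_(j < N) tlog d S (y i - y j) = n * ln d + 2 * D.
  rewrite sum_pairs_sym; last by move=> i j; rewrite -opprB tlogN.
  congr (_ + _); under eq_bigr do rewrite subrr tlog0//.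
  by rewrite sumr_const card_ord -(mulr_natl (ln d) N).
pose A := \sum_(i < N) \sum_(j < N | (i < j)%N) ln (interaction theta (l i - l j)).
have pair (i j : 'I_N) : (i < j)%N ->
  2 * theta * ln n + 2 * theta * tlog d S (y i - y j) - (C0 / theta) * h i j -
    4 * theta * Num.sqrt (d * n / theta) * h i j <=
  ln (interaction theta (l i - l j)) <=
  2 * theta * ln n + 2 * theta * tlog d S (y i - y j) + (C0 / theta) * h i j.
  move=> ij; have gap := particle_gap theta lc (ltnW ij); rewrite -/l in gap.
  have k1 : (1 : R) <= (j - i)%:R by rewrite ler1n subn_gt0.
  set k : R := (j - i)%:R in gap k1.
  have k0 : 0 < k by exact: lt_le_trans k1.
  have sk1 : 1 <= Num.sqrt k by rewrite -[leLHS](sqrtr1 R) ler_sqrt.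
  have sk0 : 0 < Num.sqrt k by exact: lt_le_trans sk1.
  have skk : Num.sqrt k <= k.
    by rewrite -[leRHS](sqr_sqrtr (ltW k0)) expr2 ler_peMl// ltW.
  have kt0 : 0 < k * theta by rewrite mulr_gt0.
  have g0 : 0 < l i - l j by exact: lt_le_trans gap.
  have tg : theta <= l i - l j by exact: particle_gap_theta.
  have uE : y i - y j = (l i - l j) / n by rewrite /y -mulrBl.
  have u0 : 0 < y i - y j by rewrite uE divr_gt0.
  have uS : 0 < y i - y j <= S.
    rewrite u0 (le_trans _ (lS i))//= gerBl; apply: divr_ge0; last exact: ltW.
    by apply: particle_ge0; exact: ltW.
  have lnE : ln (l i - l j) = ln n + ln (y i - y j).
    by rewrite uE ln_div ?posrE//; ring.
  have hk : h i j = (Num.sqrt k)^-1 by [].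
  have err : C0 / (l i - l j) <= (C0 / theta) * h i j.
    rewrite hk -mulrA ler_wpM2l// -invfM lef_pV2 ?posrE// ?mulr_gt0//.
    by apply: le_trans gap; rewrite mulrC ler_pM2r.
  have := HC _ tg; rewrite lnE ler_norml => /andP[q1 q2].
  have t1 := ln_le_tlog d uS.
  have t2 := tlog_le_ln d0 uS.
  have t3 : Num.sqrt (d / (y i - y j)) <= Num.sqrt (d * n / theta) * h i j.
    have dnt0 : 0 <= d * n / theta by apply: ltW; rewrite divr_gt0// mulr_gt0.
    rewrite hk -(sqrtrV (ltW k0)) -(sqrtrM _ dnt0) ler_sqrt; last first.
      by rewrite mulr_ge0// invr_ge0 ltW.
    rewrite uE invf_div -!mulrA ler_pM2l// ler_pM2l// -invfM lef_pV2 ?posrE//.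
      by rewrite mulrC.
    by rewrite mulr_gt0.
  have t1' : 2 * theta * ln (y i - y j) <= 2 * theta * tlog d S (y i - y j).
    by rewrite ler_pM2l// mulr_gt0.
  have t2' : 2 * theta * (tlog d S (y i - y j) - 2 * Num.sqrt (d / (y i - y j))) <=
      2 * theta * ln (y i - y j).
    by rewrite ler_pM2l// mulr_gt0.
  have t3' : 4 * theta * Num.sqrt (d / (y i - y j)) <=
      4 * theta * (Num.sqrt (d * n / theta) * h i j).
    by rewrite ler_pM2l// mulr_gt0.
  move: q1 q2 err t1' t2' t3'; rewrite mulrDr.
  move: (ln (interaction _ _)) (ln (y i - y j)) (tlog _ _ _) (ln n) (h i j) (Num.sqrt _)
    (Num.sqrt _) => a b c e f g1 g2.
  clear; move: (C0 / _) (C0 / _) => c1 c2 *; apply/andP; split; lra.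
have sumS (F1 F2 : 'I_N -> 'I_N -> R) : (forall i j : 'I_N, (i < j)%N -> F1 i j <= F2 i j) ->
    \sum_(i < N) \sum_(j < N | (i < j)%N) F1 i j <=
    \sum_(i < N) \sum_(j < N | (i < j)%N) F2 i j.
  by move=> F12; apply: ler_sum => i _; apply: ler_sum => j ij; exact: F12.
have sumE (c1 c2 c3 : R) : \sum_(i < N) \sum_(j < N | (i < j)%N)
    (c1 + c2 * tlog d S (y i - y j) + c3 * h i j) =
    c1 * n * (n - 1) / 2 + c2 * D + c3 * X.
  rewrite -sum_pairs_cst /D /X !mulr_sumr -!big_split/=; apply: eq_bigr => i _.
  by rewrite !mulr_sumr -!big_split.
have Aup : A <= 2 * theta * ln n * n * (n - 1) / 2 + 2 * theta * D + C0 / theta * X.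
  by rewrite -sumE; apply: sumS => i j /pair/andP[].
have Alow : 2 * theta * ln n * n * (n - 1) / 2 + 2 * theta * D +
    (- (C0 / theta) - 4 * theta * Num.sqrt (d * n / theta)) * X <= A.
  rewrite -sumE; apply: sumS => i j /pair/andP[+ _]; apply: le_trans.
  by rewrite le_eqVlt; apply/orP; left; apply/eqP; ring.
have sq : Num.sqrt (d * n / theta) = Num.sqrt (d / theta) * s.
  by rewrite mulrAC sqrtrM// ltW// divr_gt0.
rewrite (ln_gibbs_weight theta0 lc) -/l -/A.
pose W := \sum_(i < N) VN (y i); pose W' := \sum_(i < N) U (y i).
have P0 : 0 <= P.
  have := VU (Ordinal N0); apply: le_trans; exact: normr_ge0.
have WW : `|W - W'| <= n * P.
  rewrite /W /W' -sumrB (le_trans (ler_norm_sum _ _ _))//.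
  apply: (@le_trans _ _ (\sum_(i < N) P)); first by apply: ler_sum => i _; exact: VU.
  by rewrite sumr_const card_ord -(mulr_natl P N).
have HE : H = - theta * ((n ^+ 2)^-1 * (n * ln d + 2 * D)) + n^-1 * W'.
  by rewrite /H /discrete_energy SD.
rewrite -/W HE /E -/n -/s.
have lns : ln n <= 2 * s by exact: ln_le_sqrt.
have lnn0 : 0 <= ln n by exact: ln_ge0.
have ld : - `|ln d| <= ln d <= `|ln d| by rewrite -ler_norml.
move: WW; rewrite ler_norml => /andP[w1 w2].
have n20 : 0 < n ^+ 2 by rewrite exprn_gt0.
have nsE x : x / s = (n ^+ 2)^-1 * (n * s * x).
  by rewrite -s2; field; rewrite gt_eqF.
have HE' : - (- theta * ((n ^+ 2)^-1 * (n * ln d + 2 * D)) + n^-1 * W') =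
    (n ^+ 2)^-1 * (theta * (n * ln d + 2 * D) - n * W').
  by field; rewrite gt_eqF.
have cn x : x = (n ^+ 2)^-1 * (n ^+ 2 * x) by rewrite mulKf// gt_eqF.
rewrite HE' nsE (cn P) (cn (theta * ln n)) (cn (8 * theta * _)).
rewrite -!mulrBr -!mulrDr -!mulrBr !ler_pM2l ?invr_gt0//.
set q := Num.sqrt (d / theta) in sq *.
rewrite sq in Alow.
have q0 : 0 <= q by exact: sqrtr_ge0.
set c := C0 / theta in Aup Alow *.
have c0 : 0 <= c by rewrite divr_ge0// ltW.
have cX : c * X <= c * (2 * n * s) by rewrite ler_wpM2l.
have qX : 4 * theta * (q * s) * X <= 8 * theta * q * n ^+ 2.
  have -> : 8 * theta * q * n ^+ 2 = 4 * theta * (q * s) * (2 * n * s).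
    by rewrite expr2 -{2}s2; ring.
  by rewrite ler_wpM2l// !mulr_ge0// ltW.
have tn0 : 0 <= theta * n by rewrite mulr_ge0 ?ltW.
have lt1 : theta * n * ln n <= theta * n * (2 * s) by rewrite ler_wpM2l.
have lt0 : 0 <= theta * n * ln n by rewrite mulr_ge0.
have /andP[ld1 ld2] := ld.
have lt3 : theta * n * (- ln d) <= theta * n * (s * `|ln d|).
  rewrite ler_wpM2l// (le_trans _ (ler_peMl (normr_ge0 _) s1))//; lra.
have lt4 : theta * n * ln d <= theta * n * (s * `|ln d|).
  by rewrite ler_wpM2l// (le_trans ld2)// ler_peMl.
have nw1 : n * (W' - W) <= n * (n * P) by rewrite ler_pM2l//; lra.
have nw2 : n * (W - W') <= n * (n * P) by rewrite ler_pM2l//; lra.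
have ts0 : 0 <= theta * n * s by rewrite mulr_ge0// ltW.
have cs0 : 0 <= c * (2 * n * s) by rewrite mulr_ge0// !mulr_ge0// ltW.
move: Aup Alow cX qX lt1 lt0 lt3 lt4 nw1 nw2 ts0 cs0.
move: (`|ln d|) (ln d) (ln n) => e1 e2 e3.
clear; rewrite !expr2 => *; apply/andP; split; lra.
Qed.

End Weights.

(** * Quadrature of the energy *)

Section DiscreteEnergy.
Context {R : realType}.
Local Notation mu := (@lebesgue_measure R).
Implicit Types (a d S T e K eta theta : R) (N M : nat) (f U : R -> R).

Lemma sum_le_cst N (F : 'I_N -> R) c : (forall i, F i <= c) ->
  \sum_(i < N) F i <= N%:R * c.
Proof.
move=> Fc; apply: (@le_trans _ _ (\sum_(i < N) c)); first exact: ler_sum.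
by rewrite sumr_const card_ord -(mulr_natl c N).
Qed.

Lemma mean_dist N (F G : 'I_N -> R) c : (0 < N)%N ->
  (forall i, `|F i - G i| <= c) ->
  `|N%:R^-1 * \sum_(i < N) F i - N%:R^-1 * \sum_(i < N) G i| <= c.
Proof.
move=> N0 FG; have n0 : 0 < N%:R :> R by rewrite ltr0n.
rewrite -mulrBr normrM gtr0_norm ?invr_gt0// mulrC ler_pdivrMr//.
rewrite -sumrB (le_trans (ler_norm_sum _ _ _))// mulrC.
exact: sum_le_cst.
Qed.

Lemma discrete_energyE theta d S U N (y : 'I_N -> R) :
  discrete_energy theta d S U y =
  - theta * (N%:R^-1 * \sum_(i < N) (N%:R^-1 * \sum_(j < N) tlog d S (y i - y j))) +
  N%:R^-1 * \sum_(i < N) U (y i).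
Proof.
rewrite /discrete_energy -mulr_sumr; congr (_ * _ + _).
by rewrite mulrA -invfM -expr2.
Qed.

Lemma discrete_energy_perturb theta d S U e K N (y y' : 'I_N -> R) eta :
  0 < theta -> 0 < d -> 0 <= K -> (0 < N)%N ->
  (forall x x', `|U x - U x'| <= e + K * `|x - x'|) ->
  (forall i, `|y i - y' i| <= eta) ->
  `|discrete_energy theta d S U y - discrete_energy theta d S U y'| <=
  2 * theta * eta / d + (e + K * eta).
Proof.
move=> theta0 d0 K0 N0 hU yy.
rewrite !discrete_energyE opprD addrACA (le_trans (ler_normD _ _))// lerD//.
  rewrite -mulrBr normrM normrN (gtr0_norm theta0).
  have -> : 2 * theta * eta / d = theta * (2 * eta / d) by ring.
  rewrite ler_pM2l//; apply: mean_dist => // i; apply: mean_dist => // j.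
  apply: (le_trans (tlog_lip _ _ _ d0)).
  rewrite ler_pM2r ?invr_gt0//.
  have -> : y i - y j - (y' i - y' j) = (y i - y' i) - (y j - y' j) by ring.
  rewrite (le_trans (ler_normB _ _))//.
  by have := yy i; have := yy j; lra.
apply: mean_dist => // i; apply: (le_trans (hU _ _)).
by rewrite lerD2l ler_wpM2l.
Qed.

(** Particles are listed from the right, quantiles from the left. *)
Lemma discrete_energy_rev theta d S U N (y : 'I_N -> R) :
  discrete_energy theta d S U (fun i => y (rev_ord i)) = discrete_energy theta d S U y.
Proof.
rewrite /discrete_energy; congr (_ * (_ * _) + _ * _).
  rewrite [RHS](reindex_inj rev_ord_inj)/=; apply: eq_bigr => i _.
  by rewrite [RHS](reindex_inj rev_ord_inj).
by rewrite [RHS](reindex_inj rev_ord_inj).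
Qed.

(** Quadrature is used for the potential created by [f] and then, at each node, for
    the kernel itself; both are Lipschitz with constant 1 / d. *)
Lemma discrete_energy_quadrature theta d S U B e K a T f N (c z : nat -> R) :
  0 < theta -> 0 < d <= S -> 0 <= e -> 0 <= K -> (0 < N)%N ->
  measurable_fun [set: R] U -> (forall x, `|U x| <= B) ->
  (forall x x', `|U x - U x'| <= e + K * `|x - x'|) ->
  density a T f ->
  c 0%N = 0 -> c N = T ->
  (forall k, (k <= N)%N -> 0 <= c k <= T) ->
  (forall k, (k < N)%N -> c k <= c k.+1) ->
  (forall k, (k < N)%N -> \int[mu]_(x in `]c k, c k.+1]) f x = N%:R^-1) ->
  (forall k, (k < N)%N -> c k <= z k <= c k.+1) ->
  `|- theta * tlog_pair d S f f + \int[mu]_x (U x * f x) -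
     discrete_energy theta d S U (fun i : 'I_N => z i)| <=
  2 * theta * T / (d * N%:R) + (e + K * T / N%:R).
Proof.
move=> theta0 dS e0 K0 N0 mU UB hU df c0 cN c_itv c_nd c_mass z_itv.
have /andP[d0 _] := dS; have n0 : 0 < N%:R :> R by rewrite ltr0n.
have Q := quadrature df N0 c0 cN c_itv c_nd c_mass z_itv.
rewrite discrete_energyE opprD addrACA (le_trans (ler_normD _ _))// lerD//; last first.
  by apply: Q mU UB e0 K0 _ => x y _ _; exact: hU.
rewrite -mulrBr normrM normrN (gtr0_norm theta0).
have -> : 2 * theta * T / (d * N%:R) =
    theta * ((0 + d^-1 * T / N%:R) + (0 + d^-1 * T / N%:R)).
  by field; rewrite !gt_eqF.
rewrite ler_pM2l// (tlog_pairE dS df df).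
have dV0 : 0 <= d^-1 by rewrite invr_ge0 ltW.
have q1 := Q _ _ 0 d^-1 (measurable_tlog_pot dS df)
  (fun x => tlog_pot_bound x dS df) (lexx 0) dV0.
have q2 x := Q _ _ 0 d^-1 (measurable_tlog_shift d S x)
  (fun y => tlog_bound (x - y) dS) (lexx 0) dV0.
have s1 : `|\int[mu]_x (tlog_pot d S f x * f x) -
    N%:R^-1 * \sum_(k < N) tlog_pot d S f (z k)| <= 0 + d^-1 * T / N%:R.
  by apply: q1 => x y _ _; rewrite add0r; exact: tlog_pot_lip dS df.
have s2 : `|N%:R^-1 * \sum_(k < N) tlog_pot d S f (z k) -
    N%:R^-1 * \sum_(k < N) (N%:R^-1 * \sum_(j < N) tlog d S (z k - z j))| <=
    0 + d^-1 * T / N%:R.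
  apply: mean_dist => // i; apply: q2 => x y _ _.
  rewrite add0r mulrC; apply: (le_trans (tlog_lip _ _ _ d0)).
  rewrite ler_pM2r ?invr_gt0//.
  by have -> : z i - x - (z i - y) = - (x - y) by [ring]; rewrite normrN.
apply: le_trans (lerD s1 s2).
apply: le_trans (ler_normD _ _).
by rewrite le_eqVlt; apply/orP; left; apply/eqP; congr (`|_|); ring.
Qed.

(** The truncation costs theta * (2 theta^-1 d) = 2 d by [log_pair_tlog]. *)
Lemma density_energy_discrete theta d S U B e K T f N (c z : nat -> R) :
  0 < theta -> 0 < d <= S -> T <= S -> 0 <= e -> 0 <= K -> (0 < N)%N ->
  measurable_fun [set: R] U -> (forall x, `|U x| <= B) ->
  (forall x x', `|U x - U x'| <= e + K * `|x - x'|) ->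
  density theta^-1 T f ->
  c 0%N = 0 -> c N = T ->
  (forall k, (k <= N)%N -> 0 <= c k <= T) ->
  (forall k, (k < N)%N -> c k <= c k.+1) ->
  (forall k, (k < N)%N -> \int[mu]_(x in `]c k, c k.+1]) f x = N%:R^-1) ->
  (forall k, (k < N)%N -> c k <= z k <= c k.+1) ->
  `|density_energy theta U f - discrete_energy theta d S U (fun i : 'I_N => z i)| <=
  2 * d + (2 * theta * T / (d * N%:R) + (e + K * T / N%:R)).
Proof.
move=> theta0 dS TS e0 K0 N0 mU UB hU df c0 cN c_itv c_nd c_mass z_itv.
have := discrete_energy_quadrature theta0 dS e0 K0 N0 mU UB hU df c0 cN c_itv c_nd c_mass z_itv.
have h : `|density_energy theta U f - (- theta * tlog_pair d S f f + \int[mu]_x (U x * f x))| <=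
    2 * d.
  have -> : density_energy theta U f - (- theta * tlog_pair d S f f + \int[mu]_x (U x * f x)) =
      - theta * (log_pair f f - tlog_pair d S f f) by rewrite /density_energy; ring.
  rewrite normrM normrN (gtr0_norm theta0).
  have -> : 2 * d = theta * (2 * theta^-1 * d) by field; rewrite gt_eqF.
  by rewrite ler_pM2l//; exact: (log_pair_tlog dS TS df df).
move=> h2; apply: le_trans (lerD h h2); apply: le_trans (ler_normD _ _).
by rewrite le_eqVlt; apply/orP; left; apply/eqP; congr (`|_|); ring.
Qed.

Lemma density_mass_le a T f x y : density a T f -> x <= y ->
  0 <= \int[mu]_(t in `]x, y]) f t <= a * (y - x).
Proof.
move=> df xy; apply/andP; split; first by apply: Rintegral_ge0 => t _; exact: density_ge0 df.
have mx : (mu `]x, y]%classic = (y - x)%:E)%E.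
  rewrite /= lebesgue_measure_itv/= lte_fin; case: ltP => [_|yx]; first by rewrite EFinB.
  by have -> : x = y by [apply/eqP; rewrite eq_le xy]; rewrite subrr.
have -> : a * (y - x) = \int[mu]_(t in `]x, y]) cst a t.
  rewrite Rintegral_cst//; congr (_ * _); apply/esym; exact: (congr1 fine mx).
apply: le_Rintegral => //.
- by apply: integrableS (integrable_density df).
- apply: measurable_bounded_integrable => //.
  + by rewrite /= [X in (X < _)%E]mx ltry.
  + by exists `|a|; split; [exact: num_real|move=> M aM z _; exact: ltW].
- by move=> t _; exact: density_le df.
Qed.

(** The distribution function of a bounded density is continuous, so it takes the
    values k / N by the intermediate value theorem. *)
Lemma quantiles a T f N : 0 <= a -> 0 <= T -> (0 < N)%N -> density a T f ->
  exists c : nat -> R,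
  [/\ c 0%N = 0, c N = T, forall k, (k <= N)%N -> 0 <= c k <= T,
      forall k, (k < N)%N -> c k <= c k.+1 &
      forall k, (k < N)%N -> \int[mu]_(x in `]c k, c k.+1]) f x = N%:R^-1].
Proof.
move=> a0 T0 N0 df; have n0 : 0 < N%:R :> R by rewrite ltr0n.
have idf := integrable_density df.
pose F x := \int[mu]_(t in `]0, x]) f t.
have Fcat x y : 0 <= x <= y -> F y = F x + \int[mu]_(t in `]x, y]) f t.
  by move=> xy; exact: Rintegral_itvoc_cat.
have F0 : F 0 = 0 by rewrite /F set_itv_ge ?bnd_simp ?ltxx// Rintegral_set0.
have FT : F T = 1.
  have c1 (x : R) : `|cst 1 x| <= 1 :> R by rewrite /= normr1.
  have := @density_int_itvoc _ _ _ _ (cst 1) 1 df (measurable_cst _) c1.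
  rewrite (density_int_cst 1 df) => ->; apply: eq_Rintegral => x _.
  by rewrite mul1r.
pose cl := clamp T.
have cl_itv x : 0 <= cl x <= T by exact: clamp_itv.
have Flip x y : `|F (cl x) - F (cl y)| <= a * `|x - y|.
  have clxy := clamp_lip T x y; rewrite mul1r in clxy.
  apply: (@le_trans _ _ (a * `|cl x - cl y|)); last by rewrite ler_wpM2l.
  have := cl_itv x; have := cl_itv y; move: (cl x) (cl y).
  move=> {clxy} u v; wlog uv : u v / u <= v.
    move=> H ? ?; have [uv|/ltW vu] := leP u v; first exact: H.
    by rewrite distrC (distrC u); exact: H.
  move=> /andP[v0 _] /andP[u0 _]; rewrite (@Fcat u v) ?u0// opprD addNKr.
  have /andP[p0 pa] := density_mass_le df uv.
  by rewrite normrN ger0_norm// distrC ger0_norm ?subr_ge0.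
have Fex k : exists x, (k <= N)%N -> 0 <= x <= T /\ F x = k%:R / N%:R.
  have [kN|kN] := leqP k N; last by exists 0.
  have cF : {within `[0, T], continuous (F \o cl)}.
    by apply: continuous_subspaceT; exact: lipschitz_continuous a0 Flip.
  have [|x] := IVT (v := k%:R / N%:R) T0 cF.
    rewrite /= /cl !clamp_id ?lexx ?T0// F0 FT (min_idPl _)// (max_idPr _)//.
    by rewrite divr_ge0//= ler_pdivrMr// mul1r ler_nat.
  by rewrite in_itv/= => xT FE; exists x => _; rewrite xT -FE /= /cl clamp_id.
have [g gP] := choice Fex.
(* The ends are set by hand: the distribution function may be constant near 0 or T. *)
pose c k := if k == 0%N then 0 else if k == N then T else g k.
have c_itv k : (k <= N)%N -> 0 <= c k <= T.
  move=> kN; rewrite /c; case: ifP => _; first by rewrite lexx T0.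
  by case: ifP => _; [rewrite T0 lexx|have [] := gP k kN].
have Fc k : (k <= N)%N -> F (c k) = k%:R / N%:R.
  move=> kN; rewrite /c; case: eqP => [->|_]; first by rewrite mul0r.
  by case: eqP => [->|_]; [rewrite divff// gt_eqF|have [] := gP k kN].
have c_nd k : (k < N)%N -> c k <= c k.+1.
  move=> kN; rewrite leNgt; apply/negP => ck.
  have /andP[c0 _] := c_itv _ kN.
  have := @Fcat (c k.+1) (c k); rewrite c0 (ltW ck) => /(_ isT).
  rewrite (Fc _ kN) (Fc _ (ltnW kN)) => H.
  have /andP[p0 _] := density_mass_le df (ltW ck).
  have : k%:R / N%:R < k.+1%:R / N%:R :> R by rewrite ltr_pM2r ?invr_gt0// ltr_nat.
  by rewrite H; lra.
exists c; split => //.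
- by rewrite /c eqxx; case: eqP N0 => // ->.
- move=> k kN; have /andP[c0 _] := c_itv _ (ltnW kN).
  have := @Fcat (c k) (c k.+1); rewrite c0 (c_nd _ kN) => /(_ isT).
  rewrite (Fc _ kN) (Fc _ (ltnW kN)) -natr1 mulrDl mul1r => /addrI ->.
  by [].
Qed.

End DiscreteEnergy.

(** * From configurations to densities *)

Section StepDensity.
Context {R : realType}.
Local Notation mu := (@lebesgue_measure R).

Section Step.
Variables (theta : R) (n : nat) (u : nat -> R).
Let N := n.+1.
Let w := theta / N%:R.
Hypothesis theta0 : 0 < theta.
Hypothesis u0 : 0 <= u 0%N.
Hypothesis u_gap : forall k, (k.+1 < N)%N -> u k + w <= u k.+1.

Definition step_set := \big[setU/set0]_(k < N) `]u k, u k + w]%classic.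

(** A density with mass 1 / N immediately to the right of each point u k, at the
    maximal height theta^-1. *)
Definition step_density x : R := theta^-1 * \1_step_set x.

(** The end of the interval that carries the mass of u (k - 1): the cells between
    consecutive values have mass 1 / N each, and u k lies in the k-th one, as
    [density_energy_discrete] requires. *)
Definition step_cell k : R := if k is j.+1 then u j + w else 0.

Local Notation T := (step_cell N).

Let n0 : 0 < N%:R :> R. Proof. by rewrite ltr0n. Qed.

Let w0 : 0 < w. Proof. exact: divr_gt0. Qed.

Lemma step_cell_le_u k : (k < N)%N -> step_cell k <= u k.
Proof. by case: k => [|k] kN //=; exact: u_gap. Qed.

Lemma step_cell_le i j : (i <= j)%N -> (j <= N)%N -> step_cell i <= step_cell j.
Proof.
elim: j => [|j IH]; first by rewrite leqn0 => /eqP ->.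
rewrite leq_eqVlt => /predU1P[->//|]; rewrite ltnS => ij jN.
apply: (le_trans (IH ij (ltnW jN))); apply: (le_trans (step_cell_le_u jN)).
by rewrite /= lerDl ltW.
Qed.

Lemma step_setP x : step_set x <-> exists2 k, (k < N)%N & u k < x <= u k + w.
Proof.
rewrite /step_set -(bigcup_mkord N (fun k => `]u k, u k + w]%classic)).
split=> [[k /= kN]|[k kN kx]]; first by rewrite /= in_itv/=; exists k.
by exists k => //=; rewrite in_itv.
Qed.

Lemma measurable_step_set : measurable step_set.
Proof. by apply: bigsetU_measurable => i _; exact: measurable_itv. Qed.

Lemma step_set_itv x : step_set x -> 0 < x <= T.
Proof.
move=> /step_setP[k kN /andP[kx xk]].
have h0 : 0 <= u k by apply: le_trans (step_cell_le_u kN); exact: (@step_cell_le 0 k _ (ltnW kN)).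
rewrite (le_lt_trans h0 kx)/= (le_trans xk)//.
exact: (@step_cell_le k.+1 N kN (leqnn N)).
Qed.

Lemma step_set_cell k : (k < N)%N ->
  step_set `&` `]step_cell k, step_cell k.+1] = `]u k, u k + w]%classic.
Proof.
move=> kN; apply/seteqP; split=> x /=; rewrite !in_itv/=.
  move=> [/step_setP[j jN /andP[jx xj]] /andP[ckx xck]].
  have [jk|kj|<-] := ltngtP j k; last by rewrite jx xj.
    have : step_cell j.+1 <= step_cell k by apply: step_cell_le => //; exact: ltnW.
    by move=> /= h; move: (lt_le_trans ckx (le_trans xj h)); rewrite ltxx.
  have : step_cell k.+1 <= step_cell j by apply: step_cell_le => //; exact: ltnW.
  move=> h; have h2 := step_cell_le_u jN.
  by move: (lt_le_trans jx (le_trans xck (le_trans h h2))); rewrite ltxx.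
move=> /andP[kx xk]; split; first by apply/step_setP; exists k => //; rewrite kx xk.
by rewrite (le_lt_trans (step_cell_le_u kN) kx) xk.
Qed.

Lemma measurable_step_density : measurable_fun [set: R] step_density.
Proof.
by apply: measurable_funM => //; exact: measurable_indic measurable_step_set.
Qed.

Lemma step_density_itv x : 0 <= step_density x <= theta^-1.
Proof.
rewrite /step_density indicE; case: (_ \in _); rewrite ?mulr1 ?mulr0 lexx ?andbT//=.
- by rewrite invr_ge0 ltW.
- by rewrite invr_ge0 ltW.
Qed.

Lemma integrable_step_density : mu.-integrable [set: R] (EFin \o step_density).
Proof.
have E : step_density = step_density \_ `[0, T].
  apply/funext => x; rewrite patchE; case: ifPn => //.
  rewrite notin_setE/= in_itv/= => xT; rewrite /step_density indicE memNset ?mulr0//.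
  by move=> /step_set_itv/andP[x0 xT']; apply: xT; rewrite ltW.
rewrite E -restrict_EFin; apply/integrable_restrict => //; rewrite setTI.
apply: measurable_bounded_integrable => //.
- rewrite /= lebesgue_measure_itv/=; case: ifP => _; exact: ltry.
- exact: measurable_funTS measurable_step_density.
- exists theta^-1; split; first exact: num_real.
  move=> M aM x _; have /andP[s0 sa] := step_density_itv x.
  by rewrite /= ger0_norm// (le_trans sa)// ltW.
Qed.

Lemma step_density_mass k : (k < N)%N ->
  \int[mu]_(x in `]step_cell k, step_cell k.+1]) step_density x = N%:R^-1.
Proof.
move=> kN; rewrite /step_density.
have i1 : mu.-integrable `]step_cell k, step_cell k.+1] (EFin \o \1_step_set).
  have i0 : mu.-integrable `]step_cell k, step_cell k.+1] (EFin \o step_density).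
    exact: integrableS integrable_step_density.
  have := @integrableZl _ _ _ mu `]step_cell k, step_cell k.+1]%classic
    (measurable_itv _) theta _ i0.
  apply: eq_integrable => // x _; rewrite /= /step_density -EFinM mulrA divff ?gt_eqF// mul1r.
  by [].
rewrite RintegralZl// /Rintegral.
rewrite (_ : (\int[mu]_(x in _) _)%E = w%:E); last first.
  rewrite integral_indic//; last exact: measurable_step_set.
  rewrite step_set_cell// /= lebesgue_measure_itv/= lte_fin ltrDl w0.
  by rewrite -EFinB; congr EFin; ring.
by rewrite /= /w mulrA mulVf ?gt_eqF// mul1r.
Qed.

Lemma density_step : density theta^-1 T step_density.
Proof.
split.
- exact: measurable_step_density.
- exact: step_density_itv.
- move=> x xT; rewrite /step_density indicE memNset ?mulr0//.
  by move=> /step_set_itv/andP[x0 xT']; move: xT; rewrite (ltW x0) xT'.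
- have ->: \int[mu]_x step_density x = \int[mu]_(x in `]0, T]) step_density x.
    rewrite [RHS]Rintegral_mkcond; apply: eq_Rintegral => x _; rewrite patchE.
    case: ifPn => //; rewrite notin_setE/= in_itv/= => xT.
    rewrite /step_density indicE memNset ?mulr0//.
    by move=> /step_set_itv.
  suff H k : (k <= N)%N ->
      \int[mu]_(x in `]0, step_cell k]) step_density x = k%:R / N%:R.
    by rewrite H// divff// gt_eqF.
  elim: k => [|k IH] kN.
    by rewrite set_itv_ge ?bnd_simp ?ltxx// Rintegral_set0 mul0r.
  rewrite (@Rintegral_itvoc_cat _ _ _ (step_cell k)).
  - by rewrite IH ?(ltnW kN)// step_density_mass// -natr1 mulrDl mul1r.
  - by rewrite (@step_cell_le 0 k) ?(ltnW kN)//= (@step_cell_le k k.+1).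
  - exact: integrable_step_density.
Qed.

End Step.

Implicit Types (d S T e K eta theta t : R) (f U : R -> R).

(** Points that are theta / N apart are the nodes of a step density.  They are first
    moved to the left by at most [eta], with the gaps preserved, so that the step
    density lives on [0, t]. *)
Lemma discrete_energy_ge theta d S U B e K t eta n (y : 'I_n.+1 -> R) :
  0 < theta -> theta <= t <= S -> 0 < d <= S -> 0 <= e -> 0 <= K -> 0 <= eta ->
  measurable_fun [set: R] U -> (forall x, `|U x| <= B) ->
  (forall x x', `|U x - U x'| <= e + K * `|x - x'|) ->
  (forall i, 0 <= y i) ->
  (forall i j : 'I_n.+1, (i <= j)%N -> (j - i)%:R * (theta / n.+1%:R) <= y i - y j) ->
  (forall i : 'I_n.+1, y i <= t - i.+1%:R * (theta / n.+1%:R) + eta) ->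
  exists2 f, density theta^-1 t f &
  density_energy theta U f <= discrete_energy theta d S U y +
    (2 * theta * eta / d + (e + K * eta)) +
    (2 * d + (2 * theta * t / (d * n.+1%:R) + (e + K * t / n.+1%:R))).
Proof.
move=> theta0 /andP[tht tS] dS e0 K0 eta0 mU UB hU y0 ygap yt.
have /andP[d0 _] := dS; pose N : R := n.+1%:R; have n0 : 0 < N by rewrite ltr0n.
pose w := theta / N; have w0 : 0 < w by rewrite divr_gt0.
pose y' (i : 'I_n.+1) := Num.min (y i) (t - i.+1%:R * w).
(* The particles decrease, whereas step densities take increasing points. *)
pose u k := y' (rev_ord (inord k)).
have uE (i : 'I_n.+1) : u i = y' (rev_ord i) by rewrite /u inord_val.
have y'gap (i j : 'I_n.+1) : (j = i.+1 :> nat) -> y' j + w <= y' i.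
  move=> ji; rewrite /y' ji le_min; apply/andP; split.
    have := ygap i j; rewrite ji leqnSn subSnn mul1r => /(_ isT) h.
    have h2 : Num.min (y j) (t - i.+2%:R * w) <= y j by rewrite ge_min lexx.
    by apply: (le_trans (lerD h2 (lexx w))); rewrite -lerBrDl.
  have h2 : Num.min (y j) (t - i.+2%:R * w) <= t - i.+2%:R * w.
    by rewrite ge_min lexx orbT.
  apply: (le_trans (lerD h2 (lexx w))).
  by rewrite -[i.+2%:R]natr1 mulrDl mul1r; lra.
have nw : N * w = theta by rewrite /w mulrC divfK// gt_eqF.
have u0 : 0 <= u 0%N.
  rewrite /u /y' le_min y0/= subr_ge0 (le_trans _ tht)// -nw ler_pM2r// ler_nat.
  by rewrite ltnS subSS leq_subr.
have u_gap k : (k.+1 < n.+1)%N -> u k + w <= u k.+1.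
  move=> kn; apply: y'gap; rewrite /= !inordK//; last exact: ltnW.
  by rewrite subSS -subnSK// -ltnS.
have ds := density_step theta0 u0 u_gap.
set T := step_cell theta n u n.+1 in ds.
have Tt : T <= t.
  rewrite /T /= /u /y'.
  set i := rev_ord _; have -> : i = ord0 :> 'I_n.+1.
    by apply/val_inj; rewrite /= inordK// subnn.
  have h2 : Num.min (y ord0) (t - 1%:R * w) <= t - 1%:R * w by rewrite ge_min lexx orbT.
  by apply: (le_trans (lerD h2 (lexx w))); rewrite mul1r subrK.
exists (step_density theta n u); first exact: density_sub Tt ds.
have N0 : (0 < n.+1)%N by [].
have cz k : (k < n.+1)%N -> step_cell theta n u k <= u k <= step_cell theta n u k.+1.
  by move=> kn; rewrite (step_cell_le_u u0 u_gap kn)/= lerDl ltW.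
have c_itv k : (k <= n.+1)%N -> 0 <= step_cell theta n u k <= T.
  move=> kn; rewrite (@step_cell_le _ _ _ theta0 u0 u_gap 0 k _ kn)//=.
  exact: (@step_cell_le _ _ _ theta0 u0 u_gap k n.+1 kn (leqnn _)).
have c_nd k : (k < n.+1)%N -> step_cell theta n u k <= step_cell theta n u k.+1.
  by move=> kn; exact: (@step_cell_le _ _ _ theta0 u0 u_gap k k.+1).
have := density_energy_discrete theta0 dS (le_trans Tt tS) e0 K0 N0 mU UB hU ds
  erefl erefl c_itv c_nd (step_density_mass theta0 u0 u_gap) cz.
have -> : discrete_energy theta d S U (fun i : 'I_n.+1 => u i) =
    discrete_energy theta d S U y'.
  rewrite -(discrete_energy_rev theta d S U y'); congr discrete_energy.
  by apply/funext => i; exact: uE.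
have yy i : `|y i - y' i| <= eta.
  rewrite /y'; have [h|h] := leP (y i) (t - i.+1%:R * w).
    by rewrite subrr normr0.
  by rewrite ger0_norm ?subr_ge0 ?(ltW h)//; have := yt i; rewrite -/N -/w; lra.
have := discrete_energy_perturb S theta0 d0 K0 N0 hU yy.
rewrite !ler_norml => /andP[p1 p2] /andP[q1 q2].
have r1 : 2 * theta * T / (d * n.+1%:R) <= 2 * theta * t / (d * n.+1%:R).
  by rewrite ler_pM2r ?invr_gt0 ?mulr_gt0// ler_pM2l// mulr_gt0.
have r2 : K * T / n.+1%:R <= K * t / n.+1%:R.
  by rewrite ler_pM2r ?invr_gt0// ler_wpM2l.
move: p1 p2 q1 q2 r1 r2.
move: (2 * theta * T / _) (2 * theta * t / _) (K * T / _) (K * t / _) (_ * eta / d) => *.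
lra.
Qed.

End StepDensity.

(** * From densities to configurations *)

Section QuantileConfiguration.
Context {R : realType}.
Local Notation mu := (@lebesgue_measure R).
Implicit Types (d S T e K eta theta t m : R) (f U : R -> R).

(** Under a density bounded by theta^-1, a mass 1 / N takes a length theta / N. *)
Lemma quantile_gap theta t f N (c : nat -> R) : 0 < theta -> (0 < N)%N ->
  density theta^-1 t f ->
  (forall k, (k < N)%N -> c k <= c k.+1) ->
  (forall k, (k < N)%N -> \int[mu]_(x in `]c k, c k.+1]) f x = N%:R^-1) ->
  forall i j, (i <= j)%N -> (j <= N)%N -> (j - i)%:R * theta <= N%:R * (c j - c i).
Proof.
move=> theta0 N0 df c_nd c_mass i j; have n0 : 0 < N%:R :> R by rewrite ltr0n.
elim: j => [|j IH]; first by rewrite leqn0 => /eqP -> _; rewrite subrr mulr0 mul0r.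
rewrite leq_eqVlt => /predU1P[->|]; first by rewrite subnn subrr mul0r mulr0.
rewrite ltnS => ij jN; rewrite subSn// -natr1 mulrDl mul1r.
have := density_mass_le df (c_nd _ jN); rewrite (c_mass _ jN) => /andP[_ h].
have h2 : theta <= N%:R * (c j.+1 - c j).
  by rewrite mulrC -ler_pdivrMr// -ler_pdivlMl//; rewrite mulrC in h; rewrite [leLHS]mulrC.
have := IH ij (ltnW jN); rewrite !mulrBr in h2 *; lra.
Qed.

(** By [quantile_gap] the numbers N c_k - k theta are nonnegative and nondecreasing
    in k, so their integer parts form a partition.  Parts that exceed M are cut
    down to M, at a cost measured by M / N - m. *)
Lemma quantile_configuration theta t m f n M (c : nat -> R) : 0 < theta ->
  theta <= t <= m + theta -> density theta^-1 t f ->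
  c 0%N = 0 -> c n.+1 = t ->
  (forall k, (k < n.+1)%N -> c k <= c k.+1) ->
  (forall k, (k < n.+1)%N -> \int[mu]_(x in `]c k, c k.+1]) f x = n.+1%:R^-1) ->
  exists2 lambda : {ffun 'I_n.+1 -> 'I_M.+1}, lambda \in configurations n.+1 M &
  forall i, particle theta lambda i / n.+1%:R <= c (rev_ord i) <=
    particle theta lambda i / n.+1%:R + (n.+1%:R^-1 + `|n.+1%:R^-1 * M%:R - m|).
Proof.
move=> theta0 /andP[tht tm] df c0 cN c_nd c_mass.
pose N : R := n.+1%:R; have n0 : 0 < N by rewrite ltr0n.
have gap := quantile_gap theta0 (ltn0Sn n) df c_nd c_mass.
pose r k := N * c k - k%:R * theta.
have r0 k : (k <= n.+1)%N -> 0 <= r k.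
  by move=> kn; have := gap 0%N k (leq0n _) kn; rewrite subn0 c0 subr0 /r subr_ge0.
have r_nd i j : (i <= j)%N -> (j <= n.+1)%N -> r i <= r j.
  move=> ij jn; have := gap i j ij jn; rewrite natrB// /r -/N mulrBl mulrBr; lra.
have r_le k : (k <= n.+1)%N -> r k <= N * m.
  move=> kn; apply: (le_trans (r_nd k _ kn (leqnn _))).
  rewrite /r cN -/N -mulrBr ler_pM2l//; lra.
pose lambda := [ffun i : 'I_n.+1 => inord (minn M (Num.truncn (r (rev_ord i)))) : 'I_M.+1].
have lE i : lambda i = minn M (Num.truncn (r (rev_ord i))) :> nat.
  by rewrite ffunE inordK// ltnS geq_minl.
exists lambda.
  rewrite inE; apply/forallP => i; apply/forallP => j; apply/implyP => ij.
  rewrite !lE leq_min geq_minl/= (leq_trans (geq_minr _ _))//.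
  apply: le_truncn; apply: r_nd => /=; last by rewrite leq_subr.
  by rewrite !subSS leq_sub2l.
move=> i; have rn : (rev_ord i <= n.+1)%N by rewrite ltnW.
have pE : particle theta lambda i = (lambda i)%:R + (rev_ord i)%:R * theta by [].
have cE : N * c (rev_ord i) = r (rev_ord i) + (rev_ord i)%:R * theta by rewrite /r subrK.
set k := rev_ord i in rn pE cE *.
have l_le : (lambda i)%:R <= r k.
  apply: (@le_trans _ _ (Num.truncn (r k))%:R); first by rewrite ler_nat lE geq_minr.
  by rewrite truncn_le// r0.
have l_ge : r k <= (lambda i)%:R + (1 + N * `|N^-1 * M%:R - m|).
  have nn : 0 <= N * `|N^-1 * M%:R - m| by rewrite mulr_ge0// ltW.
  rewrite lE; have [h|h] := leqP M (Num.truncn (r (rev_ord i))); rewrite -/k in h *.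
    have -> : N * `|N^-1 * M%:R - m| = `|M%:R - N * m|.
      by rewrite -{1}(gtr0_norm n0) -normrM mulrBr mulVKf// gt_eqF.
    have := r_le k rn; have := ler_norm (- (M%:R - N * m)); rewrite normrN; lra.
  by have := ltW (truncnS_gt (r k)); rewrite -natr1; lra.
rewrite pE; apply/andP; split; rewrite -(ler_pM2l n0) cE.
  by rewrite mulrC divfK ?gt_eqF// lerD2r.
rewrite -/N !mulrDr mulfV ?gt_eqF// [N * (_ / N)]mulrC divfK ?gt_eqF//; lra.
Qed.

End QuantileConfiguration.

(** * Restricted partition functions *)

Section Asymptotics.
Context {R : realType}.
Implicit Types (theta t m : R) (U : R -> R).

Definition min_density_energy theta U t : R :=
  inf [set density_energy theta U f | f in density theta^-1 t].

(** Uniform continuity, for a bounded function, in the form that suits quadrature: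
    Lipschitz up to an error. *)
Definition quasi_lipschitz U := forall e : R, 0 < e ->
  exists2 K : R, 0 <= K & forall x x', `|U x - U x'| <= e + K * `|x - x'|.

Lemma density_uniform theta t : 0 < theta -> theta <= t ->
  exists f, density theta^-1 t f.
Proof.
move=> theta0 tht.
have u0 : (0 : R) <= (fun _ : nat => 0) 0%N by [].
have h (k : nat) : (k.+1 < 1)%N -> (fun _ : nat => 0) k + theta / 1%:R <=
   (fun _ : nat => 0) k.+1 :> R by [].
have := @density_step R theta 0 (fun=> 0) theta0 u0 h.
rewrite /= add0r divr1 => df; exists (step_density theta 0 (fun=> 0)).
exact: density_sub tht df.
Qed.

Lemma min_density_energy_le theta U B t f : 0 < theta ->
  measurable_fun [set: R] U -> (forall x, `|U x| <= B) ->
  density theta^-1 t f -> min_density_energy theta U t <= density_energy theta U f.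
Proof.
move=> theta0 mU UB df; apply: ge_inf; last by exists f.
have a0 : 0 < theta^-1 by rewrite invr_gt0.
have [L hL] := density_energy_lb t a0 theta0 mU UB.
by exists L => _ [g dg <-]; exact: hL.
Qed.

Lemma min_density_energy_adh theta U B t e : 0 < theta -> theta <= t ->
  measurable_fun [set: R] U -> (forall x, `|U x| <= B) -> 0 < e ->
  exists2 f, density theta^-1 t f &
    density_energy theta U f < min_density_energy theta U t + e.
Proof.
move=> theta0 tht mU UB e0.
have a0 : 0 < theta^-1 by rewrite invr_gt0.
have [L hL] := density_energy_lb t a0 theta0 mU UB.
have [f0 df0] := density_uniform theta0 tht.
have hi : has_inf [set density_energy theta U f | f in density theta^-1 t].
  by split; [exists (density_energy theta U f0), f0|exists L => _ [g dg <-]; exact: hL].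
by have [_ [f df <-] h] := inf_adherent e0 hi; exists f.
Qed.

(** Upper bound: by [discrete_energy_ge] no weight exceeds
    exp (N^2 (theta ln N - F + small)), F being the least energy on [0, t], and
    there are at most (M + 1)^N of them.  Lower bound: the sum is at least the
    weight of the configuration given by the quantiles of a nearly minimizing
    density.  The event [E] is only squeezed between two bounds on the first
    particle because the full partition function is to be covered, with
    t = m + theta, and there l_1 / N may exceed t slightly. *)
Lemma ln_restricted_partition theta t m U B eps : 0 < theta ->
  0 <= m -> theta <= t <= m + theta -> measurable_fun [set: R] U ->
  (forall x, `|U x| <= B) -> quasi_lipschitz U -> 0 < eps ->
  exists2 r0 : R, 0 < r0 & forall n M (VN : R -> R)
    (E : pred {ffun 'I_n.+1 -> 'I_M.+1}) r,
  r <= r0 -> (Num.sqrt n.+1%:R)^-1 <= r -> `|n.+1%:R^-1 * M%:R - m| <= r ->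
  (forall (lambda : {ffun 'I_n.+1 -> 'I_M.+1}) i,
     `|VN (particle theta lambda i / n.+1%:R) -
       U (particle theta lambda i / n.+1%:R)| <= r) ->
  (forall lambda, lambda \in configurations n.+1 M -> E lambda ->
     particle theta lambda ord0 <= (t + r) * n.+1%:R) ->
  (forall lambda, lambda \in configurations n.+1 M ->
     particle theta lambda ord0 <= t * n.+1%:R -> E lambda) ->
  0 < \sum_(lambda in configurations n.+1 M | E lambda) gibbs_weight theta VN lambda /\
  `|(n.+1%:R ^+ 2)^-1 *
      ln (\sum_(lambda in configurations n.+1 M | E lambda)
            gibbs_weight theta VN lambda) -
    theta * ln n.+1%:R + min_density_energy theta U t| <= eps.
Proof.
move=> theta0 m0 /[dup] ttm /andP[tht tm] mU UB qU eps0.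
have t0 : 0 < t by exact: lt_le_trans tht.
have [C C0 HC] := ln_gibbs_weight_bounds theta0.
pose S := m + theta + 2.
(* This truncation level keeps 2 d and 8 theta sqrt (d / theta) at most eps / 8. *)
pose d := Num.min 1 (Num.min (eps / 16) (theta * (eps / (64 * theta)) ^+ 2)).
have d0 : 0 < d.
  by rewrite !lt_min ltr01 divr_gt0//= mulr_gt0// exprn_gt0// divr_gt0// mulr_gt0.
have d1 : d <= 1 by rewrite ge_min lexx.
have d2 : d <= eps / 16 by rewrite !ge_min lexx orbT.
have d3 : 8 * theta * Num.sqrt (d / theta) <= eps / 8.
  have h : d / theta <= (eps / (64 * theta)) ^+ 2.
    by rewrite ler_pdivrMr// mulrC !ge_min lexx !orbT.
  have : Num.sqrt (d / theta) <= eps / (64 * theta).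
    have e0 : 0 <= eps / (64 * theta) by rewrite divr_ge0// ?mulr_ge0// ltW.
    by rewrite -[leRHS](ger0_norm e0) -sqrtr_sqr ler_sqrt// sqr_ge0.
  rewrite -(ler_pM2l (_ : 0 < 8 * theta)) ?mulr_gt0// => h2.
  have -> : eps / 8 = 8 * theta * (eps / (64 * theta)) by field; rewrite gt_eqF.
  exact: h2.
have dS : 0 < d <= S by rewrite d0/= (le_trans d1)// /S; lra.
pose e := eps / 16; have e0 : 0 < e by rewrite divr_gt0.
have [K K0 hU] := qU e e0.
(* Q r collects the errors of order r, and CC r adds that of the number of configurations. *)
pose Q := (C + theta * `|ln d|) + 1 + 2 * theta * t / d + K * t +
  (2 * theta / d + K) * (2 + theta).
pose CC := Q + 2 * Num.sqrt (m + 2).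
have q1 : 0 <= C + theta * `|ln d| by rewrite addr_ge0// mulr_ge0// ltW.
have q2 : 0 <= 2 * theta * t / d by rewrite divr_ge0 ?mulr_ge0// ltW.
have q3 : 0 <= K * t by rewrite mulr_ge0// ltW.
have q4 : 0 <= 2 * theta / d by rewrite divr_ge0 ?mulr_ge0// ltW.
have q5 : 0 <= (2 * theta / d + K) * (2 + theta).
  by rewrite mulr_ge0 ?addr_ge0// ltW.
have q6 : 0 <= Num.sqrt (m + 2) by exact: sqrtr_ge0.
have CC0 : 0 < CC by rewrite /CC /Q; lra.
exists (Num.min 1 (eps / (4 * CC))).
  by rewrite lt_min ltr01/= divr_gt0// mulr_gt0.
move=> n M VN E r rr0 sr dr VU Ea Eb.
pose N : R := n.+1%:R; have n0 : 0 < N by rewrite ltr0n.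
have n1 : 1 <= N by rewrite ler1n.
pose sN := Num.sqrt N; have sN0 : 0 < sN by rewrite sqrtr_gt0.
have sN2 : sN * sN = N by rewrite -expr2 sqr_sqrtr// ltW.
have sN1 : 1 <= sN by rewrite -[leLHS](sqrtr1 R) ler_sqrt.
have r_gt0 : 0 < r by apply: lt_le_trans sr; rewrite invr_gt0.
have r1 : r <= 1 by apply: (le_trans rr0); rewrite ge_min lexx.
have CCr : CC * r <= eps / 4.
  have : r <= eps / (4 * CC) by apply: (le_trans rr0); rewrite ge_min lexx orbT.
  rewrite -(ler_pM2l CC0); congr (_ <= _); field; exact: lt0r_neq0.
have iN : N^-1 <= r.
  apply: le_trans sr; rewrite -/N -/sN lef_pV2 ?posrE// -sN2.
  by rewrite ler_peMl// ltW.
pose w := theta / N; have w0 : 0 < w by rewrite divr_gt0.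
have wr : w <= theta * r by rewrite ler_pM2l.
pose F := min_density_energy theta U t.
pose b := - F + 2 * d + 2 * e + Q * r.
have up (lambda : {ffun 'I_n.+1 -> 'I_M.+1}) : lambda \in configurations n.+1 M -> E lambda ->
    (N ^+ 2)^-1 * ln (gibbs_weight theta VN lambda) - theta * ln N <= b.
  move=> lc El; pose y i := particle theta lambda i / N.
  have y0 i : 0 <= y i by rewrite divr_ge0 ?particle_ge0// ltW.
  have ygap (i j : 'I_n.+1) : (i <= j)%N -> (j - i)%:R * (theta / N) <= y i - y j.
    move=> ij; rewrite mulrA -mulrBl ler_pM2r ?invr_gt0//.
    exact: particle_gap.
  have yt0 : y ord0 <= t + r by rewrite ler_pdivrMr// Ea.
  have yt i : y i <= t - i.+1%:R * (theta / N) + (r + w).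
    have := ygap ord0 i (leq0n _); rewrite subn0 -/w.
    rewrite -natr1 mulrDl mul1r; lra.
  have yS i : y i <= S.
    have := yt i; have : 0 <= i.+1%:R * (theta / N) by rewrite mulr_ge0// ltW.
    have := ygap ord0 i (leq0n _); rewrite subn0 -/w.
    have : 0 <= i%:R * w by rewrite mulr_ge0// ltW.
    by rewrite /S; lra.
  have /andP[_ hup] := HC n.+1 M lambda VN U d S r (ltn0Sn n) lc dS yS (VU lambda).
  have tS : theta <= t <= S by rewrite tht/= /S; lra.
  have eta0 : 0 <= r + w by rewrite addr_ge0// ltW.
  have [f df hf] := discrete_energy_ge theta0 tS dS (ltW e0) K0 eta0 mU UB hU y0 ygap yt.
  have hF := min_density_energy_le theta0 mU UB df; rewrite -/F in hF.
  apply: (le_trans hup); rewrite -/N -/sN.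
  move: hf hF; rewrite -/N -/y.
  set H := discrete_energy _ _ _ _ _; set EE := density_energy _ _ _ => hf hF.
  have b1 : (C + theta * `|ln d|) / sN <= (C + theta * `|ln d|) * r by rewrite ler_wpM2l.
  have b2 : 2 * theta * t / (d * N) <= 2 * theta * t / d * r.
    by rewrite invfM mulrA ler_wpM2l.
  have b3 : K * t / N <= K * t * r by rewrite ler_wpM2l.
  have b4 : 2 * theta * (r + w) / d + K * (r + w) <= (2 * theta / d + K) * (2 + theta) * r.
    have -> : 2 * theta * (r + w) / d + K * (r + w) = (2 * theta / d + K) * (r + w) by ring.
    rewrite -[leRHS]mulrA ler_wpM2l ?addr_ge0// mulrDl; lra.
  move: hf hF b1 b2 b3 b4; rewrite /b /Q.
  move: (_ / sN) (2 * theta * t / _) (K * t / N) (2 * theta * (r + w) / d) (K * (r + w)).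
  clear; move: ((2 * theta / d + K) * (2 + theta)) (2 * theta * t / d) => *; lra.
(* Lower bound: the configuration given by quantiles. *)
have eps8 : 0 < eps / 8 by rewrite divr_gt0.
have [f df hf] := min_density_energy_adh theta0 tht mU UB eps8.
have tV0 : 0 <= theta^-1 by rewrite invr_ge0 ltW.
have [c [c0 cN c_itv c_nd c_mass]] := quantiles tV0 (ltW t0) (ltn0Sn n) df.
have [lambda lc lcE] := quantile_configuration M theta0 ttm df c0 cN c_nd c_mass.
pose y i := particle theta lambda i / N.
have ct (i : 'I_n.+1) : c (rev_ord i) <= t.
  by have /andP[] := c_itv (rev_ord i) (ltnW (ltn_ord _)).
have yt i : y i <= t by have /andP[h _] := lcE i; exact: le_trans h (ct i).
have yS i : y i <= S by apply: (le_trans (yt i)); rewrite /S; lra.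
have El : E lambda.
  by apply: Eb => //; have := yt ord0; rewrite /y ler_pdivrMr.
have low : - (F + eps / 8) - 2 * d - 2 * e - Q * r - eps / 8 <=
    (N ^+ 2)^-1 * ln (gibbs_weight theta VN lambda) - theta * ln N.
  have /andP[hlow _] := HC n.+1 M lambda VN U d S r (ltn0Sn n) lc dS yS (VU lambda).
  apply: le_trans hlow; rewrite -/N -/sN.
  have yc i : `|y i - c (rev_ord i)| <= 2 * r.
    have /andP[h1 h2] := lcE i; rewrite -/N -/(y i) in h1 h2.
    rewrite -/N in dr.
    rewrite distrC ger0_norm ?subr_ge0// lerBlDl (le_trans h2)// lerD2l.
    by rewrite mulr_natl mulr2n lerD.
  have h1 := discrete_energy_perturb S theta0 d0 K0 (ltn0Sn n) hU yc.
  have cz k : (k < n.+1)%N -> c k <= c k <= c k.+1 by move=> kn; rewrite lexx c_nd.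
  have tS : t <= S by rewrite /S; lra.
  have h2 := density_energy_discrete theta0 dS tS (ltW e0) K0 (ltn0Sn n) mU UB hU df
    c0 cN c_itv c_nd c_mass cz.
  have h3 := discrete_energy_rev theta d S U (fun i : 'I_n.+1 => c i).
  rewrite -h3 in h2; move: h1 h2; rewrite !ler_norml -/N => /andP[_ h1] /andP[h2 _].
  move: h1 h2 hf; rewrite -/F -/y.
  set H := discrete_energy _ _ _ _ y; set H' := discrete_energy _ _ _ _ _.
  set EE := density_energy _ _ _ => h1 h2 hf'.
  have b1 : (C + theta * `|ln d|) / sN <= (C + theta * `|ln d|) * r by rewrite ler_wpM2l.
  have b2 : 2 * theta * t / (d * N) <= 2 * theta * t / d * r.
    by rewrite invfM mulrA ler_wpM2l.
  have b3 : K * t / N <= K * t * r by rewrite ler_wpM2l.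
  have b4 : 2 * theta * (2 * r) / d + K * (2 * r) <= (2 * theta / d + K) * (2 + theta) * r.
    have -> : 2 * theta * (2 * r) / d + K * (2 * r) = (2 * theta / d + K) * (2 * r) by ring.
    rewrite -[leRHS]mulrA ler_wpM2l ?addr_ge0// [leRHS]mulrDl lerDl.
    by rewrite mulr_ge0// ltW.
  move: h1 h2 hf' b1 b2 b3 b4 d3; rewrite /Q.
  move: (_ / sN) (2 * theta * t / _) (K * t / N) (2 * theta * (2 * r) / d) (K * (2 * r)).
  move: (8 * theta * _).
  clear; move: ((2 * theta / d + K) * (2 + theta)) (2 * theta * t / d) => *; lra.
pose P lambda := (lambda \in configurations n.+1 M) && E lambda.
set Z := \sum_(lambda in _ | _) _.
have w_gt0 l : P l -> 0 < gibbs_weight theta VN l.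
  by move=> /andP[lc' _]; exact: gibbs_weight_gt0.
have Pl : P lambda by rewrite /P lc El.
have Zw : gibbs_weight theta VN lambda <= Z.
  rewrite /Z (bigD1 lambda)//= lerDl; apply: sumr_ge0 => l /andP[Pl' _].
  by apply: ltW; exact: w_gt0.
have Z0 : 0 < Z by apply: lt_le_trans Zw; exact: w_gt0.
split => //.
have N20 : 0 < N ^+ 2 by rewrite exprn_gt0.
have lnZ_low : (N ^+ 2)^-1 * ln (gibbs_weight theta VN lambda) <= (N ^+ 2)^-1 * ln Z.
  by rewrite ler_pM2l ?invr_gt0// ler_ln ?posrE//; exact: w_gt0.
have Zup : Z <= M.+1%:R ^+ n.+1 * expR (N ^+ 2 * (theta * ln N + b)).
  apply: (@le_trans _ _ (\sum_(l : {ffun 'I_n.+1 -> 'I_M.+1})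
    expR (N ^+ 2 * (theta * ln N + b)))).
    rewrite /Z big_mkcond; apply: ler_sum => l _; case: ifPn => [Pl'|_]; last exact: expR_ge0.
    rewrite -[leLHS]lnK ?posrE ?w_gt0// ler_expR -ler_pdivrMl//.
    by have /andP[lc' El'] := Pl'; rewrite -lerBlDl; exact: up.
  rewrite sumr_const -(mulr_natl (expR _)) card_ffun !card_ord natrX.
  by [].
have lnZ_up : (N ^+ 2)^-1 * ln Z <= N^-1 * ln M.+1%:R + (theta * ln N + b).
  rewrite mulrC ler_pdivrMr//.
  have := Zup; rewrite -ler_ln ?posrE//; last first.
    by rewrite mulr_gt0 ?exprn_gt0 ?expR_gt0.
  rewrite lnM ?posrE ?exprn_gt0 ?expR_gt0// lnXn// expRK => h.
  apply: (le_trans h); rewrite -(mulr_natr (ln _) n.+1) -/N.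
  rewrite le_eqVlt; apply/orP; left; apply/eqP; field.
  exact: lt0r_neq0.
have lnM : N^-1 * ln M.+1%:R <= 2 * Num.sqrt (m + 2) * r.
  have MN : M%:R <= N * (m + 1).
    have : N^-1 * M%:R <= m + 1.
      by move: dr; rewrite -/N ler_norml => /andP[_ h]; rewrite -lerBlDl (le_trans h).
    by rewrite mulrC ler_pdivrMr// mulrC.
  have M1 : M.+1%:R <= N * (m + 2).
    have -> : N * (m + 2) = N * (m + 1) + N by ring.
    by rewrite -natr1 lerD.
  have m2 : 0 <= m + 2 by lra.
  have h1 : ln M.+1%:R <= 2 * (sN * Num.sqrt (m + 2)).
    apply: (le_trans (ln_le_sqrt _)) => //.
    rewrite ler_pM2l// -sqrtrM ?ler_sqrt// ?mulr_ge0//; exact: ltW.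
  rewrite mulrC ler_pdivrMr//; apply: (le_trans h1).
  have -> : 2 * (sN * Num.sqrt (m + 2)) = 2 * Num.sqrt (m + 2) * sN by ring.
  rewrite -[leRHS]mulrA ler_wpM2l ?mulr_ge0//.
  have : sN^-1 * N <= r * N by rewrite ler_pM2r.
  by rewrite -{1}sN2 mulKf// gt_eqF.
have CCr' : Q * r + 2 * Num.sqrt (m + 2) * r <= eps / 4 by rewrite -mulrDl.
have g0 : 0 <= 2 * Num.sqrt (m + 2) * r by rewrite !mulr_ge0// ltW.
rewrite -/N -/F ler_norml; apply/andP; split.
  move: low lnZ_low CCr' g0 eps0 d2; rewrite /e.
  move: (Q * r) (2 * _ * r); clear.
  by move: (_ * ln Z) (_ * ln (gibbs_weight _ _ _)) => *; lra.
move: lnZ_up lnM CCr' g0 eps0 d2; rewrite /b /e.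
move: (Q * r) (2 * _ * r); clear.
by move: (_ * ln Z) (N^-1 * _) => *; lra.
Qed.

End Asymptotics.

(** * Continuous potentials on an interval *)

Section ClampedPotential.
Context {R : realType}.
Variables (V : R -> R) (s0 A3 : R).
Hypothesis s00 : 0 <= s0.
Hypothesis V_continuous : {within `[0, s0], continuous V}.
Hypothesis V_bound : forall s : R, s \in `[0, s0] -> `|V s| <= A3.

Local Notation clamp := (clamp s0).

(** An extension of V from [0, s0] to a bounded continuous function on the line. *)
Definition clamped (x : R) : R := V (clamp x).

Lemma clampedE x : 0 <= x <= s0 -> clamped x = V x.
Proof. by move=> xs; rewrite /clamped clamp_id. Qed.

Lemma clamped_bound x : `|clamped x| <= A3.
Proof. by apply: V_bound; rewrite in_itv/= (clamp_itv _ s00). Qed.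

Lemma continuous_clamped : continuous clamped.
Proof.
move=> x; apply/cvgrPdist_le => e e0.
have /subspace_continuousP/(_ (clamp x)) := V_continuous.
rewrite /= in_itv/= (clamp_itv _ s00) => /(_ isT)/cvgrPdist_le/(_ e e0) H.
have cc : continuous clamp by exact: lipschitz_continuous ler01 (clamp_lip s0).
have H2 := cc x _ H; near=> y.
suff : `[0, s0]%classic (clamp y) -> `|V (clamp x) - V (clamp y)| <= e.
  by apply; rewrite /= in_itv/= (clamp_itv _ s00).
by near: y; exact: H2.
Unshelve. all: end_near. Qed.

(** By compactness there is a distance d below which the function varies by at most
    e; from d on, the Lipschitz term with K = 2 A3 / d exceeds its oscillation. *)
Lemma quasi_lipschitz_clamped : quasi_lipschitz clamped.
Proof.
move=> e e0.
pose P (d x : R) := forall x', `|x - x'| < d -> `|clamped x - clamped x'| <= e.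
have cK : compact `[0, s0]%classic by exact: segment_compact.
have H : \forall d \near 0^'+, `[0, s0]%classic `<=` P d.
  have cov := (compact_near_coveringP _).1 cK.
  apply: (cov R (0^'+) P _) => x _.
  have e2 : 0 < e / 2 by rewrite divr_gt0.
  have /cvgrPdist_le/(_ _ e2)/nbhs_ballP[r /= r0 Hr] := @continuous_clamped x.
  exists (ball x (r / 2), [set d : R | d < r / 2]); first split => /=.
  - by apply: nbhsx_ballx; rewrite divr_gt0.
  - by apply: nbhs_right_lt; rewrite divr_gt0.
  - move=> [y d] /= [xy dr] x' yx'.
    have h1 : `|clamped x - clamped y| <= e / 2.
      by apply: Hr; rewrite /ball/= in xy *; lra.
    have h2 : `|clamped x - clamped x'| <= e / 2.
      apply: Hr; rewrite /ball/= in xy *.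
      have -> : x - x' = (x - y) + (y - x') by ring.
      by apply: le_lt_trans (ler_normD _ _) _; lra.
    have -> : clamped y - clamped x' = - (clamped x - clamped y) + (clamped x - clamped x') by ring.
    by rewrite (le_trans (ler_normD _ _))// normrN; lra.
have [d [d0 Hd]] : exists d, 0 < d /\ `[0, s0]%classic `<=` P d.
  near (0 : R)^'+ => d; exists d; split; first by near: d; exact: nbhs_right_gt.
  by near: d.
have A30 : 0 <= A3 by exact: le_trans (clamped_bound 0).
exists (2 * A3 / d); first by rewrite divr_ge0 ?mulr_ge0// ltW.
move=> x x'.
have [h|h] := ltP `|clamp x - clamp x'| d.
  have := Hd (clamp x); rewrite /= in_itv/= (clamp_itv _ s00) => /(_ isT (clamp x') h).
  rewrite /clamped (clamp_id (clamp_itv x s00)) (clamp_id (clamp_itv x' s00)) => h2.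
  by rewrite (le_trans h2)// lerDl mulr_ge0// divr_ge0 ?mulr_ge0// ltW.
apply: (@le_trans _ _ (2 * A3)).
  rewrite (le_trans (ler_normB _ _))//.
  by have := clamped_bound x; have := clamped_bound x'; lra.
rewrite ler_wpDl ?(ltW e0)// mulrAC ler_pdivlMr//.
rewrite ler_wpM2l ?mulr_ge0// (le_trans h)//.
by have := clamp_lip s0 x x'; rewrite mul1r.
Unshelve. all: end_near. Qed.

End ClampedPotential.

(** * The rightmost point of the support *)

Section Main.
Context {R : realType}.
Local Notation mu := (@lebesgue_measure R).
Implicit Types (theta t s b : R) (U V f : R -> R).

Lemma min_energyE theta V U t : 0 < theta -> measurable_fun [set: R] U ->
  (forall x, 0 <= x <= t -> V x = U x) ->
  min_energy theta V t = min_density_energy theta U t.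
Proof.
move=> theta0 mU VU; rewrite /min_energy /min_density_energy; congr inf.
apply/seteqP; split=> _ [f df <-].
  have [g [dg Eg _]] := admissible_ae_density theta0 df.
  by exists g => //; rewrite (Eg V U mU VU).
exists f; first exact: admissible_density.
by apply: (energyE theta VU) => x xt; case: df => _ _ ->.
Qed.

Lemma density_mass_subset (a s0 : R) f (A B : set R) : density a s0 f ->
  measurable A -> measurable B -> A `&` `[0, s0] `<=` B ->
  \int[mu]_(t in A) f t <= \int[mu]_(t in B) f t.
Proof.
move=> df mA mB AB; rewrite Rintegral_mkcond [leRHS]Rintegral_mkcond.
have idf := integrable_density df.
have iA (D : set R) : measurable D -> mu.-integrable [set: R] (EFin \o (f \_ D)).
  move=> mD; rewrite -restrict_EFin; apply/integrable_restrict => //; rewrite setTI.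
  exact: integrableS idf.
apply: le_Rintegral => //; [exact: iA|exact: iA|move=> x _].
rewrite !patchE; case: ifPn => [/set_mem Ax|_]; last first.
  by case: ifP => // _; exact: density_ge0 df.
have [xs|xs] := boolP (0 <= x <= s0).
  by rewrite mem_set//; apply: AB; split => //=; rewrite in_itv.
have -> : f x = 0 by case: df => _ _ ->.
by case: ifP.
Qed.

Lemma density_support_itv (a s0 : R) f b : density a s0 f ->
  (forall e, 0 < e -> 0 < \int[mu]_(y in `]b - e, b + e[) f y) -> 0 <= b <= s0.
Proof.
move=> df Sb; rewrite -[_ && _]negbK negb_and -!ltNge.
have out (e : R) : 0 < e -> `]b - e, b + e[ `&` `[0, s0] `<=` set0 -> False.
  move=> e0 H; have := Sb _ e0; rewrite ltNge => /negP; apply.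
  rewrite -[leRHS](@Rintegral_set0 _ _ _ mu f).
  exact: (density_mass_subset df).
apply/negP => /orP[b0|sb].
  apply: (out (- b)); rewrite ?oppr_gt0// => x [/=]; rewrite !in_itv/=.
  by move=> /andP[_ h] /andP[h2 _]; lra.
apply: (out (b - s0)); rewrite ?subr_gt0// => x [/=]; rewrite !in_itv/=.
by move=> /andP[h _] /andP[_ h2]; lra.
Qed.

(** If the mass m beyond b were positive, every neighbourhood of the last point up to
    which at most m / 2 is collected would have positive mass. *)
Lemma density_tail0 theta (s0 : R) f b : 0 < theta -> density theta^-1 s0 f ->
  (forall x, b < x -> exists2 e : R, 0 < e & \int[mu]_(y in `]x - e, x + e[) f y <= 0) ->
  b <= s0 -> \int[mu]_(x in `]b, s0]) f x = 0.
Proof.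
move=> theta0 df Hb bs; apply/eqP; rewrite eq_le; apply/andP; split; last first.
  by apply: Rintegral_ge0 => x _; exact: density_ge0 df.
rewrite leNgt; apply/negP => m0; set m := Rintegral _ _ _ in m0.
have idf := integrable_density df.
pose G x := \int[mu]_(y in `]b, x]) f y.
have Gcat x y : b <= x <= y -> G y = G x + \int[mu]_(t in `]x, y]) f t.
  by move=> xy; exact: Rintegral_itvoc_cat.
have Gnd x y : b <= x -> x <= y -> G x <= G y.
  move=> bx xy; rewrite (@Gcat x y) ?bx// lerDl.
  by apply: Rintegral_ge0 => z _; exact: density_ge0 df.
pose A := [set x | b <= x <= s0 /\ G x <= m / 2].
have Gb : G b = 0 by rewrite /G set_itv_ge ?bnd_simp ?ltxx// Rintegral_set0.
have /andP[_ mle] := density_mass_le df bs; rewrite -/m in mle.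
(* As f <= theta^-1, at most m / 2 is collected up to x1, so the supremum exceeds b. *)
pose x1 := b + theta * (m / 2).
have x1b : b < x1 by rewrite ltrDl mulr_gt0// divr_gt0.
have x1s : x1 <= s0.
  have : theta * m <= s0 - b.
    by rewrite -(ler_pM2l theta0) mulVKf ?gt_eqF// in mle.
  have : 0 < theta * m by rewrite mulr_gt0.
  by rewrite /x1; lra.
have A1 : A x1.
  split; first by rewrite (ltW x1b).
  have /andP[_ h] := density_mass_le df (ltW x1b).
  apply: (le_trans h); rewrite /x1 addrC addKr mulKf// gt_eqF//.
have hA : has_sup A.
  split; first by exists x1.
  by exists s0 => x [/andP[_ ?] _].
pose xs := sup A.
have x1xs : x1 <= xs by apply: sup_upper_bound.
have xss0 : xs <= s0 by apply: ge_sup; [exists x1|move=> x [/andP[_ ?] _]].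
have [e e0 He] := Hb xs (lt_le_trans x1b x1xs).
have [x [/andP[bx xs0'] Gx] xe] := sup_adherent e0 hA; rewrite -/xs in xe.
have xxs : x <= xs by apply: sup_upper_bound => //; split => //; rewrite bx.
pose y := Num.min (xs + e / 2) s0.
have xy : x <= y by rewrite le_min xs0' andbT; lra.
have yxs : y < xs + e by rewrite gt_min; apply/orP; left; lra.
have Gy : m / 2 < G y.
  rewrite ltNge; apply/negP => h.
  have Ay : A y by split => //; rewrite (le_trans bx xy)/= ge_min lexx orbT.
  have yx : y <= xs by exact: sup_upper_bound.
  have : y = s0.
    by rewrite /y; apply/min_idPr; move: yx; rewrite /y ge_min => /orP[]; lra.
  by move=> ys; move: h; rewrite ys /G -/m; lra.
move: He; rewrite leNgt => /negP; apply.
apply: (@lt_le_trans _ _ (\int[mu]_(t in `]x, y]) f t)).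
  by have := @Gcat x y; rewrite bx xy => /(_ isT); lra.
apply: (density_mass_subset df) => // z [/=]; rewrite !in_itv/= => /andP[xz zy] _.
by rewrite (lt_trans xe xz) (le_lt_trans zy yxs).
Qed.

Lemma density_truncate theta U (s0 : R) f t : 0 < theta -> t <= s0 ->
  measurable_fun [set: R] U -> density theta^-1 s0 f ->
  \int[mu]_(x in `]t, s0]) f x = 0 ->
  exists2 g, density theta^-1 t g & density_energy theta U g = density_energy theta U f.
Proof.
move=> theta0 ts mU df m0; have mf := density_measurable df.
have idf := integrable_density df.
pose g := f \_ `[0, t].
have mg : measurable_fun [set: R] g.
  apply: (measurable_restrictT _ (measurable_itv `[0, t])).1.
  exact: measurable_funTS.
have fg : {ae mu, forall x, f x = g x}.
  have : ae_eq mu `]t, s0]%classic (EFin \o f) (cst 0%E).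
    apply/ae_eq_integral_abs => //.
      by apply: measurable_funTS; exact/measurable_EFinP.
    under eq_integral do rewrite /= ger0_norm ?(density_ge0 _ df)//.
    have ifs : mu.-integrable `]t, s0] (EFin \o f) by exact: integrableS idf.
    by rewrite -[LHS]fineK ?(integrable_fin_num _ ifs)// [fine _]m0.
  apply: (@filterS _ _ (ae_filter_ringOfSetsType mu)) => x /= H.
  rewrite /g patchE; case: ifPn => //; rewrite notin_setE/= in_itv/= => xt.
  have [xs|xs] := boolP (0 <= x <= s0); last by case: df => _ _ ->.
  have /andP[x0 xs0] := xs.
  have tx : t < x by rewrite ltNge; apply/negP => h; apply: xt; rewrite x0 h.
  by have := H; rewrite in_itv/= tx xs0 => /(_ isT) [].
have ieq (h : R -> R) : measurable_fun [set: R] h ->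
    \int[mu]_x (h x * g x) = \int[mu]_x (h x * f x).
  move=> mh; rewrite /Rintegral; congr fine; apply: ae_eq_integral => //.
  - by apply/measurable_EFinP; exact: measurable_funM.
  - by apply/measurable_EFinP; exact: measurable_funM.
  - by apply: (@filterS _ _ (ae_filter_ringOfSetsType mu) _ _ _ fg) => x /= ->.
exists g; last first.
  by rewrite /density_energy (log_pair_ae mf mg fg) ieq.
split => //.
- move=> x; rewrite /g patchE; case: ifP => _.
    by rewrite (density_ge0 _ df) (density_le _ df).
  by rewrite lexx invr_ge0 ltW.
- by move=> x xt; rewrite /g patchE memNset//= in_itv/=; exact/negP.
- transitivity (\int[mu]_x (cst 1 x * g x)); first by apply: eq_Rintegral => x _; rewrite mul1r.
  by rewrite ieq// (density_int_cst 1 df).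
Qed.

(** The minimizer has mass beyond some s between t and b, so [minimizer_gap]
    separates the energies of all competitors on [0, t] from its own by a fixed
    amount, which survives in the infimum. *)
Lemma min_density_energy_below theta U (B s0 : R) f b : 0 < theta ->
  measurable_fun [set: R] U -> (forall x, `|U x| <= B) ->
  density theta^-1 s0 f ->
  (forall g, density theta^-1 s0 g -> density_energy theta U f <= density_energy theta U g) ->
  (forall e, 0 < e -> 0 < \int[mu]_(y in `]b - e, b + e[) f y) ->
  forall t, theta <= t -> t < b ->
  density_energy theta U f < min_density_energy theta U t.
Proof.
move=> theta0 mU UB df fmin Sb t tht tb.
have t0 : 0 < t by exact: lt_le_trans tht.
have /andP[_ bs0] := density_support_itv df Sb.
pose s := (t + b) / 2.
have ts : t < s by rewrite /s; lra.
have sb : s < b by rewrite /s; lra.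
have ms : 0 < \int[mu]_(x in `]s, s0]) f x.
  have e0 : 0 < b - s by rewrite subr_gt0.
  apply: (lt_le_trans (Sb _ e0)); apply: (density_mass_subset df) => //.
  move=> x [/=]; rewrite !in_itv/= => /andP[h _] /andP[_ ->]; rewrite andbT; lra.
have [c c0 hc] := minimizer_gap theta0 (ltW t0) ts (le_trans (ltW sb) bs0) mU UB df ms fmin.
rewrite (@lt_le_trans _ _ (density_energy theta U f + c)) ?ltrDl//.
have [g dg] := density_uniform theta0 tht.
apply: lb_le_inf; first by exists (density_energy theta U g), g.
by move=> _ [h dh <-]; exact: hc.
Qed.

(** The minimizer has no mass beyond t, so that it competes on [0, t] itself after a
    change on a null set. *)
Lemma min_density_energy_above theta U (B s0 : R) f b : 0 < theta -> 
  measurable_fun [set: R] U -> (forall x, `|U x| <= B) ->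
  density theta^-1 s0 f ->
  (forall g, density theta^-1 s0 g -> density_energy theta U f <= density_energy theta U g) ->
  (forall x, b < x -> exists2 e : R, 0 < e & \int[mu]_(y in `]x - e, x + e[) f y <= 0) ->
  forall t, b <= t <= s0 ->
  min_density_energy theta U t = density_energy theta U f.
Proof.
move=> theta0 mU UB df fmin Hb t /andP[bt ts].
have tail : \int[mu]_(x in `]t, s0]) f x = 0.
  apply: (density_tail0 theta0 df) => // x tx; apply: Hb.
  exact: le_lt_trans tx.
have [g dg Eg] := density_truncate theta0 ts mU df tail.
apply/eqP; rewrite eq_le; apply/andP; split.
  by rewrite -Eg; exact: (min_density_energy_le theta0 mU UB).
apply: lb_le_inf; first by exists (density_energy theta U g), g.
by move=> _ [h dh <-]; apply: fmin; exact: density_sub dh.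
Qed.

Lemma min_energy_rightmost theta V U (B s0 : R) phi b : 0 < theta ->
  measurable_fun [set: R] U -> (forall x, `|U x| <= B) ->
  (forall x, 0 <= x <= s0 -> V x = U x) ->
  is_equilibrium theta V s0 phi -> is_rightmost (density_support s0 phi) b ->
  (forall t, theta <= t < b -> min_energy theta V t > min_energy theta V s0) /\
  (forall t, b <= t <= s0 -> min_energy theta V t = min_energy theta V s0).
Proof.
move=> theta0 mU UB VU [aphi phimin] [Sb ubb].
have [f [df Ef mf]] := admissible_ae_density theta0 aphi.
have fmin g : density theta^-1 s0 g -> density_energy theta U f <= density_energy theta U g.
  move=> dg; rewrite -(Ef V U mU VU) -(energyE theta VU); last by case: dg.
  exact: phimin (admissible_density dg).
have Sbf e : 0 < e -> 0 < \int[mu]_(y in `]b - e, b + e[) f y.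
  by move=> e0; rewrite -mf//; exact: Sb.
have /andP[_ bs0] := density_support_itv df Sbf.
have out x : b < x -> exists2 e : R, 0 < e & \int[mu]_(y in `]x - e, x + e[) f y <= 0.
  move=> bx; apply: contrapT => H; have : x <= b; last by rewrite leNgt bx.
  apply: ubb => e e0; rewrite mf// ltNge; apply/negP => h.
  by apply: H; exists e.
have minE t : t <= s0 -> min_energy theta V t = min_density_energy theta U t.
  move=> ts; apply: min_energyE => // x /andP[x0 xt].
  by rewrite VU// x0 (le_trans xt).
have above := min_density_energy_above theta0 mU UB df fmin out.
split=> t /andP[h1 h2].
  rewrite (minE t) ?(le_trans (ltW h2))// (minE s0)// (above s0) ?bs0 ?lexx//.
  exact: (min_density_energy_below theta0 mU UB df fmin Sbf).
by rewrite !minE// (above t) ?h1 ?h2// (above s0) ?bs0 ?lexx.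
Qed.

End Main.

(** * Probabilities as quotients of partition functions *)

Lemma gibbs_probE {R : realType} theta N M (VN : R -> R) (E : pred {ffun 'I_N -> 'I_M.+1}) :
  gibbs_prob theta VN E =
  (\sum_(lambda in configurations N M | E lambda) gibbs_weight theta VN lambda) /
  (\sum_(lambda in configurations N M | xpredT lambda) gibbs_weight theta VN lambda).
Proof.
rewrite /gibbs_prob -mulr_suml /partition_function; congr (_ / _).
by apply: eq_bigl => lambda; rewrite andbT.
Qed.

Lemma particle_le {R : realType} (theta : R) N M (lambda : {ffun 'I_N -> 'I_M.+1}) i :
  0 <= theta -> particle theta lambda i <= M%:R + (N - 1)%:R * theta.
Proof.
move=> theta0; rewrite /particle lerD//.
  by rewrite ler_nat -ltnS ltn_ord.
by rewrite ler_wpM2r// ler_nat leq_sub2l.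
Qed.

Lemma cvg_rate {R : realType} (p q : nat -> R) A1 A2 :
  p @ \oo --> 0 -> q @ \oo --> 0 ->
  (fun n => (Num.sqrt n.+1%:R)^-1 + A2 * p n.+1 + A1 * q n.+1) @ \oo --> 0.
Proof.
move=> p0 q0.
have c1 (A : R) (u : nat -> R) : u @ \oo --> 0 -> (fun n => A * u n.+1) @ \oo --> 0.
  move=> u0; rewrite -(mulr0 A); apply: cvgMr; by move: u0; rewrite -cvg_shiftS.
have c2 : (fun n => (Num.sqrt n.+1%:R)^-1) @ \oo --> (0 : R).
  have h := @continuous_cvg _ _ _ _ _ (@harmonic R) Num.sqrt 0 (@sqrt_continuous R 0) (@cvg_harmonic R).
  rewrite sqrtr0 in h; apply: cvg_trans; [apply: near_eq_cvg|exact: h].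
  by apply: nearW => n; rewrite /= sqrtrV.
rewrite -(addr0 0); apply: cvgD; last exact: c1.
by rewrite -(addr0 0); apply: cvgD; last exact: c1.
Qed.

Lemma ln_ratio_dist {R : realType} (a b c x y e : R) : `|a - c + x| <= e / 2 ->
  `|b - c + y| <= e / 2 -> `|y - x - (a - b)| <= e.
Proof.
by rewrite !ler_norml => /andP[a1 a2] /andP[b1 b2]; apply/andP; split; lra.
Qed.

Section Deviation.
Context {R : realType}.
Variables (theta A1 A2 m B : R) (M : nat -> nat) (p q : nat -> R) (VN : nat -> R -> R).
Variables V U : R -> R.
Hypothesis theta0 : 0 < theta.
Hypothesis m0 : 0 <= m.
Hypothesis A20 : 0 <= A2.
Hypothesis A10 : 0 <= A1.
Hypothesis q0 : forall N, (0 < N)%N -> 0 <= q N.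
Hypothesis p0 : forall N, (0 < N)%N -> 0 <= p N.
Hypothesis M_cvg : forall N, (0 < N)%N -> `|N%:R^-1 * (M N)%:R - m| <= A1 * q N.
Hypothesis VN_U : forall (N : nat) (s : R), (0 < N)%N ->
    s \in `[0, (M N)%:R / N%:R + (N - 1)%:R / N%:R * theta] ->
    `|VN N s - U s| <= A2 * p N.
Hypothesis p_cvg0 : p @ \oo --> 0.
Hypothesis q_cvg0 : q @ \oo --> 0.
Hypothesis mU : measurable_fun [set: R] U.
Hypothesis UB : forall x, `|U x| <= B.
Hypothesis qU : quasi_lipschitz U.

Lemma particle_itv N (lambda : {ffun 'I_N -> 'I_(M N).+1}) i :
  particle theta lambda i / N%:R \in
    `[0, (M N)%:R / N%:R + (N - 1)%:R / N%:R * theta].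
Proof.
rewrite in_itv/= divr_ge0 ?particle_ge0 ?(ltW theta0)//=.
rewrite (mulrAC (N - 1)%:R) -mulrDl ler_wpM2r ?invr_ge0//.
exact: particle_le (ltW theta0).
Qed.

(** Both the numerator and the normalization are restricted partition functions, for
    t and for m + theta; in the quotient the terms theta ln N cancel. *)
Lemma cvg_ln_gibbs_prob t : theta <= t <= m + theta ->
  (fun n => (n.+1%:R ^+ 2)^-1 *
     ln (gibbs_prob theta (VN n.+1)
           (fun lambda : {ffun 'I_n.+1 -> 'I_(M n.+1).+1} =>
              particle theta lambda ord0 <= t * n.+1%:R)))
    @ \oo --> min_density_energy theta U (m + theta) - min_density_energy theta U t.
Proof.
move=> ttm; have ttm' : theta <= m + theta <= m + theta by rewrite lexx lerDr m0.
apply/cvgrPdist_le => e e0; have e2 : 0 < e / 2 by rewrite divr_gt0.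
have [r1 r10 H1] := ln_restricted_partition theta0 m0 ttm mU UB qU e2.
have [r2 r20 H2] := ln_restricted_partition theta0 m0 ttm' mU UB qU e2.
have /cvgrPdist_le rate0 := cvg_rate A1 A2 p_cvg0 q_cvg0.
have := rate0 _ r10; have := rate0 _ r20; apply: filterS2 => n.
rewrite !sub0r !normrN => /ler_normlW + /ler_normlW.
(* The three terms of r dominate 1 / sqrt N, V_N - U and M_N / N - m. *)
set r := _ + _ + _ => nr2 nr1.
have N0 : (0 < n.+1)%N by [].
have Ap : 0 <= A2 * p n.+1 by rewrite mulr_ge0// p0.
have Aq : 0 <= A1 * q n.+1 by rewrite mulr_ge0// q0.
have sr0 : 0 <= (Num.sqrt (n.+1%:R : R))^-1 by rewrite invr_ge0 sqrtr_ge0.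
have rs : (Num.sqrt n.+1%:R)^-1 <= r by rewrite /r -addrA lerDl addr_ge0.
have rM : `|n.+1%:R^-1 * (M n.+1)%:R - m| <= r.
  by apply: (le_trans (M_cvg N0)); rewrite /r lerDr addr_ge0.
have rV (lambda : {ffun 'I_n.+1 -> 'I_(M n.+1).+1}) i :
    `|VN n.+1 (particle theta lambda i / n.+1%:R) -
      U (particle theta lambda i / n.+1%:R)| <= r.
  apply: (le_trans (VN_U N0 (particle_itv lambda i))).
  by rewrite /r addrAC lerDr addr_ge0.
have tN (lambda : {ffun 'I_n.+1 -> 'I_(M n.+1).+1}) s :
    particle theta lambda ord0 <= s * n.+1%:R ->
    particle theta lambda ord0 <= (s + r) * n.+1%:R.
  move=> h; apply: (le_trans h); rewrite ler_wpM2r// lerDl.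
  exact: le_trans rs.
have [P0 hP] := H1 n (M n.+1) (VN n.+1)
  (fun lambda => particle theta lambda ord0 <= t * n.+1%:R) r nr1 rs rM rV
  (fun lambda _ => @tN lambda t) (fun _ _ => id).
have [|Z0 hZ] := H2 n (M n.+1) (VN n.+1) xpredT r nr2 rs rM rV _ (fun _ _ _ => isT).
  move=> lambda _ _; apply: (le_trans (particle_le _ _ (ltW theta0))).
  have nn : (0 : R) < n.+1%:R by rewrite ltr0n.
  have := rM; rewrite ler_norml => /andP[_].
  rewrite lerBlDl -(ler_pM2r nn) mulrAC mulVf ?gt_eqF// mul1r => h.
  rewrite (addrAC m) mulrDl lerD// mulrC ler_wpM2l ?(ltW theta0)//.
  by rewrite ler_nat subn1.
rewrite gibbs_probE ln_div ?posrE// mulrBr.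
exact: ln_ratio_dist hP hZ.
Qed.

End Deviation.

Theorem proposition4p2 (R : realType)
  (theta a0 A0 A1 A2 A3 A4 Mbar : R)
  (M : nat -> nat) (p q : nat -> R) (VN : nat -> R -> R) (V : R -> R)
  (theta_gt0 : 0 < theta)
  (a0_gt0 : 0 < a0) (a0_le_A0 : a0 <= A0)
  (Mbar_itv : a0 <= Mbar <= A0)
  (A1_gt0 : 0 < A1) (A2_gt0 : 0 < A2) (A3_gt0 : 0 < A3) (A4_gt0 : 0 < A4)
  (q_itv : forall N, (0 < N)%N -> 0 <= q N <= 1)
  (M_cvg : forall N, (0 < N)%N -> `|N%:R^-1 * (M N)%:R - Mbar| <= A1 * q N)
  (VN_continuous : forall N, (0 < N)%N ->
    {within `[0, (M N)%:R / N%:R + (N - 1)%:R / N%:R * theta],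
      continuous (VN N)})
  (V_continuous : {within `[0, Mbar + theta], continuous V})
  (V_ext : forall x : R, Mbar + theta <= x -> V x = V (Mbar + theta))
  (p_ge0 : forall N, (0 < N)%N -> 0 <= p N)
  (VN_V : forall (N : nat) (s : R), (0 < N)%N ->
    s \in `[0, (M N)%:R / N%:R + (N - 1)%:R / N%:R * theta] ->
    `|VN N s - V s| <= A2 * p N)
  (V_bound : forall s : R, s \in `[0, Mbar + theta] -> `|V s| <= A3)
  (V_derivable : forall s : R, s \in `]0, Mbar + theta[ -> derivable V s 1)
  (V_deriv_bound : forall s : R, s \in `]0, Mbar + theta[ ->
    `|derive1 V s| <= A4 * (1 + `|ln `|s| | + `|ln `|s - Mbar - theta| |))
  (p_cvg0 : p @ \oo --> 0) (q_cvg0 : q @ \oo --> 0) :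
  (forall t : R, theta <= t <= Mbar + theta ->
    (fun n => (n.+1%:R ^+ 2)^-1 *
       ln (gibbs_prob theta (VN n.+1)
             (fun lambda : {ffun 'I_n.+1 -> 'I_(M n.+1).+1} =>
                particle theta lambda ord0 <= t * n.+1%:R)))
      @ \oo --> min_energy theta V (Mbar + theta) - min_energy theta V t) /\
  (forall (phi : R -> R) (b : R), is_equilibrium theta V (Mbar + theta) phi ->
    is_rightmost (density_support (Mbar + theta) phi) b ->
    (forall t : R, theta <= t < b ->
       min_energy theta V t > min_energy theta V (Mbar + theta)) /\
    (forall t : R, b <= t <= Mbar + theta ->
       min_energy theta V t = min_energy theta V (Mbar + theta))).
Proof.
have s00 : 0 <= Mbar + theta.
  have /andP[aM _] := Mbar_itv.
  by rewrite addr_ge0 ?(ltW theta_gt0)// (le_trans (ltW a0_gt0)).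
pose U := clamped V (Mbar + theta).
have UB x : `|U x| <= A3 by exact: clamped_bound.
have mU : measurable_fun [set: R] U.
  exact: continuous_measurable_fun (continuous_clamped s00 V_continuous).
have VU x : 0 <= x <= Mbar + theta -> V x = U x.
  by move=> xs; rewrite /U clampedE.
split; last first.
  move=> phi b; exact: (min_energy_rightmost theta_gt0 mU UB VU).
move=> t /[dup] ttm /andP[tht tm].
have M0 : 0 <= Mbar by have /andP[aM _] := Mbar_itv; exact: le_trans (ltW a0_gt0) aM.
(* V is extended to the right of the interval by a constant, as its clamped version is. *)
have VU0 x : 0 <= x -> V x = U x.
  move=> x0; have [xs|/ltW sx] := leP x (Mbar + theta); first by rewrite VU ?x0.
  by rewrite V_ext// /U /clamped /clamp (min_idPr sx) (max_idPr s00).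
rewrite !(min_energyE theta_gt0 mU); last 2 first.
- by move=> x /andP[x0 xt]; exact: VU0.
- by move=> x /andP[x0 xt]; exact: VU0.
apply: (cvg_ln_gibbs_prob theta_gt0 M0 (ltW A2_gt0) (ltW A1_gt0) _ p_ge0 M_cvg _
  p_cvg0 q_cvg0 mU UB (quasi_lipschitz_clamped s00 V_continuous V_bound) ttm).
  by move=> N N0; have /andP[] := q_itv N N0.
move=> N s N0 sI; rewrite -VU0; first exact: VN_V.
by move: sI; rewrite in_itv/= => /andP[].
Qed.
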